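(* Let $k$ be an algebraically closed field of characteristic zero, $F$ an algebraically closed extension of $k$ of countably infinite transcendence degree, and $G=\mathrm{Aut}(F/k)$. Let $\mathcal{A}$ be an irreducible commutative algebraic group over $k$ and $W_{\mathcal{A}}=\mathcal{A}(F)/\mathcal{A}(k)$. Then $$\mathrm{Ext}^1_{\mathcal{S}m_G}(W_{\mathcal{A}},\mathbb{Q})=\mathrm{Ext}^1_{G,\mathrm{cont}}(W_{\mathcal{A}},\mathbb{Q})=\mathrm{Hom}(\mathcal{A}(k),\mathbb{Q}).$$
   Context: Topology on $G$: for a subfield $k\subseteq K\subseteq F$ put $U_K=\mathrm{Aut}(F/K)$; the subgroups $U_{k(x)}$, $x\in F$, generate the neighbourhoods of $1$ (equivalently, the $U_L$ with $L$ finitely generated over $k$ form a base of neighbourhoods of $1$). Modules are $\mathbb{Q}$-vector spaces; $W_{\mathcal{A}}$ is a $\mathbb{Q}$-vector space with $G$-action, and $\mathbb{Q}$ is the trivial $G$-module. A $G$-module is smooth (resp. continuous) if stabilizers of all its vectors are open (resp. closed). $\mathcal{S}m_G$ is the abelian category of smooth $G$-modules over $\mathbb{Q}$. $\mathrm{Ext}^1_{G,\mathrm{cont}}(W,\mathbb{Q})$ is the group of classes of extensions $0\to\mathbb{Q}\to E\to W\to 0$ of $G$-modules with $E$ continuous. The identification with $\mathrm{Hom}(\mathcal{A}(k),\mathbb{Q})$ is via the connecting map of $0\to\mathcal{A}(k)\otimes\mathbb{Q}\to\mathcal{A}(F)\otimes\mathbb{Q}\to W_{\mathcal{A}}\to 0$.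 *)

(* Defs.v *)
From HB Require Import structures.
From mathcomp Require Import all_boot all_algebra.
From mathcomp Require Import boolp classical_sets functions topology.
From mathcomp Require Import ring_quotient ring.
From mathcomp Require mpoly.

Set Implicit Arguments.
Unset Strict Implicit.
Unset Printing Implicit Defensive.

Import GRing.Theory Num.Theory.

Local Open Scope classical_set_scope.
Local Open Scope quotient_scope.
Local Open Scope ring_scope.

Record subspace (V : lmodType rat) := Subspace {
  subspace_set :> V -> Prop;
  subspace0 : subspace_set 0;
  subspaceD : forall v w, subspace_set v -> subspace_set w -> subspace_set (v + w);
  subspaceZ : forall a v, subspace_set v -> subspace_set (a *: v) }.

Section QuotientSpace.
Variables (V : lmodType rat) (S : subspace V).

Definition subspace_pred : V -> bool := fun v => `[< S v >].

Lemma subspace_zmod_closed : zmod_closed subspace_pred.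
Proof.
split; first by apply/asboolP; exact: subspace0.
move=> v w /asboolP hv /asboolP hw; apply/asboolP.
by apply: subspaceD => //; rewrite -scaleN1r; exact: subspaceZ.
Qed.

HB.instance Definition _ := GRing.isZmodClosed.Build V subspace_pred subspace_zmod_closed.

Definition subspace_closed : zmodClosed V := GRing.ZmodClosed.clone V subspace_pred _.
Definition lquot : Type := Quotient.quot subspace_closed.
HB.instance Definition _ := GRing.Zmodule.on lquot.

Definition lproj : V -> lquot := \pi_(Quotient.quot subspace_closed).

Lemma lproj_is_zmod_morphism : zmod_morphism lproj.
Proof. exact: raddfB. Qed.

Lemma lproj_surj (x : lquot) : exists v, lproj v = x.
Proof. by exists (repr (x : (Quotient.quot subspace_closed))); rewrite /lproj reprK. Qed.

Lemma lproj_eq v w : lproj v = lproj w <-> S (v - w).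
Proof.
split=> [/eqP|h]; rewrite /lproj.
  by rewrite -Quotient.idealrBE => /asboolP.
by apply/eqP; rewrite -Quotient.idealrBE; apply/asboolP.
Qed.

Definition lscale (a : rat) (x : lquot) : lquot :=
  lproj (a *: repr (x : (Quotient.quot subspace_closed))).

Lemma lscale_proj a v : lscale a (lproj v) = lproj (a *: v).
Proof.
apply/lproj_eq; rewrite -scalerBr; apply: subspaceZ.
by apply/lproj_eq; rewrite /lproj reprK.
Qed.

Lemma lprojD : {morph lproj : x y / x + y}.
Proof. exact: raddfD. Qed.

Lemma lscaleA a b v : lscale a (lscale b v) = lscale (a * b) v.
Proof. by have [w <-] := lproj_surj v; rewrite !lscale_proj scalerA. Qed.
Lemma lscale1 : left_id 1 lscale.
Proof. by move=> v; have [w <-] := lproj_surj v; rewrite lscale_proj scale1r. Qed.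
Lemma lscaleDr : right_distributive lscale +%R.
Proof.
move=> a v w; have [v' <-] := lproj_surj v; have [w' <-] := lproj_surj w.
by rewrite -lprojD !lscale_proj -lprojD scalerDr.
Qed.
Lemma lscaleDl v : {morph lscale^~ v : a b / a + b}.
Proof.
by move=> a b; have [w <-] := lproj_surj v; rewrite !lscale_proj -lprojD scalerDl.
Qed.

HB.instance Definition _ :=
  GRing.Zmodule_isLmodule.Build rat lquot lscaleA lscale1 lscaleDr lscaleDl.

Lemma lproj_is_linear : linear lproj.
Proof. by move=> a v w; rewrite lprojD -lscale_proj. Qed.

HB.instance Definition _ := GRing.isLinear.Build rat V lquot *:%R lproj lproj_is_linear.

End QuotientSpace.

(** An abelian group carries a (necessarily unique) structure of rational
    vector space iff multiplication by every positive integer is bijective. *)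

Definition uniquely_divisible (M : zmodType) : Prop :=
  forall n : nat, (0 < n)%N -> bijective (fun x : M => x *+ n).

Section DivisibleModule.
Variables (M : zmodType) (hM : uniquely_divisible M).

Definition divisible_module : Type := let _ := hM in M.
Local Notation D := divisible_module.
HB.instance Definition _ := GRing.Zmodule.copy D M.

Lemma divmod_injz (q : int) : q != 0 -> injective (fun x : D => x *~ q).
Proof.
move=> q0 x y; have q1 : (0 < `|q|)%N by rewrite absz_gt0.
have inj := bij_inj (hM q1).
case: (intP q) q1 inj => [|n|n]; rewrite ?absz0 ?abszN //= => _ inj.
  by move=> h; apply: inj.
by rewrite !mulrNz => /oppr_inj h; apply: inj.
Qed.

Lemma divmod_scale_ex (a : rat) (x : D) : exists y : D, y *~ denq a = x *~ numq a.
Proof.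
have d0 : (0 < `|denq a|)%N by rewrite absz_gt0 denq_neq0.
have [g _ gK] := hM d0; exists (g (x *~ numq a)).
by rewrite -absz_denq; apply: gK.
Qed.

Definition divmod_scale (a : rat) (x : D) : D := projT1 (cid (divmod_scale_ex a x)).

Lemma divmod_scaleP a x : divmod_scale a x *~ denq a = x *~ numq a.
Proof. exact: projT2 (cid (divmod_scale_ex a x)). Qed.

Lemma divmod_scaleE (a : rat) (p q : int) x : q != 0 -> a * q%:~R = p%:~R ->
  divmod_scale a x *~ q = x *~ p.
Proof.
move=> q0 e; apply: (@divmod_injz (denq a)); first exact: denq_neq0.
rewrite /= mulrzAC divmod_scaleP -!mulrzA; congr (_ *~ _).
apply/eqP; rewrite -(eqr_int rat) !intrM -e.
by rewrite -{2}[a]divq_num_den mulrAC divfK ?intr_eq0 ?denq_neq0.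
Qed.

Lemma denq_mulK (a : rat) : a * (denq a)%:~R = (numq a)%:~R.
Proof. by rewrite -{1}[a]divq_num_den divfK // intr_eq0 denq_neq0. Qed.

Lemma divmod_scaleA a b x :
  divmod_scale a (divmod_scale b x) = divmod_scale (a * b) x.
Proof.
have d0 : denq a * denq b != 0 by rewrite mulf_neq0 ?denq_neq0.
apply: (divmod_injz d0) => /=.
rewrite (@divmod_scaleE (a * b) (numq a * numq b)) //; last first.
  by rewrite !intrM mulrACA !denq_mulK.
rewrite mulrzA divmod_scaleP mulrzAC divmod_scaleP -mulrzA.
by rewrite [numq b * _]mulrC.
Qed.

Lemma divmod_scale1 : left_id 1 divmod_scale.
Proof. by move=> x; rewrite -[LHS]mulr1z (@divmod_scaleE _ 1) // mulr1z. Qed.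

Lemma divmod_scaleDr : right_distributive divmod_scale +%R.
Proof.
move=> a x y; apply: (divmod_injz (denq_neq0 a)) => /=.
by rewrite mulrzDl !divmod_scaleP mulrzDl.
Qed.

Lemma divmod_scaleDl x : {morph divmod_scale^~ x : a b / a + b}.
Proof.
move=> a b; have d0 : denq a * denq b != 0 by rewrite mulf_neq0 ?denq_neq0.
apply: (divmod_injz d0) => /=; rewrite mulrzDl.
have -> : divmod_scale a x *~ (denq a * denq b) = x *~ (numq a * denq b).
  by rewrite mulrzA divmod_scaleP -mulrzA.
have -> : divmod_scale b x *~ (denq a * denq b) = x *~ (numq b * denq a).
  by rewrite mulrzA mulrzAC divmod_scaleP -mulrzA.
rewrite -mulrzDr.
apply: divmod_scaleE => //.
by rewrite intrD !intrM mulrDl -!denq_mulK !mulrA; congr (_ + _); rewrite mulrAC.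
Qed.

HB.instance Definition _ := GRing.Zmodule_isLmodule.Build rat D
  divmod_scaleA divmod_scale1 divmod_scaleDr divmod_scaleDl.

End DivisibleModule.

(** [M (x) Q], constructed as the group of fractions [m / n], [n > 0]; the pair
    [(m, a)] stands for [m / (a + 1)]. *)

Section Fractions.
Variable M : zmodType.

Definition torsion (x : M) : Prop := exists n : nat, x *+ n.+1 = 0.

Lemma torsion0 : torsion 0. Proof. by exists 0%N. Qed.

Lemma torsionD x y : torsion x -> torsion y -> torsion (x + y).
Proof.
move=> [n hn] [p hp]; exists (n.+1 * p.+1).-1; rewrite prednK ?muln_gt0 //.
by rewrite mulrnDl {1}mulrnA hn mul0rn mulnC mulrnA hp mul0rn addr0.
Qed.

Lemma torsionMn x n : torsion x -> torsion (x *+ n).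
Proof. by move=> [p hp]; exists p; rewrite -mulrnA mulnC mulrnA hp mul0rn. Qed.

Lemma torsionMnK x n : torsion (x *+ n.+1) -> torsion x.
Proof.
move=> [p hp]; exists (n.+1 * p.+1).-1.
by rewrite prednK ?muln_gt0 // mulrnA.
Qed.

Lemma torsionN x : torsion x -> torsion (- x).
Proof. by move=> [p hp]; exists p; rewrite mulNrn hp oppr0. Qed.

Definition pre_frac : Type := (M * nat)%type.
HB.instance Definition _ := Choice.on pre_frac.

Definition frac_rel (x y : pre_frac) : bool :=
  `[< torsion (x.1 *+ y.2.+1 - y.1 *+ x.2.+1) >].

Lemma frac_rel_equiv : equiv_class_of frac_rel.
Proof.
split=> [[m a]|[m a] [n b]|[n b] [m a] [p c]]; rewrite /frac_rel /=.
- by apply/asboolP; rewrite subrr; apply: torsion0.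
- by apply/asboolP/asboolP => /torsionN; rewrite opprB.
move=> /asboolP h /asboolP h'; apply/asboolP; apply: (@torsionMnK _ b).
have := torsionD (torsionMn c.+1 h) (torsionMn a.+1 h').
congr torsion; rewrite !mulrnBl [n *+ c.+1 *+ _]mulrnAC addrA subrK.
by rewrite mulrnAC [p *+ _ *+ _]mulrnAC.
Qed.

Canonical frac_rel_canonical := EquivRelPack frac_rel_equiv.
Canonical frac_rel_enc := defaultEncModRel frac_rel.

Definition fracs : Type := {eq_quot frac_rel}.
HB.instance Definition _ := Choice.on fracs.

Definition mkfrac (m : M) (a : nat) : fracs := \pi_{eq_quot frac_rel} (m, a).

Lemma mkfrac_eq m a n b :
  mkfrac m a = mkfrac n b <-> torsion (m *+ b.+1 - n *+ a.+1).
Proof.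
split; first by move=> /eqquotP /asboolP.
by move=> h; apply/eqquotP/asboolP.
Qed.

Definition fnum (x : fracs) : M := (repr (x : {eq_quot frac_rel})).1.
Definition fden (x : fracs) : nat := (repr (x : {eq_quot frac_rel})).2.

Lemma mkfracK x : mkfrac (fnum x) (fden x) = x.
Proof. by rewrite /mkfrac -surjective_pairing reprK. Qed.

Lemma mkfrac_scale m a n : mkfrac (m *+ n.+1) (a.+1 * n.+1).-1 = mkfrac m a.
Proof.
apply/mkfrac_eq; rewrite prednK ?muln_gt0 // -mulrnA mulnC subrr.
exact: torsion0.
Qed.

Definition frac_add (x y : fracs) : fracs :=
  mkfrac (fnum x *+ (fden y).+1 + fnum y *+ (fden x).+1)
         ((fden x).+1 * (fden y).+1).-1.
Definition frac_opp (x : fracs) : fracs := mkfrac (- fnum x) (fden x).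

Lemma frac_addE m a n b : frac_add (mkfrac m a) (mkfrac n b) =
  mkfrac (m *+ b.+1 + n *+ a.+1) (a.+1 * b.+1).-1.
Proof.
have /mkfrac_eq h1 := mkfracK (mkfrac m a).
have /mkfrac_eq h2 := mkfracK (mkfrac n b).
move: h1 h2; rewrite /frac_add.
set m' := fnum _; set a' := fden _; set n' := fnum _; set b' := fden _ => h1 h2.
apply/mkfrac_eq; rewrite !prednK ?muln_gt0 //.
have := torsionD (torsionMn (b'.+1 * b.+1) h1) (torsionMn (a'.+1 * a.+1) h2).
congr torsion; rewrite !mulrnBl !mulrnDl opprD -!mulrnA addrACA.
by congr (_ + _ + (_ + _)); do ?congr (- _); congr GRing.natmul; ring.
Qed.

Lemma frac_addA : associative frac_add.
Proof.
move=> x y z; rewrite -[x]mkfracK -[y]mkfracK -[z]mkfracK !frac_addE.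
rewrite !prednK ?muln_gt0 // !mulrnDl -!mulrnA addrA mulnA.
by congr (mkfrac (_ *+ _ + _ *+ _ + _ *+ _) _); rewrite mulnC.
Qed.

Lemma frac_addC : commutative frac_add.
Proof. by move=> x y; rewrite /frac_add addrC mulnC. Qed.

Lemma frac_add0 : left_id (mkfrac 0 0) frac_add.
Proof.
by move=> x; rewrite -[x]mkfracK frac_addE mul0rn add0r mulr1n mul1n.
Qed.

Lemma frac_addN : left_inverse (mkfrac 0 0) frac_opp frac_add.
Proof.
move=> x; rewrite -{2}[x]mkfracK frac_addE mulNrn addNr; apply/mkfrac_eq.
by rewrite !mul0rn subr0; apply: torsion0.
Qed.

HB.instance Definition _ := GRing.isZmodule.Build fracs
  frac_addA frac_addC frac_add0 frac_addN.

Lemma mkfracD m a n b : mkfrac m a + mkfrac n b =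
  mkfrac (m *+ b.+1 + n *+ a.+1) (a.+1 * b.+1).-1.
Proof. exact: frac_addE. Qed.

Definition mkfrac_over (a : nat) (m : M) : fracs := mkfrac m a.

Lemma mkfrac_is_zmod_morphism a : zmod_morphism (mkfrac_over a).
Proof.
move=> m n; rewrite /mkfrac_over; apply: (addIr (mkfrac n a)); rewrite subrK mkfracD.
by rewrite mulrnBl subrK mkfrac_scale.
Qed.

HB.instance Definition _ a :=
  GRing.isZmodMorphism.Build M fracs (mkfrac_over a) (mkfrac_is_zmod_morphism a).

Lemma mkfracMn m a n : mkfrac m a *+ n = mkfrac (m *+ n) a.
Proof. exact: (esym (raddfMn (mkfrac_over a) n m)). Qed.

Lemma mkfrac_eq0 m a : mkfrac m a = 0 <-> torsion m.
Proof.
rewrite -[0]/(mkfrac 0 0) mkfrac_eq mulr1n mul0rn subr0; exact: iff_refl.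
Qed.

Lemma fracs_uniquely_divisible : uniquely_divisible fracs.
Proof.
move=> [//|n] _.
have inj : injective (fun x : fracs => x *+ n.+1).
  move=> x y /eqP; rewrite -subr_eq0 -mulrnBl => h.
  apply/eqP; rewrite -subr_eq0; move: h; rewrite -[x - y]mkfracK mkfracMn.
  by move=> /eqP /mkfrac_eq0 /torsionMnK h; apply/eqP/mkfrac_eq0.
have gK : cancel (fun x => mkfrac (fnum x) ((fden x).+1 * n.+1).-1)
                 (fun x : fracs => x *+ n.+1).
  by move=> x; rewrite mkfracMn mkfrac_scale mkfracK.
by exists (fun x => mkfrac (fnum x) ((fden x).+1 * n.+1).-1) => // x; apply: inj; rewrite gK.
Qed.

Definition tensorQ : lmodType rat := divisible_module fracs_uniquely_divisible.

Definition frac (m : M) (a : nat) : tensorQ := mkfrac m a.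

End Fractions.

Section FractionMaps.
Variables (M : zmodType).
Implicit Types (V W : lmodType rat).

Lemma frac_ex (x : tensorQ M) : exists m a, x = frac m a.
Proof. by exists (fnum x), (fden x); rewrite /frac mkfracK. Qed.

Lemma frac_ex2 (x y : tensorQ M) : exists m n a, x = frac m a /\ y = frac n a.
Proof.
have [m [a ->]] := frac_ex x; have [n [b ->]] := frac_ex y.
exists (m *+ b.+1), (n *+ a.+1), (a.+1 * b.+1).-1; split.
  by rewrite /frac mkfrac_scale.
by rewrite mulnC /frac mkfrac_scale.
Qed.

Lemma fracB (m n : M) a : frac (m - n) a = frac m a - frac n a.
Proof. exact: (raddfB (@mkfrac_over M a)). Qed.

Lemma fracMn (m : M) a n : frac m a *+ n = frac (m *+ n) a.
Proof. exact: (mkfracMn m a n). Qed.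

(** The linear map [m / (a + 1) |-> (a + 1)^-1 *: f m] extending [f]. *)

Section Lift.
Variables (V : lmodType rat) (f : {additive M -> V}).

Definition tensorQ_lift (x : tensorQ M) : V :=
  ((fden x).+1%:R)^-1 *: f (fnum x).

Lemma scale_natK (a : nat) (v : V) : (a.+1%:R)^-1 *: (v *+ a.+1) = v.
Proof. by rewrite -scaler_nat scalerA mulVf ?scale1r // pnatr_eq0. Qed.

Lemma scale_nat_inj a : injective (fun v : V => v *+ a.+1).
Proof. by move=> v w /= h; rewrite -(scale_natK a v) h scale_natK. Qed.

Lemma additive_torsion m : torsion m -> f m = 0.
Proof. by move=> [n h]; apply: (@scale_nat_inj n); rewrite /= -raddfMn h raddf0 mul0rn. Qed.

Lemma tensorQ_lift_frac m a : tensorQ_lift (frac m a) = (a.+1%:R)^-1 *: f m.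
Proof.
have /mkfrac_eq /additive_torsion /eqP := mkfracK (frac m a).
rewrite /tensorQ_lift; set m' := fnum _; set a' := fden _.
rewrite raddfB subr_eq0 !(raddfMn f) => /eqP h.
by rewrite -[f m](scale_natK a') -h [in RHS]scalerA mulrC -scalerA scale_natK.
Qed.

Lemma tensorQ_lift_is_zmod_morphism : zmod_morphism tensorQ_lift.
Proof.
move=> x y; have [m [n [a [-> ->]]]] := frac_ex2 x y.
by rewrite -fracB !tensorQ_lift_frac raddfB scalerBr.
Qed.

HB.instance Definition _ :=
  GRing.isZmodMorphism.Build (tensorQ M) V tensorQ_lift tensorQ_lift_is_zmod_morphism.
HB.instance Definition _ := GRing.isScalable.Build rat (tensorQ M) V *:%R tensorQ_lift
  (rat_linear tensorQ_lift_is_zmod_morphism).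

End Lift.
End FractionMaps.

Definition frac1 (M : zmodType) (m : M) : tensorQ M := frac m 0.

Section TensorMap.
Variables (M N : zmodType) (f : {additive M -> N}).

Lemma frac1_is_zmod_morphism (P : zmodType) : zmod_morphism (@frac1 P).
Proof. by move=> x y; rewrite /frac1 fracB. Qed.

HB.instance Definition _ (P : zmodType) :=
  GRing.isZmodMorphism.Build P (tensorQ P) (@frac1 P) (@frac1_is_zmod_morphism P).

Definition tensorQ_map : {linear tensorQ M -> tensorQ N} :=
  tensorQ_lift (@frac1 N \o f).

Lemma frac_frac1 (m : N) a : frac m a = (a.+1%:R)^-1 *: frac1 m.
Proof.
apply: (@scale_nat_inj (tensorQ N) a); rewrite /= scalerMnl -mulr_natr mulVf ?pnatr_eq0 //.
by rewrite scale1r /frac1 fracMn; apply/mkfrac_eq; rewrite mulr1n subrr; exists 0%N; rewrite mul0rn.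
Qed.

Lemma tensorQ_map_frac m a : tensorQ_map (frac m a) = frac (f m) a.
Proof. by rewrite [LHS]tensorQ_lift_frac frac_frac1. Qed.

Lemma frac_eq0 m a : frac m a = 0 :> tensorQ N <-> torsion m.
Proof. exact: mkfrac_eq0. Qed.

Lemma tensorQ_map_inj : injective f -> injective tensorQ_map.
Proof.
move=> finj; suff ker x : tensorQ_map x = 0 -> x = 0 by exact: raddf_inj ker.
have [m [a ->]] := frac_ex x.
rewrite tensorQ_map_frac => /mkfrac_eq0 [n h]; apply/mkfrac_eq0; exists n.
by apply: finj; rewrite raddfMn h raddf0.
Qed.

End TensorMap.

Record gmodule (G : groupType) := GModule {
  gcarrier :> lmodType rat;
  gact : G -> gcarrier -> gcarrier;
  gact_linear : forall g, linear (gact g);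
  gact1 : forall v, gact 1%g v = v;
  gactM : forall g h v, gact (g * h)%g v = gact g (gact h v) }.

HB.instance Definition _ (G : groupType) (M : gmodule G) (g : G) :=
  GRing.isLinear.Build rat M M *:%R (gact g) (gact_linear g).

Record ghom (G : groupType) (M N : gmodule G) := GHom {
  ghom_linear :> {linear M -> N};
  ghomP : forall g v, ghom_linear (gact g v) = gact g (ghom_linear v) }.

Definition trivial_gmodule (G : groupType) (V : lmodType rat) : gmodule G :=
  @GModule G V (fun _ v => v) (fun _ _ _ _ => erefl) (fun _ => erefl)
           (fun _ _ _ => erefl).

Definition gstabilizer (G : groupType) (M : gmodule G) (v : M) : set G :=
  [set g | gact g v = v].

(** [0 -> N -> ext_mid -> W -> 0]. *)

Record extension (G : groupType) (W N : gmodule G) := Extension {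
  ext_mid : gmodule G;
  ext_in : ghom N ext_mid;
  ext_out : ghom ext_mid W;
  ext_in_inj : injective ext_in;
  ext_out_surj : forall w, exists e, ext_out e = w;
  ext_exact : forall e, ext_out e = 0 <-> exists n, ext_in n = e }.

Section Extensions.
Variable G : groupType.
Implicit Types M N W : gmodule G.

Definition ext_equiv W N (E E' : extension W N) : Prop :=
  exists f : ghom (ext_mid E) (ext_mid E'),
    (forall n, f (ext_in E n) = ext_in E' n) /\
    (forall e, ext_out E' (f e) = ext_out E e).

Lemma ext_equiv_refl W N (E : extension W N) : ext_equiv E E.
Proof. by exists (@GHom _ _ _ [the {linear _ -> _} of idfun] (fun _ _ => erefl)). Qed.

Lemma ext_equiv_trans W N (E1 E2 E3 : extension W N) :
  ext_equiv E1 E2 -> ext_equiv E2 E3 -> ext_equiv E1 E3.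
Proof.
move=> [f [f1 f2]] [g [g1 g2]].
have gfP s v : (g \o f) (gact s v) = gact s ((g \o f) v) by rewrite /= !ghomP.
exists (@GHom _ _ _ [the {linear _ -> _} of g \o f] gfP); split=> x /=.
  by rewrite f1 g1.
by rewrite g2 f2.
Qed.

Lemma ext_equiv_bij W N (E E' : extension W N) (f : ghom (ext_mid E) (ext_mid E')) :
  (forall n, f (ext_in E n) = ext_in E' n) ->
  (forall e, ext_out E' (f e) = ext_out E e) ->
  injective f /\ forall e', exists e, f e = e'.
Proof.
move=> f1 f2; split.
  suff ker x : f x = 0 -> x = 0 by exact: raddf_inj ker.
  move=> fx0; have /ext_exact [n nx] : ext_out E x = 0 by rewrite -f2 fx0 raddf0.
  move: fx0; rewrite -nx f1 -[X in _ = X](raddf0 (ext_in E')) => /ext_in_inj ->.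
  by rewrite raddf0.
move=> e'; have [e ee'] := ext_out_surj E (ext_out E' e').
have /ext_exact [n hn] : ext_out E' (e' - f e) = 0 by rewrite raddfB /= f2 ee' subrr.
by exists (ext_in E n + e); rewrite raddfD /= f1 hn subrK.
Qed.

Lemma ext_equiv_sym W N (E E' : extension W N) : ext_equiv E E' -> ext_equiv E' E.
Proof.
move=> [f [f1 f2]]; have [finj fsurj] := ext_equiv_bij f1 f2.
pose g e' := projT1 (cid (fsurj e')).
have fg e' : f (g e') = e' by exact: projT2 (cid (fsurj e')).
have glin : linear g by move=> a x y; apply: finj; rewrite linearP !fg.
pose gL : {linear ext_mid E' -> ext_mid E} :=
  HB.pack g (GRing.isLinear.Build rat _ _ *:%R g glin).
have gP s v : gL (gact s v) = gact s (gL v).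
  by apply: finj; rewrite ghomP /= !fg.
exists (GHom gP); split=> x /=; first by apply: finj; rewrite fg f1.
by rewrite -f2 fg.
Qed.

Definition Ext1 W N : Type :=
  {c : extension W N -> Prop | exists E, c = ext_equiv E}.

Definition ext_class W N (E : extension W N) : Ext1 W N :=
  exist _ (ext_equiv E) (ex_intro _ E erefl).

Lemma ext_classP W N (E E' : extension W N) :
  ext_class E = ext_class E' <-> ext_equiv E E'.
Proof.
split=> [[h]|h].
  by rewrite h; exact: ext_equiv_refl.
apply: eq_exist; apply/funext => F; apply/propext; split=> hF.
  exact: ext_equiv_trans (ext_equiv_sym h) hF.
exact: ext_equiv_trans h hF.
Qed.

Lemma ext_class_surj W N (c : Ext1 W N) : exists E, ext_class E = c.
Proof. by case: c => c [E hE]; exists E; apply: eq_exist. Qed.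

Definition ext_repr W N (c : Ext1 W N) : extension W N :=
  projT1 (cid (ext_class_surj c)).

Lemma ext_reprK W N (c : Ext1 W N) : ext_class (ext_repr c) = c.
Proof. exact: projT2 (cid (ext_class_surj c)). Qed.

End Extensions.

Section ProductModule.
Variables (G : groupType) (M N : gmodule G).

Definition prod_act (g : G) (x : M * N) : M * N := (gact g x.1, gact g x.2).

Lemma prod_act_linear g : linear (prod_act g).
Proof. by move=> a x y; rewrite /prod_act !linearP. Qed.

Lemma prod_act1 x : prod_act 1%g x = x.
Proof. by case: x => x y; rewrite /prod_act !gact1. Qed.

Lemma prod_actM g h x : prod_act (g * h)%g x = prod_act g (prod_act h x).
Proof. by rewrite /prod_act !gactM. Qed.

Definition prod_gmodule : gmodule G := @GModule G (M * N)%type prod_act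
  prod_act_linear prod_act1 prod_actM.

End ProductModule.

Section QuotientGModule.
Variables (G : groupType) (M : gmodule G) (S : subspace M).
Hypothesis S_stable : forall g v, S v -> S (gact g v).

Definition quot_act (g : G) (x : lquot S) : lquot S :=
  lproj S (gact g (repr (x : Quotient.quot (subspace_closed S)))).

Lemma quot_act_proj g v : quot_act g (lproj S v) = lproj S (gact g v).
Proof.
apply/lproj_eq; rewrite -raddfB; apply: S_stable.
by apply/lproj_eq; rewrite /lproj reprK.
Qed.

Lemma quot_act_linear g : linear (quot_act g).
Proof.
move=> a x y; have [v <-] := lproj_surj x; have [w <-] := lproj_surj y.
by rewrite -linearP !quot_act_proj !linearP.
Qed.

Lemma quot_act1 x : quot_act 1%g x = x.
Proof. by have [v <-] := lproj_surj x; rewrite quot_act_proj gact1. Qed.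

Lemma quot_actM g h x : quot_act (g * h)%g x = quot_act g (quot_act h x).
Proof. by have [v <-] := lproj_surj x; rewrite !quot_act_proj gactM. Qed.

Definition quot_gmodule : gmodule G :=
  @GModule G (lquot S) quot_act quot_act_linear quot_act1 quot_actM.

End QuotientGModule.

Section SubGModule.
Variables (G : groupType) (M : gmodule G) (S : subspace M).
Hypothesis S_stable : forall g v, S v -> S (gact g v).

Lemma subspace_submod_closed : subsemimod_closed (subspace_pred S).
Proof.
split; last by move=> a v /asboolP h; apply/asboolP; exact: subspaceZ.
split; first by apply/asboolP; exact: subspace0.
by move=> v w /asboolP hv /asboolP hw; apply/asboolP; exact: subspaceD.
Qed.

Record sub_carrier := SubCarrier {
  sub_val : M;
  sub_valP : subspace_pred S sub_val }.

HB.instance Definition _ := [isSub for sub_val].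
HB.instance Definition _ := [Choice of sub_carrier by <:].
HB.instance Definition _ := GRing.SubChoice_isSubLmodule.Build rat M
  (subspace_pred S) sub_carrier subspace_submod_closed.

Lemma sub_act_subproof g (x : sub_carrier) : subspace_pred S (gact g (sub_val x)).
Proof. by apply/asboolP/S_stable/asboolP; exact: sub_valP. Qed.

Definition sub_act g (x : sub_carrier) : sub_carrier := SubCarrier (sub_act_subproof g x).

Lemma sub_act_linear g : linear (sub_act g).
Proof. by move=> a x y; apply: val_inj; rewrite /= linearP. Qed.

Lemma sub_act1 x : sub_act 1%g x = x.
Proof. by apply: val_inj; rewrite /= gact1. Qed.

Lemma sub_actM g h x : sub_act (g * h)%g x = sub_act g (sub_act h x).
Proof. by apply: val_inj; rewrite /= gactM. Qed.

Definition sub_gmodule : gmodule G :=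
  @GModule G sub_carrier sub_act sub_act_linear sub_act1 sub_actM.

End SubGModule.

Section ExtensionSum.
Variables (G : groupType) (W W' N N' : gmodule G).
Variables (E : extension W N) (E' : extension W' N').

Definition sum_in (x : N * N') : ext_mid E * ext_mid E' :=
  (ext_in E x.1, ext_in E' x.2).
Definition sum_out (x : ext_mid E * ext_mid E') : W * W' :=
  (ext_out E x.1, ext_out E' x.2).

Lemma sum_in_linear : linear sum_in.
Proof. by move=> a x y; rewrite /sum_in !linearP. Qed.
Lemma sum_out_linear : linear sum_out.
Proof. by move=> a x y; rewrite /sum_out !linearP. Qed.

HB.instance Definition _ := GRing.isLinear.Build rat (N * N')%type
  (ext_mid E * ext_mid E')%type *:%R sum_in sum_in_linear.
HB.instance Definition _ := GRing.isLinear.Build rat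
  (ext_mid E * ext_mid E')%type (W * W')%type *:%R sum_out sum_out_linear.

Definition sum_in_hom : ghom (prod_gmodule N N') (prod_gmodule (ext_mid E) (ext_mid E')).
Proof.
exists [the {linear _ -> _} of sum_in] => g x.
by rewrite /= /sum_in /prod_act !ghomP.
Defined.

Definition sum_out_hom : ghom (prod_gmodule (ext_mid E) (ext_mid E')) (prod_gmodule W W').
Proof.
exists [the {linear _ -> _} of sum_out] => g x.
by rewrite /= /sum_out /prod_act !ghomP.
Defined.

Lemma sum_in_inj : injective sum_in_hom.
Proof.
by move=> [x x'] [y y'] [] /ext_in_inj -> /ext_in_inj ->.
Qed.

Lemma sum_out_surj w : exists e, sum_out_hom e = w.
Proof.
case: w => w w'; have [e <-] := ext_out_surj E w.
by have [e' <-] := ext_out_surj E' w'; exists (e, e').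
Qed.

Lemma sum_exact e : sum_out_hom e = 0 <-> exists n, sum_in_hom n = e.
Proof.
case: e => e e'; split=> [[/ext_exact [n <-] /ext_exact [n' <-]]|[[n n'] [<- <-]]].
  by exists (n, n').
by congr pair; apply/ext_exact; [exists n | exists n'].
Qed.

Definition ext_sum : extension (prod_gmodule W W') (prod_gmodule N N') :=
  Extension sum_in_inj sum_out_surj sum_exact.

End ExtensionSum.

Section Pullback.
Variables (G : groupType) (W W' N : gmodule G).
Variables (h : ghom W' W) (E : extension W N).
Local Notation P := (prod_gmodule (ext_mid E) W').

Definition pull_set (x : P) : Prop := ext_out E x.1 = h x.2.

Definition pull_subspace : subspace P.
Proof.
apply: (@Subspace P pull_set); rewrite /pull_set /=.
- by rewrite !raddf0.
- by move=> x y hx hy; rewrite !raddfD /= hx hy.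
- by move=> a x hx; rewrite !linearZ /= hx.
Defined.

Lemma pull_stable g (x : P) : pull_subspace x -> pull_subspace (gact g x).
Proof. by rewrite /= /pull_set /= !ghomP => ->. Qed.

Definition pull_mid : gmodule G := sub_gmodule pull_stable.

Lemma pull_in_subproof (n : N) : subspace_pred pull_subspace ((ext_in E n, 0) : P).
Proof. by apply/asboolP; rewrite /= /pull_set /= raddf0; apply/ext_exact; exists n. Qed.

Definition pull_in (n : N) : pull_mid := SubCarrier (pull_in_subproof n).
Definition pull_out (x : pull_mid) : W' := (sub_val x).2.

Lemma pull_in_linear : linear pull_in.
Proof.
move=> a x y; apply: val_inj => /=.
have e : 0 = a *: 0 + 0 :> W' by rewrite scaler0 addr0.
by rewrite linearP {1}e.
Qed.
Lemma pull_out_linear : linear pull_out. Proof. by []. Qed.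

HB.instance Definition _ := GRing.isLinear.Build rat N pull_mid *:%R pull_in pull_in_linear.
HB.instance Definition _ := GRing.isLinear.Build rat pull_mid W' *:%R pull_out pull_out_linear.

Definition pull_in_hom : ghom N pull_mid.
Proof.
exists [the {linear _ -> _} of pull_in] => g x; apply: val_inj => /=.
by rewrite /prod_act /= ghomP raddf0.
Defined.

Definition pull_out_hom : ghom pull_mid W'.
Proof. by exists [the {linear _ -> _} of pull_out]. Defined.

Lemma pull_in_inj : injective pull_in_hom.
Proof. by move=> x y [] /ext_in_inj. Qed.

Lemma pull_out_surj w : exists e, pull_out_hom e = w.
Proof.
have [e he] := ext_out_surj E (h w).
have hew : subspace_pred pull_subspace ((e, w) : P) by apply/asboolP.
by exists (SubCarrier hew).
Qed.

Lemma pull_exact e : pull_out_hom e = 0 <-> exists n, pull_in_hom n = e.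
Proof.
split=> [|[n <-]//]; case: e => -[e w] /= he; rewrite /pull_out /= => w0.
have /ext_exact [n hn] : ext_out E e = 0.
  by move/asboolP: (he); rewrite /= /pull_set /= w0 raddf0.
by exists n; apply: val_inj; rewrite /= hn w0.
Qed.

Definition ext_pull : extension W' N := Extension pull_in_inj pull_out_surj pull_exact.

End Pullback.

Section Pushout.
Variables (G : groupType) (W N N' : gmodule G).
Variables (f : ghom N N') (E : extension W N).
Local Notation P := (prod_gmodule N' (ext_mid E)).

Definition push_set (x : P) : Prop := exists n, x = (f n, - ext_in E n).

Definition push_subspace : subspace P.
Proof.
apply: (@Subspace P push_set); rewrite /push_set.
- by exists 0; rewrite !raddf0.
- by move=> x y [n ->] [p ->]; exists (n + p); rewrite !raddfD.
- by move=> a x [n ->]; exists (a *: n); rewrite !linearZ /=; congr pair; rewrite ?scalerN.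
Defined.

Lemma push_stable g (x : P) : push_subspace x -> push_subspace (gact g x).
Proof. by move=> [n ->]; exists (gact g n); rewrite !ghomP /= /prod_act /= raddfN. Qed.

Definition push_mid : gmodule G := quot_gmodule push_stable.

Definition push_mk (x : N') (e : ext_mid E) : push_mid := lproj push_subspace ((x, e) : P).

Lemma push_mk_surj z : exists x e, push_mk x e = z.
Proof. by have [[x e] <-] := lproj_surj z; exists x, e. Qed.

Lemma push_mk_eq x e y e' : push_mk x e = push_mk y e' <->
  exists n, x - y = f n /\ e - e' = - ext_in E n.
Proof.
split=> [/lproj_eq [n [h1 h2]]|[n [h1 h2]]]; first by exists n.
by apply/lproj_eq; exists n; congr pair.
Qed.

Lemma push_mkP a x e y e' :
  a *: push_mk x e + push_mk y e' = push_mk (a *: x + y) (a *: e + e').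
Proof. exact: esym (@lproj_is_linear _ push_subspace a (x, e) (y, e')). Qed.

Lemma push_mk_act g x e : gact g (push_mk x e) = push_mk (gact g x) (gact g e).
Proof. exact: (quot_act_proj push_stable g ((x, e) : P)). Qed.

Definition push_in (x : N') : push_mid := push_mk x 0.
Definition push_out (z : push_mid) : W :=
  ext_out E (repr (z : Quotient.quot (subspace_closed push_subspace))).2.

Lemma push_out_mk x e : push_out (push_mk x e) = ext_out E e.
Proof.
have : push_mk (repr (push_mk x e : Quotient.quot (subspace_closed push_subspace))).1
               (repr (push_mk x e : Quotient.quot (subspace_closed push_subspace))).2
     = push_mk x e.
  by rewrite {1}/push_mk -surjective_pairing /lproj reprK.
move=> /push_mk_eq [n [_ h]]; apply/eqP; rewrite -subr_eq0 -raddfB /= h.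
by rewrite raddfN oppr_eq0; apply/eqP/ext_exact; exists n.
Qed.

Lemma push_in_linear : linear push_in.
Proof. by move=> a x y; rewrite push_mkP scaler0 addr0. Qed.

Lemma push_out_linear : linear push_out.
Proof.
move=> a z z'; have [x [e <-]] := push_mk_surj z; have [y [e' <-]] := push_mk_surj z'.
by rewrite push_mkP !push_out_mk linearP.
Qed.

HB.instance Definition _ := GRing.isLinear.Build rat N' push_mid *:%R push_in push_in_linear.
HB.instance Definition _ := GRing.isLinear.Build rat push_mid W *:%R push_out push_out_linear.

Definition push_in_hom : ghom N' push_mid.
Proof.
by exists [the {linear _ -> _} of push_in] => g x; rewrite push_mk_act raddf0.
Defined.

Definition push_out_hom : ghom push_mid W.
Proof.
exists [the {linear _ -> _} of push_out] => g z.
have [x [e <-]] := push_mk_surj z.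
by rewrite push_mk_act /= !push_out_mk ghomP.
Defined.

Lemma push_in_inj : injective push_in_hom.
Proof.
move=> x y /push_mk_eq [n [h1 h2]]; apply/eqP; rewrite -subr_eq0 h1.
have -> : n = 0; last by rewrite raddf0.
by apply: (@ext_in_inj _ _ _ E); rewrite raddf0 -[LHS]opprK -h2 subrr oppr0.
Qed.

Lemma push_out_surj w : exists e, push_out_hom e = w.
Proof. by have [e <-] := ext_out_surj E w; exists (push_mk 0 e); rewrite /= push_out_mk. Qed.

Lemma push_exact z : push_out_hom z = 0 <-> exists x, push_in_hom x = z.
Proof.
split=> [|[x <-]]; last by rewrite /= push_out_mk raddf0.
have [x [e <-]] := push_mk_surj z; rewrite /= push_out_mk => /ext_exact [n <-].
exists (x + f n); apply/push_mk_eq; exists n.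
by rewrite addrC addKr sub0r.
Qed.

Definition ext_push : extension W N' := Extension push_in_inj push_out_surj push_exact.

End Pushout.

Section BaerSum.
Variables (G : groupType) (W N : gmodule G).

Definition diag_fun (w : W) : prod_gmodule W W := (w, w).
Definition codiag_fun (x : prod_gmodule N N) : N := x.1 + x.2.

Lemma diag_linear : linear diag_fun. Proof. by []. Qed.
Lemma codiag_linear : linear codiag_fun.
Proof. by move=> a x y; rewrite /codiag_fun /= scalerDr addrACA. Qed.

HB.instance Definition _ := GRing.isLinear.Build rat W (prod_gmodule W W) *:%R diag_fun diag_linear.
HB.instance Definition _ := GRing.isLinear.Build rat (prod_gmodule N N) N *:%R codiag_fun codiag_linear.

Definition diag_hom : ghom W (prod_gmodule W W).
Proof. by exists [the {linear _ -> _} of diag_fun]. Defined.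

Definition codiag_hom : ghom (prod_gmodule N N) N.
Proof. by exists [the {linear _ -> _} of codiag_fun] => g x; rewrite /= /codiag_fun raddfD. Defined.

Definition baer_sum (E E' : extension W N) : extension W N :=
  ext_push codiag_hom (ext_pull diag_hom (ext_sum E E')).

Definition Ext1_add (c c' : Ext1 W N) : Ext1 W N :=
  ext_class (baer_sum (ext_repr c) (ext_repr c')).

End BaerSum.

Section Automorphisms.
Variables (k F : fieldType) (iota : {rmorphism k -> F}).

Record faut := FAut {
  faut_fun :> F -> F;
  faut_zmod : zmod_morphism faut_fun;
  faut_monoid : monoid_morphism faut_fun;
  faut_bij : bijective faut_fun;
  faut_fix : forall c, faut_fun (iota c) = iota c }.

HB.instance Definition _ (g : faut) := GRing.isZmodMorphism.Build F F g (faut_zmod g).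
HB.instance Definition _ (g : faut) := GRing.isMonoidMorphism.Build F F g (faut_monoid g).

Lemma faut_eq (g h : faut) : g =1 h -> g = h.
Proof.
case: g h => [g g1 g2 g3 g4] [h h1 h2 h3 h4] /= /funext e; subst h.
by congr FAut; exact: Prop_irrelevance.
Qed.

Definition faut_id : faut.
Proof. by exists id => //; exists id. Defined.

Definition faut_comp (g h : faut) : faut.
Proof.
exists (g \o h).
- by move=> x y /=; rewrite !rmorphB.
- by split=> [|x y] /=; rewrite ?rmorph1 ?rmorphM.
- by apply: bij_comp; exact: faut_bij.
- by move=> c /=; rewrite !faut_fix.
Defined.

Lemma faut_inv_ex (g : faut) : exists h : faut, cancel g h /\ cancel h g.
Proof.
have [f fK Kf] := faut_bij g; have inj := can_inj fK.
have f1 : zmod_morphism f by move=> x y; apply: inj; rewrite rmorphB /= !Kf.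
have f2 : monoid_morphism f.
  by split=> [|x y]; apply: inj; rewrite ?rmorph1 ?rmorphM /= ?Kf ?rmorph1.
have f3 : bijective f by exists g.
have f4 c : f (iota c) = iota c by apply: inj; rewrite Kf faut_fix.
by exists (FAut f1 f2 f3 f4).
Qed.

Definition faut_inv (g : faut) : faut := projT1 (cid (faut_inv_ex g)).

Lemma faut_invK (g : faut) : cancel g (faut_inv g) /\ cancel (faut_inv g) g.
Proof. exact: projT2 (cid (faut_inv_ex g)). Qed.

HB.instance Definition _ := gen_eqMixin faut.
HB.instance Definition _ := gen_choiceMixin faut.

Lemma faut_mulA : associative faut_comp.
Proof. by move=> f g h; apply: faut_eq. Qed.
Lemma faut_mul1 : left_id faut_id faut_comp.
Proof. by move=> f; apply: faut_eq. Qed.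
Lemma faut_mulr1 : right_id faut_id faut_comp.
Proof. by move=> f; apply: faut_eq. Qed.
Lemma faut_mulV : left_inverse faut_id faut_inv faut_comp.
Proof. by move=> f; apply: faut_eq => x /=; rewrite (faut_invK f).1. Qed.
Lemma faut_mulrV : right_inverse faut_id faut_inv faut_comp.
Proof. by move=> f; apply: faut_eq => x /=; rewrite (faut_invK f).2. Qed.

HB.instance Definition _ := isGroup.Build faut
  faut_mulA faut_mul1 faut_mulr1 faut_mulV faut_mulrV.

Definition intermediate_field (K : set F) : Prop :=
  [/\ forall c, K (iota c),
      forall x y, K x -> K y -> K (x - y),
      forall x y, K x -> K y -> K (x * y) &
      forall x, K x -> K x^-1].

Definition adjoin (S : set F) : set F := smallest intermediate_field S.

(** [U_K = Aut(F/K)]. *)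

Definition fixing_subgroup (K : set F) : set faut :=
  [set g | forall x, K x -> g x = x].

(** The subgroups [U_L], [L = k(s)] with [s] finite, are a base of
    neighbourhoods of [1]. *)

Definition aut_open (U : set faut) : Prop :=
  forall g, U g -> exists s : seq F,
    forall h, fixing_subgroup (adjoin [set x | x \in s]) h -> U (g * h)%g.

Lemma aut_openT : aut_open setT. Proof. by move=> g _; exists [::]. Qed.

Lemma aut_openI : setI_closed aut_open.
Proof.
move=> A B oA oB g [/oA [s hs] /oB [t ht]]; exists (s ++ t) => h hh.
have sub (u : seq F) : {subset u <= s ++ t} ->
    adjoin [set x | x \in u] `<=` adjoin [set x | x \in s ++ t].
  by move=> hu x hx M [hM /= sM]; apply: hx; split=> // y /hu /sM.
split.
  by apply: hs => x hx; apply: hh; apply: sub hx => y; rewrite mem_cat => ->.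
by apply: ht => x hx; apply: hh; apply: sub hx => y; rewrite mem_cat orbC => ->.
Qed.

Lemma aut_open_bigU (I : Type) (f : I -> set faut) :
  (forall i, aut_open (f i)) -> aut_open (\bigcup_i f i).
Proof. by move=> of_ g [i _ /of_ [s hs]]; exists s => h /hs hh; exists i. Qed.

HB.instance Definition _ := isOpenTopological.Build faut aut_openT aut_openI aut_open_bigU.

End Automorphisms.

Section Topological.
Variables (k F : fieldType) (iota : {rmorphism k -> F}).

Definition smooth (M : gmodule (faut iota)) : Prop :=
  forall v : M, open (gstabilizer v).

(** Not joint continuity of the action: only stabilizers are required to be
    closed. *)

Definition continuous_module (M : gmodule (faut iota)) : Prop :=
  forall v : M, closed (gstabilizer v).

(** Smooth modules form a full subcategory containing, with [N] and [W], every
    module isomorphic to one of its objects, so its Yoneda [Ext^1] is this set of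
    classes; the condition does not depend on the representative [E]. *)

Definition Ext1_smooth (W N : gmodule (faut iota)) (c : Ext1 W N) : Prop :=
  exists E, ext_class E = c /\ smooth (ext_mid E).

Definition Ext1_cont (W N : gmodule (faut iota)) (c : Ext1 W N) : Prop :=
  exists E, ext_class E = c /\ continuous_module (ext_mid E).

Definition transcendence_basis (b : nat -> F) : Prop :=
  (forall (n : nat) (p : mpoly.mpoly n k),
     mpoly.mmap iota (fun i : 'I_n => b i) p = 0 ->
     forall m, mpoly.mcoeff m p = 0) /\
  (forall x, exists p : {poly F},
     [/\ p != 0, forall i, adjoin iota (range b) p`_i & root p x]).

Definition countably_infinite_trdeg : Prop := exists b, transcendence_basis b.

End Topological.

(** Group schemes of finite type over [k] through their functors of points
    (Demazure and Gabriel, Groupes algebriques, chapter I).  Over a field they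
    are separated, and in characteristic zero they are reduced (Cartier), hence
    they are the algebraic groups over [k].  Algebras are not [comAlgType k]
    because that structure excludes the zero ring, which occurs as a
    localization. *)

Record kalg (k : fieldType) := KAlg {
  kalg_ring :> comPzRingType;
  kalg_str : {rmorphism k -> kalg_ring} }.

Record kalg_hom (k : fieldType) (R S : kalg k) := KAlgHom {
  kalg_map :> {rmorphism R -> S};
  kalg_homP : forall c, kalg_map (kalg_str R c) = kalg_str S c }.

Definition kalg_id (k : fieldType) (R : kalg k) : kalg_hom R R.
Proof. by exists [the {rmorphism R -> R} of idfun]. Defined.

Definition kalg_comp (k : fieldType) (R S T : kalg k) (f : kalg_hom R S)
  (g : kalg_hom S T) : kalg_hom R T.
Proof. by exists [the {rmorphism R -> T} of g \o f] => c /=; rewrite !kalg_homP. Defined.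

Record group_functor (k : fieldType) := GroupFunctor {
  points :> kalg k -> zmodType;
  fmap : forall R S : kalg k, kalg_hom R S -> {additive points R -> points S};
  fmap_id : forall (R : kalg k) (f : kalg_hom R R),
    f =1 id -> forall x, fmap f x = x;
  fmap_comp : forall (R S T : kalg k) (f : kalg_hom R S) (g : kalg_hom S T)
    (h : kalg_hom R T), h =1 g \o f -> forall x, fmap h x = fmap g (fmap f x) }.

Section Schemes.
Variable k : fieldType.
Implicit Types R S : kalg k.

Definition generates_unit_ideal R (I : set R) : Prop :=
  exists (n : nat) (a r : 'I_n -> R),
    (forall i, I (r i)) /\ \sum_(i < n) a i * r i = 1.

(** [l : R -> L] is a localization of [R] at the powers of [f]. *)

Definition is_localization R L (l : kalg_hom R L) (f : R) : Prop :=
  [/\ exists v, l f * v = 1,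
      forall y, exists r n, y * l f ^+ n = l r &
      forall r, l r = 0 -> exists n, r * f ^+ n = 0].

Variable A : group_functor k.

(** A section over [L j] and one over [L i] agree on the overlap iff they agree
    over every algebra under both, the localization at [f i * f j] being the
    universal such algebra. *)

Definition zariski_sheaf : Prop :=
  forall R (n : nat) (f : 'I_n -> R) (L : 'I_n -> kalg k)
         (l : forall i, kalg_hom R (L i)),
    generates_unit_ideal (range f) ->
    (forall i, is_localization (l i) (f i)) ->
    forall s : (forall i, A (L i)),
      (forall i j S (u : kalg_hom (L i) S) (v : kalg_hom (L j) S),
         (forall r, u (l i r) = v (l j r)) -> fmap A u (s i) = fmap A v (s j)) ->
      exists! x : A R, forall i, fmap A (l i) x = s i.

(** [U] is an open subfunctor of [A]: its pullback along every [Spec R -> A]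
    is the complement of the closed subset defined by some [I] in [R]. *)

Definition open_subfunctor (U : forall R, set (A R)) : Prop :=
  forall R (x : A R), exists I : set R, forall S (f : kalg_hom R S),
    U S (fmap A f x) <-> generates_unit_ideal (f @` I).

Definition finitely_generated (B : kalg k) : Prop :=
  exists (n : nat) (b : 'I_n -> B), forall P : set B,
    (forall c, P (kalg_str B c)) -> (forall i, P (b i)) ->
    (forall x y, P x -> P y -> P (x + y)) ->
    (forall x y, P x -> P y -> P (x * y)) ->
    forall x, P x.

(** [U] is represented by a finitely generated algebra [B] with universal
    point [u]. *)

Definition affine_finite_type (U : forall R, set (A R)) : Prop :=
  exists (B : kalg k) (u : A B), [/\ finitely_generated B, U B u &
    forall S (x : A S), U S x -> exists f : kalg_hom B S,
      fmap A f u = x /\ forall f' : kalg_hom B S, fmap A f' u = x -> f' =1 f].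

Definition field_kalg (K : fieldType) (j : {rmorphism k -> K}) : kalg k :=
  @KAlg k K j.

(** Open subfunctors cover as soon as they do so on points with values in
    fields. *)

Definition scheme_finite_type : Prop :=
  zariski_sheaf /\
  exists (m : nat) (U : 'I_m -> forall R, set (A R)),
    (forall i, open_subfunctor (U i) /\ affine_finite_type (U i)) /\
    (forall (K : fieldType) (j : {rmorphism k -> K}) (x : A (field_kalg j)),
       exists i, U i _ x).

Definition nonempty_subfunctor (U : forall R, set (A R)) : Prop :=
  exists (K : fieldType) (j : {rmorphism k -> K}), U (field_kalg j) !=set0.

(** The underlying topological space is irreducible; it is not empty since it
    contains the neutral element. *)

Definition irreducible_space : Prop :=
  forall U V : (forall R, set (A R)),
    open_subfunctor U -> open_subfunctor V ->
    nonempty_subfunctor U -> nonempty_subfunctor V ->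
    nonempty_subfunctor (fun R => U R `&` V R).

End Schemes.

Record algebraic_group (k : fieldType) := AlgebraicGroup {
  alg_functor :> group_functor k;
  alg_scheme : scheme_finite_type alg_functor }.

Section WA.
Variables (k F : fieldType) (iota : {rmorphism k -> F}).
Variable A : algebraic_group k.
Local Notation G := (faut iota).
Local Notation kk := (field_kalg [the {rmorphism k -> k} of idfun]).
Local Notation FF := (field_kalg iota).

Definition base_points : zmodType := A kk.
Definition ext_points : zmodType := A FF.

Definition iota_hom : kalg_hom kk FF.
Proof. by exists (iota : {rmorphism kk -> FF}). Defined.

Definition faut_hom (g : G) : kalg_hom FF FF.
Proof. by exists ([the {rmorphism F -> F} of faut_fun g] : {rmorphism FF -> FF}); exact: faut_fix. Defined.

Definition base_change : {additive base_points -> ext_points} := fmap A iota_hom.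
Definition point_act (g : G) : {additive ext_points -> ext_points} := fmap A (faut_hom g).

Lemma point_act1 x : point_act 1%g x = x.
Proof. exact: fmap_id. Qed.

Lemma point_actM g h x : point_act (g * h)%g x = point_act g (point_act h x).
Proof. exact: fmap_comp. Qed.

Lemma point_act_base g c : point_act g (base_change c) = base_change c.
Proof.
rewrite /point_act /base_change -(@fmap_comp _ A _ _ _ iota_hom (faut_hom g) iota_hom) //.
by move=> x /=; rewrite faut_fix.
Qed.

Lemma base_change_inj : injective base_change.
Proof.
case: (alg_scheme A) => _ [m [U [hU cov]]] x y exy.
have [i Ux] := cov F iota (base_change x).
have [oU [B [u [_ _ repU]]]] := hU i.
have desc z : U i FF (base_change z) -> U i kk z.
  move=> Uz; have [I hI] := oU kk z.
  rewrite -(@fmap_id _ A kk (kalg_id kk) (fun=> erefl) z); apply/hI.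
  have [n [a [r [Ir ar1]]]] := (hI FF iota_hom).1 Uz.
  have [j rj0] : exists j, r j != 0.
    apply: contrapT => h; move/eqP: ar1; rewrite big1 ?(eq_sym 0) ?oner_eq0 // => j _.
    by have [->|rj] := eqVneq (r j) 0; [rewrite mulr0 | case: h; exists j].
  have [c Ic rc] := Ir j.
  exists 1%N, (fun=> c^-1), (fun=> c); split; first by move=> _; exists c.
  rewrite big_ord1; apply: mulVf; apply: contraNneq rj0 => c0.
  by rewrite -rc c0 rmorph0.
have [f [fx _]] := repU _ _ (desc x Ux).
have [g [gy _]] : exists g : kalg_hom B kk, fmap A g u = y /\ True.
  by move: Ux; rewrite exy => /desc /repU [g [gy _]]; exists g.
have [h [_ uniq_h]] := repU _ _ Ux.
have hf : kalg_comp f iota_hom =1 h.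
  by apply: uniq_h; rewrite (@fmap_comp _ A _ _ _ f iota_hom) // fx.
have hg : kalg_comp g iota_hom =1 h.
  by apply: uniq_h; rewrite (@fmap_comp _ A _ _ _ g iota_hom) // gy -exy.
rewrite -fx -gy -[RHS](@fmap_id _ A kk (kalg_id kk) (fun=> erefl)).
apply: fmap_comp => b; apply: (fmorph_inj iota).
exact: etrans (hf b) (esym (hg b)).
Qed.

Definition base_image : ext_points -> bool := fun x => `[< exists c, base_change c = x >].

Lemma base_image_zmod_closed : zmod_closed base_image.
Proof.
split; first by apply/asboolP; exists 0; rewrite raddf0.
by move=> x y /asboolP [c <-] /asboolP [d <-]; apply/asboolP; exists (c - d); rewrite raddfB.
Qed.

HB.instance Definition _ := GRing.isZmodClosed.Build ext_points base_image base_image_zmod_closed.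

Definition base_image_closed : zmodClosed ext_points :=
  GRing.ZmodClosed.clone ext_points base_image _.

Definition WA : zmodType := Quotient.quot base_image_closed.

Definition WA_proj : {additive ext_points -> WA} :=
  [the {additive _ -> _} of \pi_(Quotient.quot base_image_closed)].

Lemma WA_proj_surj w : exists x, WA_proj x = w.
Proof. by exists (repr (w : Quotient.quot base_image_closed)); rewrite /WA_proj /= reprK. Qed.

Lemma WA_proj_eq0 x : WA_proj x = 0 <-> exists c, base_change c = x.
Proof.
rewrite -(raddf0 WA_proj); split=> [/eqP|h].
  by rewrite -Quotient.idealrBE subr0 => /asboolP.
by apply/eqP; rewrite -Quotient.idealrBE subr0; apply/asboolP.
Qed.

Definition WA_act (g : G) (w : WA) : WA :=
  WA_proj (point_act g (repr (w : Quotient.quot base_image_closed))).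

Lemma WA_act_proj g x : WA_act g (WA_proj x) = WA_proj (point_act g x).
Proof.
apply/eqP; rewrite -subr_eq0 -raddfB -raddfB; apply/eqP/WA_proj_eq0.
have /WA_proj_eq0 [c <-] :
    WA_proj (repr (WA_proj x : Quotient.quot base_image_closed) - x) = 0.
  by rewrite raddfB /= reprK subrr.
by exists c; rewrite point_act_base.
Qed.

(** The rational vector space structure on [A(F)/A(k)] is the one of
    [divisible_module hW]. *)

Section Module.
Hypothesis hW : uniquely_divisible WA.
Local Notation W := (divisible_module hW).

Lemma WA_act_is_zmod_morphism g : zmod_morphism (WA_act g : W -> W).
Proof.
move=> v w; have [x <-] := WA_proj_surj v; have [y <-] := WA_proj_surj w.
by rewrite -raddfB !WA_act_proj !raddfB.
Qed.

Lemma WA_act_linear g : linear (WA_act g : W -> W).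
Proof.
move=> a v w; have h := WA_act_is_zmod_morphism g.
have h0 : WA_act g 0 = 0 by rewrite -[0 in LHS](subrr (0 : W)) h subrr.
have hN x : WA_act g (- x) = - WA_act g x by rewrite -[in LHS](sub0r (x : W)) h h0 sub0r.
by rewrite -[X in _ + X]opprK h hN opprK (rat_linear h).
Qed.

Lemma WA_act1 w : WA_act 1%g w = w.
Proof. by have [x <-] := WA_proj_surj w; rewrite WA_act_proj point_act1. Qed.

Lemma WA_actM g h w : WA_act (g * h)%g w = WA_act g (WA_act h w).
Proof. by have [x <-] := WA_proj_surj w; rewrite !WA_act_proj point_actM. Qed.

Definition WA_module : gmodule G := @GModule G W WA_act WA_act_linear WA_act1 WA_actM.

(** The extension [0 -> A(k) (x) Q -> A(F) (x) Q -> W_A -> 0]. *)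

Definition tensor_act (g : G) : tensorQ ext_points -> tensorQ ext_points :=
  tensorQ_map (point_act g).

Lemma tensor_act_linear g : linear (tensor_act g).
Proof. by move=> a x y; rewrite /tensor_act linearP. Qed.

Lemma tensor_act1 x : tensor_act 1%g x = x.
Proof.
by have [m [a ->]] := frac_ex x; rewrite /tensor_act tensorQ_map_frac point_act1.
Qed.

Lemma tensor_actM g h x : tensor_act (g * h)%g x = tensor_act g (tensor_act h x).
Proof.
by have [m [a ->]] := frac_ex x; rewrite /tensor_act !tensorQ_map_frac point_actM.
Qed.

Definition points_module : gmodule G :=
  @GModule G (tensorQ ext_points) tensor_act tensor_act_linear tensor_act1 tensor_actM.

Definition base_module : gmodule G := trivial_gmodule G (tensorQ base_points).

Definition base_hom : ghom base_module points_module.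
Proof.
exists (tensorQ_map base_change) => g x; have [m [a ->]] := frac_ex x.
by rewrite /= /tensor_act !tensorQ_map_frac point_act_base.
Defined.

Definition WA_proj_module : {additive ext_points -> W} := WA_proj.

Definition WA_hom : ghom points_module WA_module.
Proof.
exists [the {linear _ -> _} of tensorQ_lift WA_proj_module] => g x.
have [m [a ->]] := frac_ex x.
rewrite /= /tensor_act tensorQ_map_frac !tensorQ_lift_frac /=.
have h := rat_linear (WA_act_is_zmod_morphism g).
by rewrite [RHS]h WA_act_proj.
Defined.

Lemma base_hom_inj : injective base_hom.
Proof. exact: tensorQ_map_inj base_change_inj. Qed.

Lemma WA_hom_surj w : exists e, WA_hom e = w.
Proof.
have [x <-] := WA_proj_surj w; exists (frac1 x).
by rewrite /= tensorQ_lift_frac invr1 scale1r.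
Qed.

Lemma WA_hom_exact e : WA_hom e = 0 <-> exists c, base_hom c = e.
Proof.
have [x [a ->]] := frac_ex e; rewrite /= tensorQ_lift_frac.
split=> [h|[c]].
  have := congr1 (fun v : W => a.+1%:R *: v) h.
  rewrite scalerA mulfV ?pnatr_eq0 // scale1r scaler0 => /WA_proj_eq0 [c <-].
  by exists (frac c a); rewrite tensorQ_map_frac.
have [c' [b ->]] := frac_ex c; rewrite tensorQ_map_frac => e'.
by rewrite -(tensorQ_lift_frac WA_proj_module) -e' tensorQ_lift_frac
  (WA_proj_eq0 _).2 ?scaler0 //; exists c'.
Qed.

Definition tensor_extension : extension WA_module base_module :=
  Extension base_hom_inj WA_hom_surj WA_hom_exact.

Definition Q_module : gmodule G := trivial_gmodule G rat^o.

Definition functional_hom (phi : {additive base_points -> rat^o}) :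
  ghom base_module Q_module.
Proof. by exists [the {linear _ -> _} of tensorQ_lift phi]. Defined.

(** The connecting map [Hom(A(k), Q) -> Ext^1(W_A, Q)] sends [phi] to the class
    of the pushout of [tensor_extension] along [phi (x) Q]. *)

Definition connecting (phi : {additive base_points -> rat^o}) : Ext1 WA_module Q_module :=
  ext_class (ext_push (functional_hom phi) tensor_extension).

End Module.
End WA.

(* Main.v *)
(** A partial isomorphism between subfields of finite transcendence degree extends to [G], so
    the generic points of [A] over a finitely generated field [L] form one orbit of
    [Aut(F/L)], stable under translation by [A(L)]. For [y] generic over [k(x)] there is thus
    [g] in [G] with [x = g y - y]. Hence [A(F)] has no nonzero coinvariants, and the connecting
    map is injective. Given an extension [E] of [W_A] by [Q] and a lift [e] of the class of
    [y], the vector [s x = g e - e] lifts the class of [x]. It does not depend on the choices,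
    and then is additive and equivariant in [x], provided [g e = e] whenever [g y = y]: on the
    open subgroup [Aut(F/k(y))], [g |-> g e - e] is a homomorphism to [Q], with closed kernel
    when [E] is continuous, and such homomorphisms vanish. Indeed, an automorphism fixing the
    algebraic closure of [k(y)] agrees with a commutator on every finite set; an automorphism
    with finite orbits generates a procyclic group, to which Baire's theorem applies; every
    element is a product of these two kinds. So [E] is the pushout of [A(F) (x) Q] along the
    restriction of [s] to [A(k)], and it is smooth because the points of [A] have open
    stabilizers.

    [W_A] is a rational vector space: divisibility follows from transitivity on generic points
    again ([x + n y = g (n y)] gives [x = n (g y - y)]), and [n x] in [A(k)] forces [x] in
    [A(k)] since otherwise a [k]-derivation moving a coordinate of [x] would produce a nonzero
    tangent vector of [A] at [0] killed by [n]. *)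

Require Import Defs.
From HB Require Import structures.
From mathcomp Require Import all_boot all_algebra separable ring zify.
From mathcomp Require Import boolp classical_sets functions topology.
From mathcomp Require mpoly.

Set Implicit Arguments.
Unset Strict Implicit.
Unset Printing Implicit Defensive.

Import GRing.Theory Num.Theory.
Local Open Scope classical_set_scope.
Local Open Scope ring_scope.

(** * Intermediate fields and algebraic closure *)

(** Automorphisms, embeddings and derivations are all built in the same way. A partial map is kept
    as its graph, a subring of [E * S]; [good] says that a set of pairs generates such a graph, to
    which further pairs are then added. The target [S] need not be a field: [S = F] gives
    automorphisms, and for dual numbers a map [x + D x eps] encodes a derivation [D]. To extend a
    partial map to [F], both sides should be algebraic over finitely many elements, so that the
    complementary transcendence bases are both countably infinite and can be matched. The obstacle
    is to fix one subfield pointwise while prescribing values on another: even for independent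
    subfields the two prescriptions may disagree on algebraic closures, unless the common base is
    algebraically closed. This is stationarity, which yields both the commutators and the orbits of
    generic points. Points enter through coordinates in some chart, taken up to [acl]: the
    stabilizer of a point determines this closure, so sums of points are handled without formulas,
    and genericity becomes a count of independent elements. *)

Definition coefs_in (R : nzRingType) (C : set R) (p : {poly R}) : Prop :=
  forall i, C p`_i.

Notation sset s := [set x | x \in s].

Section Subrings.
Variables (R : comNzRingType).
Implicit Types (G : set R) (p q : {poly R}).

Definition subring G : Prop :=
  [/\ G 1, forall x y, G x -> G y -> G (x - y) & forall x y, G x -> G y -> G (x * y)].

Section Closure.
Variables (G : set R) (hG : subring G).
Lemma subring1 : G 1. Proof. by case: hG. Qed.
Lemma subringB x y : G x -> G y -> G (x - y). Proof. by case: hG => _ + _; apply. Qed.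
Lemma subringM x y : G x -> G y -> G (x * y). Proof. by case: hG => _ _; apply. Qed.
Lemma subring0 : G 0. Proof. by rewrite -(subrr 1); apply: subringB; exact: subring1. Qed.
Lemma subringN x : G x -> G (- x).
Proof. by move=> h; rewrite -[- x]add0r; apply: subringB => //; exact: subring0. Qed.
Lemma subringD x y : G x -> G y -> G (x + y).
Proof. by move=> hx hy; rewrite -[y]opprK; apply: subringB => //; exact: subringN. Qed.
Lemma subring_sum (I : Type) (r : seq I) (P : pred I) (f : I -> R) :
  (forall i, P i -> G (f i)) -> G (\sum_(i <- r | P i) f i).
Proof. by move=> h; elim/big_ind: _ => // *; [exact: subring0|exact: subringD]. Qed.
Lemma subringX x n : G x -> G (x ^+ n).
Proof.
move=> hx; elim: n => [|n IH]; first exact: subring1.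
by rewrite exprS; exact: subringM.
Qed.

Lemma coefs_in0 : coefs_in G 0. Proof. by move=> i; rewrite coef0; exact: subring0. Qed.
Lemma coefs_inC c : G c -> coefs_in G c%:P.
Proof. by move=> hc i; rewrite coefC; case: ifP => // _; exact: subring0. Qed.
Lemma coefs_inX : coefs_in G 'X.
Proof. by move=> i; rewrite coefX; case: eqP => _; [exact: subring1|exact: subring0]. Qed.
Lemma coefs_inB p q : coefs_in G p -> coefs_in G q -> coefs_in G (p - q).
Proof. by move=> hp hq i; rewrite coefB; exact: subringB. Qed.
Lemma coefs_inD p q : coefs_in G p -> coefs_in G q -> coefs_in G (p + q).
Proof. by move=> hp hq i; rewrite coefD; exact: subringD. Qed.
Lemma coefs_inM p q : coefs_in G p -> coefs_in G q -> coefs_in G (p * q).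
Proof. by move=> hp hq i; rewrite coefM; apply: subring_sum => j _; exact: subringM. Qed.
Lemma coefs_inZ c p : G c -> coefs_in G p -> coefs_in G (c *: p).
Proof. by move=> hc hp i; rewrite coefZ; exact: subringM. Qed.
Lemma coefs_inXn p n : coefs_in G p -> coefs_in G (p ^+ n).
Proof.
move=> hp; elim: n => [|n IH]; first exact: coefs_inC subring1.
by rewrite exprS; exact: coefs_inM.
Qed.
Lemma coefs_in_sum (I : Type) (r : seq I) (P : pred I) (f : I -> {poly R}) :
  (forall i, P i -> coefs_in G (f i)) -> coefs_in G (\sum_(i <- r | P i) f i).
Proof. by move=> h; elim/big_ind: _ => // *; [exact: coefs_in0|exact: coefs_inD]. Qed.
Lemma coefs_in_deriv p : coefs_in G p -> coefs_in G p^`().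
Proof.
move=> hp i; rewrite coef_deriv -mulr_natr; apply: subringM => //.
elim: i.+1 => [|n IH]; first exact: subring0.
by rewrite mulrSr; apply: subringD => //; exact: subring1.
Qed.
Lemma subring_horner p x : coefs_in G p -> G x -> G p.[x].
Proof.
move=> hp hx; rewrite horner_coef; apply: subring_sum => i _.
by apply: subringM => //; exact: subringX.
Qed.

(** Coefficients will be pairs in a product [E * S], which has zero divisors. So only monic divisors
    are allowed, and quotient and remainder must keep their coefficients in [G]. *)
Lemma monic_division f : f \is monic -> coefs_in G f -> forall p, coefs_in G p ->
  exists q r, [/\ coefs_in G q, coefs_in G r, p = q * f + r & (size r < size f)%N].
Proof.
move=> mf hf p; move: {2}(size p) (leqnn (size p)) => n.
elim: n p => [|n IH] p sp hp.
  exists 0, 0; rewrite mul0r addr0 size_poly0 lt0n size_poly_eq0 monic_neq0 //.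
  by split=> //; try exact: coefs_in0; apply/eqP; rewrite -size_poly_leq0.
case: (ltnP (size p) (size f)) => [lt_pf|le_fp].
  by exists 0, p; rewrite mul0r add0r; split=> //; exact: coefs_in0.
pose m := (lead_coef p)%:P * 'X^(size p - size f).
have hm : coefs_in G m.
  by apply: coefs_inM; [exact/coefs_inC/hp|exact/coefs_inXn/coefs_inX].
have [|q [r [hq hr e sr]]] := IH (p - m * f) _ (coefs_inB hp (coefs_inM hm hf)).
  have [p0|p0] := eqVneq p 0; first by rewrite /m p0 lead_coef0 !mul0r subr0 size_poly0.
  have sf : (0 < size f)%N by rewrite lt0n size_poly_eq0 monic_neq0.
  rewrite -ltnS; apply: leq_trans sp.
  rewrite [X in (_ < X)%N](_ : _ = (size p).-1.+1); last first.
    by rewrite prednK // lt0n size_poly_eq0.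
  rewrite ltnS; apply/leq_sizeP => j le_j; rewrite coefB /m -mulrA coefCM coefXnM.
  have [lt_j|ge_j] := ltnP j (size p - size f).
    rewrite mulr0 subr0 nth_default //.
    by move: lt_j; rewrite ltn_subRL => lt_j; lia.
  have [->|ne_j] := eqVneq j (size p).-1.
    rewrite (_ : _ - _ = (size f).-1)%N; last by lia.
    have -> : f`_(size f).-1 = 1 by apply/eqP; rewrite -monicE.
    by rewrite mulr1 subrr.
  have -> : p`_j = 0.
    apply/nth_default/(leq_trans (leqSpred _)).
    by rewrite ltn_neqAle eq_sym ne_j.
  rewrite [f`__]nth_default ?mulr0 ?subr0 //.
  rewrite -[X in (X <= _)%N](subKn le_fp); apply: leq_sub2r.
  apply: (leq_trans (leqSpred _)).
  by rewrite ltn_neqAle eq_sym ne_j.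
by exists (m + q), r; split=> //; [exact: coefs_inD|rewrite mulrDl -addrA -e addrC subrK].
Qed.

End Closure.
End Subrings.

Arguments subring {R} G.

(** [K] being algebraically closed, [p] is the image of a polynomial that splits in [K], and [y] is
    the image of one of its roots. This serves to prove endomorphisms surjective and to identify
    [acl set0] with [k]. *)
Lemma root_image (K : closedFieldType) (L : fieldType) (f : {rmorphism K -> L}) (p : {poly L}) y :
  p != 0 -> (forall i, exists x, f x = p`_i) -> root p y -> exists x, f x = y.
Proof.
move=> p0 hp py; have [q hq] := choice hp; pose r := \poly_(i < size p) q i.
have rp : map_poly f r = p.
  apply/polyP => i; rewrite coef_map coef_poly; case: ltnP => [_|h]; first exact: hq.
  by rewrite raddf0 nth_default.
have [s rs] := closed_field_poly_normal r.
have r0 : lead_coef r != 0.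
  by rewrite lead_coef_eq0; apply: contraNneq p0 => r0; rewrite -rp r0 rmorph0.
move: py; rewrite -rp rs map_polyZ /= rootZ ?fmorph_eq0 // rmorph_prod /=.
rewrite (eq_bigr (fun z => 'X - (f z)%:P)); last first.
  by move=> x _; rewrite rmorphB /= map_polyX map_polyC.
by rewrite -(big_map f xpredT (fun z => 'X - z%:P)) root_prod_XsubC => /mapP [x _ ->]; exists x.
Qed.

Section IntermediateFields.
Variables (k F : fieldType) (iota : {rmorphism k -> F}).
Implicit Types (C K : set F).
Local Notation intermediate := (intermediate_field iota).
Local Notation adjoin := (adjoin iota).

Section Closure.
Variables (K : set F) (hK : intermediate K).

Lemma inter_base c : K (iota c). Proof. by case: hK. Qed.
Lemma interV x : K x -> K x^-1. Proof. by case: hK => _ _ _; apply. Qed.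
Lemma inter_subring : subring K.
Proof. by case: hK => b B M _; split=> //; rewrite -(rmorph1 iota). Qed.
Lemma inter_div x y : K x -> K y -> K (x / y).
Proof. by move=> hx hy; apply: (subringM inter_subring) => //; exact: interV. Qed.

(** The dummy [let] keeps [hK] as a parameter, so that the instances depending on it can be attached
    to the predicate and its subtype. *)
Definition subfield_pred : pred F := let _ := hK in fun x => `[< K x >].

Lemma subfield_divring : divring_closed subfield_pred.
Proof.
split; first by apply/asboolP; exact: (subring1 inter_subring).
  by move=> x y /asboolP hx /asboolP hy; apply/asboolP; exact: (subringB inter_subring).
by move=> x y /asboolP hx /asboolP hy; apply/asboolP; exact: inter_div.
Qed.

HB.instance Definition _ := GRing.isDivringClosed.Build F subfield_pred subfield_divring.

Record subfield_type := SubfieldElt {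
  subfield_val : F;
  subfield_valP : subfield_pred subfield_val }.

HB.instance Definition _ := [isSub for subfield_val].
HB.instance Definition _ := [Choice of subfield_type by <:].
HB.instance Definition _ :=
  GRing.SubChoice_isSubComUnitRing.Build F subfield_pred subfield_type subfield_divring.
HB.instance Definition _ :=
  GRing.SubComUnitRing_isSubIntegralDomain.Build F subfield_pred subfield_type.
HB.instance Definition _ :=
  [SubIntegralDomain_isSubField of subfield_type by <:].

Definition subfield_incl : subfield_type -> F := subfield_val.
HB.instance Definition _ := GRing.RMorphism.copy subfield_incl (val : subfield_type -> F).

Lemma subfield_inclP x : K (subfield_incl x).
Proof. by apply/asboolP; exact: (subfield_valP x). Qed.

Lemma subfield_lift x : K x -> exists y, subfield_incl y = x.
Proof.
move=> hx; have hx' : subfield_pred x by apply/asboolP.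
by exists (SubfieldElt hx').
Qed.

Lemma coefs_in_lift p : coefs_in K p -> exists q, map_poly subfield_incl q = p.
Proof.
move=> hp; pose f i := projT1 (cid (subfield_lift (hp i))).
have fE i : subfield_incl (f i) = p`_i by exact: projT2 (cid (subfield_lift (hp i))).
exists (\poly_(i < size p) f i); apply/polyP => i.
rewrite coef_map coef_poly; case: ltnP => [_|h] /=; first exact: fE.
by rewrite nth_default.
Qed.

Lemma coefs_in_map (q : {poly subfield_type}) : coefs_in K (map_poly subfield_incl q).
Proof. by move=> i; rewrite coef_map; exact: subfield_inclP. Qed.

End Closure.

Coercion inter_subring : intermediate_field >-> subring.

Lemma adjoin_inter C : intermediate (adjoin C).
Proof.
split=> [c M|x y hx hy M hM|x y hx hy M hM|x hx M hM]; first by case=> -[hM _ _ _] _; exact: hM.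
- by case: (hM) => -[_ hB _ _] _; apply: hB; [exact: hx|exact: hy].
- by case: (hM) => -[_ _ h _] _; apply: h; [exact: hx|exact: hy].
- by case: (hM) => -[_ _ _ h] _; apply: h; exact: hx.
Qed.

Lemma sub_adjoin C : C `<=` adjoin C.
Proof. by move=> x Cx M [_]; apply. Qed.

Lemma adjoin_min C K : intermediate K -> C `<=` K -> adjoin C `<=` K.
Proof. by move=> hK CK x; apply. Qed.

Lemma adjoinS C D : C `<=` D -> adjoin C `<=` adjoin D.
Proof.
move=> CD; apply: adjoin_min; first exact: adjoin_inter.
by apply: subset_trans CD _; exact: sub_adjoin.
Qed.

Definition acl (C : set F) : set F :=
  [set x | exists p : {poly F}, [/\ p != 0, coefs_in (adjoin C) p & root p x]].

Lemma acl_algebraicOver C x :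
  acl C x <-> algebraicOver (subfield_incl (hK := adjoin_inter C)) x.
Proof.
split=> [[p [p0 /(coefs_in_lift (adjoin_inter C)) [q qp] px]]|[q q0 qx]].
  exists q; last by rewrite qp.
  by apply: contraNneq p0 => q0; rewrite -qp q0 rmorph0.
exists (map_poly (subfield_incl (hK := adjoin_inter C)) q); split=> //.
  by rewrite map_poly_eq0.
exact: coefs_in_map.
Qed.

Lemma adjoin_acl C : adjoin C `<=` acl C.
Proof.
move=> x hx; apply/acl_algebraicOver.
by have [y <-] := subfield_lift (adjoin_inter C) hx; exact: algebraic_id.
Qed.

Lemma sub_acl C : C `<=` acl C.
Proof. by move=> x /(@sub_adjoin C); exact: adjoin_acl. Qed.

Lemma acl_inter C : intermediate (acl C).
Proof.
split=> [c|x y|x y|x].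
- by apply: adjoin_acl; exact: (inter_base (adjoin_inter C)).
- by move=> /acl_algebraicOver hx /acl_algebraicOver hy; apply/acl_algebraicOver/algebraic_sub.
- by move=> /acl_algebraicOver hx /acl_algebraicOver hy; apply/acl_algebraicOver/algebraic_mul.
- by move=> /acl_algebraicOver hx; apply/acl_algebraicOver/algebraic_inv.
Qed.

Lemma root_acl C p x : p != 0 -> coefs_in (acl C) p -> root p x -> acl C x.
Proof.
move=> p0 hp px; apply/acl_algebraicOver/integral_algebraic.
apply: (integral_root p0 px) => c /(nthP 0) [i _ <-].
exact/integral_algebraic/acl_algebraicOver/hp.
Qed.

Lemma coefs_inS (C D : set F) p : C `<=` D -> coefs_in C p -> coefs_in D p.
Proof. by move=> CD hp i; exact/CD/hp. Qed.

Lemma acl_min C D : C `<=` acl D -> acl C `<=` acl D.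
Proof.
move=> CD x [p [p0 hp px]]; apply: root_acl p0 _ px.
by apply: coefs_inS hp; apply: adjoin_min CD; exact: acl_inter.
Qed.

Lemma aclS C D : C `<=` D -> acl C `<=` acl D.
Proof. by move=> CD; apply: acl_min; apply: subset_trans CD _; exact: sub_acl. Qed.

Lemma adjoin_eq K : intermediate K -> adjoin K = K.
Proof. by move=> hK; apply/seteqP; split; [exact: adjoin_min|exact: sub_adjoin]. Qed.

Definition frac_in K (t : F) : set F := [set x | exists p q : {poly F},
  [/\ coefs_in K p, coefs_in K q, q.[t] != 0 & x = p.[t] / q.[t]]].

Section CoefsIn.
Variables (K : set F) (hK : intermediate K).

Lemma frac_in_inter t : intermediate (frac_in K t).
Proof.
split=> [c|x y [p [q [hp hq q0 ->]]] [p' [q' [hp' hq' q0' ->]]]|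
  x y [p [q [hp hq q0 ->]]] [p' [q' [hp' hq' q0' ->]]]|x [p [q [hp hq q0 ->]]]].
- exists (iota c)%:P, 1; rewrite !hornerC oner_neq0 divr1; split=> //; apply: (coefs_inC hK).
    exact: (inter_base hK).
  exact: (subring1 hK).
- exists (p * q' - p' * q), (q * q'); split.
  + by apply: (coefs_inB hK); exact: (coefs_inM hK).
  + exact: (coefs_inM hK).
  + by rewrite hornerM mulf_neq0.
  + by rewrite hornerD hornerN !hornerM -mulNr addf_div // mulNr.
- exists (p * p'), (q * q'); split; try exact: (coefs_inM hK).
    by rewrite hornerM mulf_neq0.
  by rewrite !hornerM mulf_div.
have [p0|p0] := eqVneq p.[t] 0.
  exists 0, 1; rewrite horner0 hornerC p0 mul0r invr0 oner_neq0 mul0r.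
  by split=> //; [exact: (coefs_in0 hK)|exact: (coefs_inC hK (subring1 hK))].
by exists q, p; rewrite invf_div.
Qed.

Lemma adjoin1E t : adjoin (K `|` [set t]) = frac_in K t.
Proof.
apply/seteqP; split.
  apply: adjoin_min; first exact: frac_in_inter.
  move=> x [Kx|->].
    exists x%:P, 1; rewrite !hornerC oner_neq0 divr1; split=> //; apply: (coefs_inC hK) => //.
    exact: (subring1 hK).
  exists 'X, 1; rewrite !hornerE oner_neq0 divr1; split=> //; first exact: (coefs_inX hK).
  by apply: (coefs_inC hK); exact: (subring1 hK).
move=> x [p [q [hp hq q0 ->]]]; set L := adjoin _.
have hL : intermediate L by exact: adjoin_inter.
have KL : K `<=` L by move=> y Ky; apply: sub_adjoin; left.
have Lt : L t by apply: sub_adjoin; right.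
by apply: (inter_div hL); apply: (subring_horner hL) => //; apply: coefs_inS KL _.
Qed.
End CoefsIn.

Lemma frac_in_clear K t (I : finType) (f : I -> F) : intermediate K ->
  (forall i, frac_in K t (f i)) ->
  exists d, [/\ coefs_in K d, d.[t] != 0 &
    forall i, exists2 p, coefs_in K p & f i * d.[t] = p.[t]].
Proof.
move=> hK hf.
have [p hp] := @choice _ _ (fun i p => exists q : {poly F},
  [/\ coefs_in K p, coefs_in K q, q.[t] != 0 & f i = p.[t] / q.[t]]) hf.
have [q hq] := @choice _ _ (fun i q =>
  [/\ coefs_in K (p i), coefs_in K q, q.[t] != 0 & f i = (p i).[t] / q.[t]]) hp.
exists (\prod_i q i); split.
- by elim/big_ind: _ => [|*|i _]; [exact: (coefs_inC hK (subring1 hK))|exact: (coefs_inM hK)|case: (hq i)].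
- by rewrite horner_prod; apply/prodf_neq0 => i _; case: (hq i).
move=> i; exists (p i * \prod_(j | j != i) q j).
  apply: (coefs_inM hK) => //; first by case: (hq i).
  by elim/big_ind: _ => [|*|j _]; [exact: (coefs_inC hK (subring1 hK))|exact: (coefs_inM hK)|case: (hq j)].
have [_ _ q0 ->] := hq i.
by rewrite (bigD1 i) //= !hornerM mulrA divfK.
Qed.

End IntermediateFields.

(** * Algebraic independence *)

Lemma sset_nil (T : eqType) : sset [::] = set0 :> set T.
Proof. by apply/seteqP; split=> x /=. Qed.

Lemma sset_cons (T : eqType) (a : T) s : sset (a :: s) = [set a] `|` sset s.
Proof.
apply/seteqP; split=> x /=; rewrite in_cons; first by case/orP => [/eqP|]; [left|right].
by case=> [->|->]; rewrite ?eqxx ?orbT.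
Qed.

Lemma sset_cat (T : eqType) (s t : seq T) : sset (s ++ t) = sset s `|` sset t.
Proof.
apply/seteqP; split=> x /=; rewrite mem_cat; first by case/orP; [left|right].
by case=> ->; rewrite ?orbT.
Qed.

Section Dependence.
Variables (k F : fieldType) (iota : {rmorphism k -> F}).
Implicit Types (C D K : set F) (s t : seq F).
Local Notation adjoin := (adjoin iota).
Local Notation acl := (acl iota).

Lemma adjoin_finitary C x : adjoin C x -> exists s, sset s `<=` C /\ adjoin (sset s) x.
Proof.
move=> Cx; apply: (Cx [set x | exists s, sset s `<=` C /\ adjoin (sset s) x]).
split; last first.
  move=> y Cy; exists [:: y]; split; first by move=> z /=; rewrite inE => /eqP ->.
  by apply: sub_adjoin; rewrite /= inE.
have two y z (op : F -> F -> F) :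
    (forall K, intermediate_field iota K -> K y -> K z -> K (op y z)) ->
    (exists s, sset s `<=` C /\ adjoin (sset s) y) ->
    (exists s, sset s `<=` C /\ adjoin (sset s) z) ->
    exists s, sset s `<=` C /\ adjoin (sset s) (op y z).
  move=> hop [s [sC hs]] [t [tC ht]]; exists (s ++ t); rewrite sset_cat; split.
    by move=> w [/sC|/tC].
  apply: hop; first exact: adjoin_inter.
    by apply: adjoinS hs => w; left.
  by apply: adjoinS ht => w; right.
split=> [c|y z|y z|y].
- by exists [::]; rewrite sset_nil; split=> //; exact: inter_base (adjoin_inter _ _) c.
- by apply: (two y z (fun y z => y - z)) => K hK hy hz; exact: (subringB hK).
- by apply: (two y z (fun y z => y * z)) => K hK hy hz; exact: (subringM hK).
by move=> h; apply: (two y y (fun y _ => y^-1) _ h h) => K hK hy _; exact: (interV hK).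
Qed.

Lemma acl_finitary C x : acl C x -> exists s, sset s `<=` C /\ acl (sset s) x.
Proof.
move=> [p [p0 hp px]].
have [s [sC hs]] : exists s, sset s `<=` C /\ coefs_in (adjoin (sset s)) p.
  suff: forall n, exists s, sset s `<=` C /\ forall i, (i < n)%N -> adjoin (sset s) p`_i.
    move=> /(_ (size p)) [s [sC hs]]; exists s; split=> // i.
    case: (ltnP i (size p)) => [/hs//|h]; rewrite nth_default //.
    exact: subring0 (adjoin_inter _ _).
  elim=> [|n [s [sC hs]]]; first by exists [::]; split=> // y.
  have [t [tC ht]] := adjoin_finitary (hp n); exists (s ++ t); rewrite sset_cat; split.
    by move=> w [/sC|/tC].
  move=> i; rewrite ltnS leq_eqVlt => /predU1P [->|/hs hi].
    by apply: adjoinS ht => w; right.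
  by apply: adjoinS hi => w; left.
by exists s; split=> //; exists p.
Qed.

Lemma adjoinU C D : adjoin (adjoin C `|` D) = adjoin (C `|` D).
Proof.
apply/seteqP; split.
  apply: adjoin_min; first exact: adjoin_inter.
  move=> x [|Dx]; last by apply: sub_adjoin; right.
  by apply: adjoinS => y; left.
by apply: adjoinS => x [Cx|Dx]; [left; exact: sub_adjoin|right].
Qed.

Lemma acl1_relation C (t x : F) : acl (C `|` [set t]) x ->
  exists (n : nat) (P : 'I_n -> {poly F}),
    [/\ forall i, coefs_in (adjoin C) (P i), exists i, (P i).[t] != 0 &
      \sum_(i < n) (P i).[t] * x ^+ i = 0].
Proof.
move=> [p [p0]]; rewrite -adjoinU adjoin1E; last exact: adjoin_inter.
move=> hp px.
have [d [hd d0 hP]] := @frac_in_clear _ _ iota (adjoin C) t 'I_(size p) (fun i => p`_i)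
  (adjoin_inter _ _) (fun i => hp i).
have [P hP'] := @choice _ _ (fun (i : 'I_(size p)) (P : {poly F}) =>
  coefs_in (adjoin C) P /\ p`_i * d.[t] = P.[t])
  (fun i : 'I_(size p) => let: ex_intro2 P h1 h2 := hP i in ex_intro _ P (conj h1 h2)).
exists (size p), P; split.
- by move=> i; case: (hP' i).
- have sp : ((size p).-1 < size p)%N by rewrite prednK // lt0n size_poly_eq0.
  exists (Ordinal sp); rewrite -(hP' _).2 mulf_neq0 //=.
  by rewrite -[_`__]/(lead_coef p) lead_coef_eq0.
transitivity (d.[t] * p.[x]); last by rewrite (rootP px) mulr0.
rewrite (horner_coef p) big_distrr /=; apply: eq_bigr => i _.
by rewrite -(hP' i).2 mulrA [d.[t] * _]mulrC.
Qed.

(** The relation between [t] and [x] is read the other way, as a polynomial in [t] with coefficients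
    in [C(x)]. If all its coefficients vanished, one of them would be a nontrivial equation of [x]
    over [C]. *)
Lemma acl_exchange C (t x : F) : acl (C `|` [set t]) x -> ~ acl C x -> acl (C `|` [set x]) t.
Proof.
move=> /acl1_relation [n [P [hP [i0 Pi0] rel]]] nx.
have hK := adjoin_inter iota (C `|` [set x]).
have CK : adjoin C `<=` adjoin (C `|` [set x]) by apply: adjoinS => y; left.
have Kx : adjoin (C `|` [set x]) x by apply: sub_adjoin; right.
pose Q := \sum_(i < n) (x ^+ i) *: P i.
exists Q; split.
- apply/eqP => Q0; move: Pi0; suff -> : P i0 = 0 by rewrite horner0 eqxx.
  apply/polyP => j; rewrite coef0.
  pose r := \poly_(i < n) (if insub i is Some i' then (P i')`_j else 0).
  have hr (i : 'I_n) : r`_i = (P i)`_j.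
    by rewrite coef_poly ltn_ord; case: insubP => [u _ /val_inj ->|]; rewrite ?ltn_ord.
  have [r0|r0] := eqVneq r 0; first by rewrite -hr r0 coef0.
  case: nx; exists r; split=> //.
    move=> i; rewrite coef_poly; case: ifP => [lt_in|_]; last exact: subring0 (adjoin_inter _ _).
    by case: insubP => [u _ _|_]; [exact: hP|exact: subring0 (adjoin_inter _ _)].
  apply/rootP; rewrite horner_poly; transitivity Q`_j; last by rewrite Q0 coef0.
  rewrite /Q coef_sum; apply: eq_bigr => i _.
  by rewrite coefZ -hr coef_poly ltn_ord mulrC.
- apply: (coefs_in_sum hK) => i _; apply: (coefs_inZ hK); first exact: (subringX hK).
  exact: coefs_inS CK (hP i).
apply/rootP; rewrite horner_sum -[RHS]rel; apply: eq_bigr => i _.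
by rewrite hornerZ mulrC.
Qed.

(** The sequential form, each term transcendental over [C] and the terms before it, suits
    inductions; symmetry is recovered through [indepP]. *)
Fixpoint indep C s : Prop :=
  if s is a :: s' then ~ acl C a /\ indep (C `|` [set a]) s' else True.

Lemma aclUS C D E : C `<=` acl D -> acl (C `|` E) `<=` acl (D `|` E).
Proof.
move=> CD; apply: acl_min => x [/CD|Ex]; last by apply: sub_acl; right.
by apply: aclS => y; left.
Qed.

Lemma indepS C D s : C `<=` acl D -> indep D s -> indep C s.
Proof.
elim: s C D => [//|a s IH] C D CD /= [na hs]; split.
  by move=> /(acl_min CD).
apply: IH hs => x [/CD|->]; last by apply: sub_acl; right.
by apply: aclS => y; left.
Qed.

Lemma indep_cat C s t : indep C (s ++ t) <-> indep C s /\ indep (C `|` sset s) t.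
Proof.
elim: s C => [|a s IH] C /=; first by rewrite sset_nil setU0; split=> // -[].
rewrite IH sset_cons setUA; split=> [[h [h1 h2]]|[[h h1] h2]]; by [].
Qed.

(** [b] is the first term of [t] whose addition makes [a] algebraic; exchange trades it for [a]. *)
Lemma acl_exchange_seq C a t : acl (C `|` sset t) a -> ~ acl C a ->
  exists t1 b t2, t = t1 ++ b :: t2 /\ acl (C `|` [set a] `|` sset (t1 ++ t2)) b.
Proof.
elim: t C => [|b t IH] C; first by rewrite sset_nil setU0.
rewrite sset_cons setUA => h na.
have [hb|nb] := pselect (acl (C `|` [set b]) a).
  exists [::], b, t; split=> //; move: (acl_exchange hb na).
  by apply: aclS => x; left.
have [t1 [c [t2 [-> hc]]]] := IH _ h nb.
exists (b :: t1), c, t2; split=> //; move: hc; apply: aclS.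
rewrite cat_cons sset_cons => x [[[]|]|]; [by left; left|by right; left|by left; right|].
by right; right.
Qed.

Lemma steinitz C s t : indep C s -> sset s `<=` acl (C `|` sset t) -> (size s <= size t)%N.
Proof.
elim: s C t => [//|a s IH] C t /= [na hs]; rewrite sset_cons => hst.
have [t1 [b [t2 [def_t hb]]]] := acl_exchange_seq (hst a (or_introl erefl)) na.
rewrite def_t in hst *.
rewrite size_cat /= addnS -size_cat ltnS; apply: IH hs _ => x sx.
have := hst x (or_intror sx); apply: acl_min => y [Cy|].
  by apply: sub_acl; left; left.
rewrite /= mem_cat inE => /or3P [h|/eqP ->//|h].
  by apply: sub_acl; right; rewrite /= mem_cat h.
by apply: sub_acl; right; rewrite /= mem_cat h orbT.
Qed.

Lemma indep_subseq_ex C s : exists t,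
  [/\ subseq t s, indep C t & sset s `<=` acl (C `|` sset t)].
Proof.
elim: s C => [|a s IH] C; first by exists [::]; rewrite sset_nil; split.
have [ha|na] := pselect (acl C a).
  have [t [ts ti st]] := IH C; exists t; split=> //.
    by apply: subseq_trans ts _; exact: subseq_cons.
  rewrite sset_cons => x [->|/st//]; move: ha; by apply: aclS => y; left.
have [t [ts ti st]] := IH (C `|` [set a]); exists (a :: t); split=> //=.
  by rewrite eqxx.
rewrite !sset_cons setUA => x [->|/st//].
by apply: sub_acl; left; right.
Qed.

(** In this characterization by cardinality the order of [s] no longer matters. The converse
    compares [s] with an independent subsequence that spans it. *)
Lemma indepP C s : indep C s <->
  forall t, sset s `<=` acl (C `|` sset t) -> (size s <= size t)%N.
Proof.
split=> [h t|h]; first exact: steinitz.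
have [t [ts ti st]] := indep_subseq_ex C s.
by have := size_subseq_leqif ts; move=> /geq_leqif; rewrite h // => /esym /eqP <-.
Qed.

Lemma indep_catC C s t : indep C (s ++ t) -> indep C (t ++ s).
Proof.
move=> /indepP h; apply/indepP => u hu; rewrite size_cat addnC -size_cat.
by apply: h => x; rewrite /= mem_cat orbC -mem_cat => /hu.
Qed.

Lemma indep_take C s n : indep C s -> indep C (take n s).
Proof. by rewrite -{1}(cat_take_drop n s) => /indep_cat []. Qed.

Lemma indep_span C s t : indep C s -> sset s `<=` acl (C `|` sset t) ->
  (size t <= size s)%N -> sset t `<=` acl (C `|` sset s).
Proof.
move=> hs st ts x tx; apply: contrapT => nx.
have : indep C (s ++ [:: x]) by apply/indep_cat; split.
move=> /(@steinitz C _ t); rewrite size_cat addn1 ltnNge ts => contra.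
suff: is_true false by []; apply: contra.
rewrite sset_cat sset_cons sset_nil setU0 => y [/st//|->].
by apply: sub_acl; right.
Qed.

End Dependence.

(** * Partial isomorphisms of fields *)

Section PartialMorphisms.
Variables (E : fieldType) (S : comNzRingType).
Local Notation R := (E * S)%type.
Implicit Types (A G Q : set R) (p q f : {poly R}).

(** A partial field isomorphism, given by its graph. *)
Definition partial_iso G : Prop :=
  [/\ subring G, forall z, G z -> z.1 = 0 -> z = 0 &
    forall z, G z -> z.1 != 0 -> exists2 w, G w & z * w = 1].

Definition ring_gen A : set R := smallest (@subring _) A.

(** By additivity the first clause makes the generated ring the graph of a map; the second makes
    images of nonzero elements invertible, so that the map extends to fractions although [S] need
    not be a field. *)
Definition good A : Prop := forall z, ring_gen A z ->
  (z.1 = 0 -> z.2 = 0) /\ (z.1 != 0 -> exists w, z.2 * w = 1).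

Lemma ring_gen_subring A : subring (ring_gen A).
Proof.
split=> [M|x y hx hy M hM|x y hx hy M hM]; first by case=> -[].
  by case: (hM) => -[_ h _] _; apply: h; [exact: hx|exact: hy].
by case: (hM) => -[_ _ h] _; apply: h; [exact: hx|exact: hy].
Qed.

Lemma sub_ring_gen A : A `<=` ring_gen A.
Proof. by move=> x Ax M [_]; apply. Qed.

Lemma ring_gen_min A G : subring G -> A `<=` G -> ring_gen A `<=` G.
Proof. by move=> hG AG x; apply. Qed.

Lemma ring_genS A B : A `<=` B -> ring_gen A `<=` ring_gen B.
Proof.
move=> AB; apply: ring_gen_min; first exact: ring_gen_subring.
by apply: subset_trans AB _; exact: sub_ring_gen.
Qed.

Lemma goodS A B : A `<=` B -> good B -> good A.
Proof. by move=> AB gB z /(ring_genS AB) /gB. Qed.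

Lemma good_partial_iso G : partial_iso G -> good G.
Proof.
move=> [hG h0 hV] z /(ring_gen_min hG (@subset_refl _ _)) Gz; split=> [/(h0 _ Gz) ->//|].
by move=> /(hV _ Gz) [w _ zw]; exists w.2; have := congr1 snd zw.
Qed.

Definition field_gen A : set R :=
  [set z | exists u v, [/\ ring_gen A u, ring_gen A v, v.1 != 0 & z * v = u]].

Lemma sub_field_gen A : A `<=` field_gen A.
Proof.
move=> x Ax; exists x, 1; rewrite mulr1 oner_neq0; split=> //.
  exact: sub_ring_gen.
exact: subring1 (ring_gen_subring A).
Qed.

Lemma field_gen_sub A Q : subring Q ->
  (forall z w, Q z -> z * w = 1 -> Q w) -> good A -> A `<=` Q -> field_gen A `<=` Q.
Proof.
move=> hQ QV gA AQ z [u [v [gu gv v0 zv]]].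
have [_ /(_ v0) [w2 vw2]] := gA _ gv.
pose w : R := (v.1^-1, w2); have vw : v * w = 1 by congr pair => //=; rewrite mulfV.
have -> : z = u * w by rewrite -zv -mulrA vw mulr1.
apply: (subringM hQ); first exact: (ring_gen_min hQ AQ).
by apply: QV vw; exact: (ring_gen_min hQ AQ).
Qed.

Lemma field_gen_partial_iso A : good A -> partial_iso (field_gen A).
Proof.
move=> gA; have hA := ring_gen_subring A.
have unit_ v : ring_gen A v -> v.1 != 0 -> exists w : R, v * w = 1.
  move=> gv v0; have [_ /(_ v0) [w2 vw2]] := gA _ gv.
  by exists (v.1^-1, w2); congr pair => //=; rewrite mulfV.
split.
- split.
  + exists 1, 1; rewrite mulr1 oner_neq0; split=> //; exact: subring1.
  + move=> x y [u [v [gu gv v0 e]]] [u' [v' [gu' gv' v0' e']]].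
    exists (u * v' - u' * v), (v * v'); split.
    * by apply: (subringB hA); exact: (subringM hA).
    * exact: (subringM hA).
    * by rewrite mulf_neq0.
    * by rewrite mulrBl -e -e' !mulrA [y * v' * v]mulrAC.
  + move=> x y [u [v [gu gv v0 e]]] [u' [v' [gu' gv' v0' e']]].
    exists (u * u'), (v * v'); split; try exact: (subringM hA).
      by rewrite mulf_neq0.
    by rewrite -e -e' mulrACA.
- move=> z [u [v [gu gv v0 e]]] z0; have [w vw] := unit_ _ gv v0.
  have u0 : u.1 = 0 by rewrite -e /= z0 mul0r.
  have : u = 0 by case: (gA _ gu) => /(_ u0) + _; case: (u) u0 => a b /= -> ->.
  by move=> h; rewrite -[z]mulr1 -vw mulrA e h mul0r.
move=> z [u [v [gu gv v0 e]]] z0.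
have u0 : u.1 != 0 by rewrite -e mulf_neq0.
have [w uw] := unit_ _ gu u0; have [v' vv'] := unit_ _ gv v0.
exists (v * w); first by exists v, u; rewrite -mulrA [w * u]mulrC uw mulr1.
by rewrite mulrA e.
Qed.

Section OneStep.
Variables (G : set R) (hG : partial_iso G) (a : E).

Let sG : subring G. Proof. by case: hG. Qed.

(** Every element of the ring generated by [G] and [(a, b)] is a value [p.[(a, b)]], so only these
    have to be tested. *)
Lemma good_adjoin b : (forall p, coefs_in G p ->
    (p.[(a, b)].1 = 0 -> p.[(a, b)].2 = 0) /\
    (p.[(a, b)].1 != 0 -> exists w, p.[(a, b)].2 * w = 1)) ->
  good (G `|` [set (a, b)]).
Proof.
move=> h z gz; suff [p hp ->] : exists2 p, coefs_in G p & z = p.[(a, b)] by exact: h.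
apply: (gz [set z | exists2 p, coefs_in G p & z = p.[(a, b)]]).
split; last first.
  move=> x [Gx|->]; first by exists x%:P; rewrite ?hornerC //; exact: coefs_inC.
  by exists 'X; rewrite ?hornerX //; exact: coefs_inX.
split=> [|_ _ [p hp ->] [q hq ->]|_ _ [p hp ->] [q hq ->]].
- by exists 1; rewrite ?hornerC //; apply: (coefs_inC sG); exact: subring1.
- by exists (p - q); rewrite ?hornerD ?hornerN //; exact: coefs_inB.
by exists (p * q); rewrite ?hornerM //; exact: coefs_inM.
Qed.

Lemma fst_horner p x : p.[x].1 = (map_poly fst p).[x.1].
Proof. exact: (esym (horner_map (fst : {rmorphism R -> E}) p x)). Qed.

Lemma snd_horner p x : p.[x].2 = (map_poly snd p).[x.2].
Proof. exact: (esym (horner_map (snd : {rmorphism R -> S}) p x)). Qed.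

Lemma coef_fst (p : {poly R}) i : (map_poly fst p)`_i = (p`_i).1.
Proof. exact: (coef_map (fst : {rmorphism R -> E})). Qed.

Lemma coef_snd (p : {poly R}) i : (map_poly snd p)`_i = (p`_i).2.
Proof. exact: (coef_map (snd : {rmorphism R -> S})). Qed.

(** The minimal polynomial of [a] over the domain of [G], with coefficients lifted to [G]. *)
Definition min_poly f : Prop :=
  [/\ f \is monic, coefs_in G f, (map_poly fst f).[a] = 0 &
    forall p, coefs_in G p -> (map_poly fst p).[a] = 0 -> (size p < size f)%N -> p = 0].

Lemma monic_multiple p : coefs_in G p -> p != 0 -> exists c, 
  [/\ G c, c%:P * p \is monic & size (c%:P * p) = size p].
Proof.
move=> hp p0; have lp : (lead_coef p).1 != 0.
  apply/eqP => l0; case: (hG) => _ /(_ _ (hp (size p).-1) l0) /eqP + _.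
  by rewrite -[_`__]/(lead_coef p) lead_coef_eq0 (negPf p0).
case: (hG) => _ _ /(_ _ (hp (size p).-1) lp) [c Gc lc]; exists c.
have cR : GRing.lreg c.
  by move=> x y /(congr1 (fun z => lead_coef p * z)); rewrite !mulrA lc !mul1r.
rewrite mul_polyC; split=> //; last exact: lreg_size.
by rewrite monicE lead_coef_lreg // mulrC -lc.
Qed.

Lemma min_poly_ex : (exists p, [/\ p != 0, coefs_in G p & (map_poly fst p).[a] = 0]) ->
  exists f, min_poly f.
Proof.
move=> [p0 [np0 hp0 ap0]].
pose P n := `[< exists p, [/\ p != 0, coefs_in G p, (map_poly fst p).[a] = 0 & size p = n] >].
have exP : exists n, P n by exists (size p0); apply/asboolP; exists p0.
case: (ex_minnP exP) => n /asboolP [p [np hp ap sp]] minn.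
have [c [Gc mc sc]] := monic_multiple hp np.
exists (c%:P * p); split=> //.
- by apply: (coefs_inM sG) => //; exact: coefs_inC.
- by rewrite rmorphM /= hornerM ap mulr0.
rewrite sc sp => q hq aq sq; apply/eqP/negPn/negP => nq.
by move: sq; rewrite ltnNge minn //; apply/asboolP; exists q.
Qed.

Section MinPoly.
Variables (f : {poly R}) (hf : min_poly f).

Lemma min_poly_size : (1 < size f)%N.
Proof.
case: hf => mf _ af _; rewrite ltnNge; apply/negP => sf.
have f1 : f = 1.
  have fC := size1_polyC sf; rewrite fC; move: mf.
  by rewrite monicE {1}fC lead_coefC => /eqP ->.
by move: af; rewrite f1 rmorph1 hornerC => /eqP; rewrite oner_eq0.
Qed.

Lemma min_poly_multiple p : coefs_in G p -> (map_poly fst p).[a] = 0 ->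
  exists2 q, coefs_in G q & p = q * f.
Proof.
case: hf => mf cf af minf hp ap.
have [q [r [hq hr e sr]]] := monic_division sG mf cf hp.
exists q => //; rewrite e (_ : r = 0) ?addr0 //; apply: minf => //.
by move: ap; rewrite e rmorphD rmorphM /= hornerD hornerM af mulr0 add0r.
Qed.

Lemma min_poly_bezout p : coefs_in G p -> (map_poly fst p).[a] != 0 ->
  exists u v, [/\ coefs_in G u, coefs_in G v & u * f + v * p = 1].
Proof.
case: (hf) => mf cf af minf hp ap.
pose I g := exists u v, [/\ coefs_in G u, coefs_in G v & u * f + v * p = g].
pose P n := `[< exists g, [/\ g \is monic, I g & size g = n] >].
have If : I f by exists 1, 0; split; [exact: (coefs_inC sG (subring1 sG))|exact: coefs_in0|rewrite mul1r mul0r addr0].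
have exP : exists n, P n by exists (size f); apply/asboolP; exists f.
case: (ex_minnP exP) => n /asboolP [g [mg [u [v [hu hv e]]] sg]] minn.
have hg : coefs_in G g by rewrite -e; apply: (coefs_inD sG); exact: (coefs_inM sG).
have dvd q : coefs_in G q -> I q -> exists2 h, coefs_in G h & q = h * g.
  move=> hq [u' [v' [hu' hv' e']]].
  have [h [r [hh hr eq sr]]] := monic_division sG mg hg hq.
  exists h => //; rewrite eq (_ : r = 0) ?addr0 //; apply: contrapT => /eqP r0.
  have [c [Gc mc sc]] := monic_multiple hr r0.
  move: sr; rewrite sg ltnNge minn //; apply/asboolP; exists (c%:P * r); split=> //.
  exists (c%:P * (u' - h * u)), (c%:P * (v' - h * v)).
  have hc := coefs_inC sG Gc.
  split; try by apply: (coefs_inM sG) => //; apply: (coefs_inB sG) => //; exact: (coefs_inM sG).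
  have -> : r = q - h * g by rewrite eq addrC addKr.
  rewrite -e -e'; ring.
have [h1 hh1 e1] := dvd f cf If.
have Ip : I p by exists 0, 1; split; [exact: coefs_in0|exact: (coefs_inC sG (subring1 sG))|rewrite mul1r mul0r add0r].
have [h2 hh2 e2] := dvd p hp Ip.
have ga : (map_poly fst g).[a] != 0.
  by apply: contraNneq ap => ga; rewrite e2 rmorphM /= hornerM ga mulr0.
have h1a : (map_poly fst h1).[a] = 0.
  by move/eqP: af; rewrite e1 rmorphM /= hornerM mulf_eq0 (negPf ga) orbF => /eqP.
have h1n : h1 != 0 by apply: contraTneq mf => h0; rewrite e1 h0 mul0r monicE lead_coef0 eq_sym oner_eq0.
(* [g] divides [f] and does not vanish at [a], so the cofactor [h1] does; minimality of [f] leaves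
   no room for a nonconstant [g]. *)
have h : ((size h1 + size g).-1 <= size h1)%N.
  rewrite -size_Mmonic // -e1 leqNgt; apply/negP => /(minf _ hh1 h1a) /eqP.
  by rewrite (negPf h1n).
have sg1 : (size g <= 1)%N.
  move: h1n h; rewrite -size_poly_eq0; case: (size h1) => [//|m] _.
  by rewrite addSn /= -[m.+1]addn1 leq_add2l.
exists u, v; split=> //; rewrite e; have gC := size1_polyC sg1.
by rewrite gC; move: mg; rewrite monicE {1}gC lead_coefC => /eqP ->.
Qed.

(** Polynomials over [G] that kill [a] are multiples of [f], which [b] kills as well; any other one
    is invertible modulo [f], so its value at [b] is a unit of [S]. *)
Lemma good_min_poly b : (map_poly snd f).[b] = 0 -> good (G `|` [set (a, b)]).
Proof.
move=> fb; apply: good_adjoin => p hp; rewrite fst_horner snd_horner /=; split=> ap.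
  have [q hq ->] := min_poly_multiple hp ap.
  by rewrite rmorphM /= hornerM fb mulr0.
have [u [v [hu hv e]]] := min_poly_bezout hp ap.
exists (map_poly snd v).[b].
have := congr1 (fun p => (map_poly snd p).[b]) e.
by rewrite rmorphD !rmorphM rmorph1 /= hornerD !hornerM fb mulr0 add0r hornerC mulrC.
Qed.

(** If the derivative killed [a], minimality would make it zero; but its top coefficient is
    [(size f).-1], nonzero in characteristic zero. *)
Lemma min_poly_separable : [pchar E] =i pred0 -> (map_poly fst f^`()).[a] != 0.
Proof.
move=> ch0; case: (hf) => mf cf af minf; have sf := min_poly_size.
apply/eqP => f'a.
have : f^`() = 0.
  apply: minf => //; first exact: coefs_in_deriv.
  by apply: lt_size_deriv; exact: monic_neq0.
move=> /(congr1 (fun p : {poly R} => p`_(size f).-2)); rewrite coef_deriv coef0.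
have -> : (size f).-2.+1 = (size f).-1 by lia.
have -> : f`_(size f).-1 = 1 by apply/eqP; rewrite -monicE.
move=> /(congr1 fst) /=.
have -> : fst (1 *+ (size f).-1 : R) = (size f).-1%:R :> E.
  exact: (rmorph_nat (fst : {rmorphism R -> E})).
by move/eqP; rewrite (pcharf0P _).1 //; lia.
Qed.

End MinPoly.
End OneStep.

Lemma partial_iso_algebraic G a : partial_iso G ->
  (exists p : {poly E}, [/\ p != 0, forall i, exists2 z, G z & z.1 = p`_i & root p a]) ->
  exists f, min_poly G a f.
Proof.
move=> hG [p [p0 hp pa]]; apply: min_poly_ex => //.
have [f hf] := @choice _ _ (fun i z => G z /\ z.1 = p`_i)
  (fun i => let: ex_intro2 z h1 h2 := hp i in ex_intro _ z (conj h1 h2)).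
pose q := \poly_(i < size p) f i.
have qp : map_poly fst q = p.
  apply/polyP => i; rewrite (coef_map (fst : {rmorphism R -> E})) /= coef_poly.
  by case: ltnP => [_|h]; [case: (hf i)|rewrite nth_default].
exists q; split; last by rewrite qp; exact/rootP.
  by apply: contraNneq p0 => q0; rewrite -qp q0 rmorph0.
move=> i; rewrite coef_poly; case: ifP => _; first by case: (hf i).
by case: hG => sG _ _; exact: subring0.
Qed.

(** An element of a generated ring involves finitely many generators, which lie in one member of the
    chain; the first term of the union accounts for the empty chain. *)
Lemma ring_gen_chain (F : set (set R)) A0 : total_on F subset ->
  ring_gen (A0 `|` \bigcup_(X in F) X) `<=`
  ring_gen A0 `|` \bigcup_(X in F) ring_gen (A0 `|` X).
Proof.
move=> tot; set U := _ `|` \bigcup_(X in F) ring_gen _.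
have two x y : U x -> U y -> exists A, [/\ A `<=` U, subring A, A x & A y].
  have one X : F X -> ring_gen (A0 `|` X) `<=` U by move=> FX z hz; right; exists X.
  have sub0 X : ring_gen A0 `<=` ring_gen (A0 `|` X) by apply: ring_genS => z; left.
  move=> [hx|[X FX hx]] [hy|[Y FY hy]].
  - by exists (ring_gen A0); split=> //; [move=> z; left|exact: ring_gen_subring].
  - exists (ring_gen (A0 `|` Y)); split=> //; [exact: one|exact: ring_gen_subring|exact: sub0].
  - exists (ring_gen (A0 `|` X)); split=> //; [exact: one|exact: ring_gen_subring|exact: sub0].
  have [XY|YX] := tot _ _ FX FY.
    exists (ring_gen (A0 `|` Y)); split=> //; [exact: one|exact: ring_gen_subring|].
    by apply: ring_genS hx => z [|/XY]; [left|right].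
  exists (ring_gen (A0 `|` X)); split=> //; [exact: one|exact: ring_gen_subring|].
  by apply: ring_genS hy => z [|/YX]; [left|right].
apply: ring_gen_min.
  split=> [|x y Ux Uy|x y Ux Uy].
  - by left; exact: subring1 (ring_gen_subring A0).
  - by have [A [AU sA Ax Ay]] := two x y Ux Uy; apply/AU/(subringB sA).
  - by have [A [AU sA Ax Ay]] := two x y Ux Uy; apply/AU/(subringM sA).
move=> x [A0x|[X FX Xx]]; first by left; exact: sub_ring_gen.
by right; exists X => //; apply: sub_ring_gen; right.
Qed.

(** [Q] bounds the pairs that may be added. *)
Lemma good_extension A0 Q : subring Q -> (forall z w, Q z -> z * w = 1 -> Q w) ->
  A0 `<=` Q -> good A0 ->
  (forall a G, partial_iso G -> A0 `<=` G -> G `<=` Q ->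
     exists f, min_poly G a f) ->
  (forall a G f, partial_iso G -> A0 `<=` G -> G `<=` Q -> min_poly G a f ->
     exists2 b, Q (a, b) & (map_poly snd f).[b] = 0) ->
  exists G, [/\ partial_iso G, A0 `<=` G, G `<=` Q & forall a, exists b, G (a, b)].
Proof.
move=> sQ QV AQ gA0 alg root.
(* Zorn's lemma runs over the sets added to [A0], so that the empty chain is admissible. *)
have [A [[AQ' gA] maxA]] : exists A, (A `<=` Q /\ good (A0 `|` A)) /\
    forall B, A `<` B -> ~ (B `<=` Q /\ good (A0 `|` B)).
  apply: (@Zorn_bigcup R [set A | A `<=` Q /\ good (A0 `|` A)]) => F FP tot.
  split; first by move=> x [X /FP [XQ _] /XQ].
  by move=> z /(ring_gen_chain tot) [/gA0//|[X /FP [_ gX] /gX]].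
pose G := field_gen (A0 `|` A).
have A0G : A0 `|` A `<=` G by exact: sub_field_gen.
have hG : partial_iso G by exact: field_gen_partial_iso.
have GQ : G `<=` Q by apply: field_gen_sub => // x [/AQ|/AQ'].
have AG : A `<=` G by move=> x Ax; apply: A0G; right.
have maxG B : G `<=` B -> B `<=` Q -> good B -> B `<=` A.
  move=> GB BQ gB; apply: contrapT => BA.
  apply: (maxA B); first by split=> // x /AG /GB.
  split=> //; apply: goodS gB => x [A0x|//]; apply/GB/A0G; by left.
exists G; split=> //; first by move=> x A0x; apply: A0G; left.
have A0G' : A0 `<=` G by move=> x A0x; apply: A0G; left.
move=> a; have [f hf] := alg a G hG A0G' GQ.
have [b Qab fb] := root a G f hG A0G' GQ hf.
(* [G] with [(a, b)] is again good, so maximality puts it back into [A]. *)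
exists b; apply/AG/(maxG (G `|` [set (a, b)])); [by move=> x; left| |exact: (good_min_poly hG hf fb)|by right].
by move=> x [/GQ|->].
Qed.

Lemma partial_iso_total G : partial_iso G -> (forall a, exists b, G (a, b)) ->
  exists f : {rmorphism E -> S}, forall a, G (a, f a).
Proof.
move=> [sG G0 _] tot; have [f hf] := choice tot.
have uniq_b a b b' : G (a, b) -> G (a, b') -> b = b'.
  move=> h h'; have /G0 : G ((a, b) - (a, b')) by exact: subringB.
  by move=> /(_ (subrr a)) /(congr1 snd) /eqP; rewrite /= subr_eq0 => /eqP.
have f1 : zmod_morphism f.
  by move=> x y; apply: uniq_b (hf _) _; exact: (subringB sG (hf x) (hf y)).
have f2 : monoid_morphism f.
  split; first by apply: uniq_b (hf _) _; exact: (subring1 sG).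
  by move=> x y; apply: uniq_b (hf _) _; exact: (subringM sG (hf x) (hf y)).
pose g : {rmorphism E -> S} := HB.pack f (GRing.isZmodMorphism.Build E S f f1)
  (GRing.isMonoidMorphism.Build E S f f2).
by exists g.
Qed.

End PartialMorphisms.

Lemma min_poly_root (E : fieldType) (S : closedFieldType) (G : set (E * S)%type) a f :
  min_poly G a f -> exists b, (map_poly snd f).[b] = 0.
Proof.
move=> hf; have sf := min_poly_size hf; have [mf _ _ _] := hf.
have : size (map_poly snd f) != 1%N.
  rewrite size_map_poly_id0 ?(monicP mf) ?oner_neq0 //.
  by apply/eqP => s1; rewrite s1 in sf.
by move=> /closed_rootP [b /rootP fb]; exists b.
Qed.

(** * Transcendence bases *)

Section MultivariateEvaluation.
Import -(notations) mpoly.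
Variables (k F : fieldType) (iota : {rmorphism k -> F}) (b : nat -> F).

Definition mev n (p : mpoly n k) : F := mmap iota (fun i : 'I_n => b i) p.

Lemma mmap1_widen n (m : multinom n) :
  mmap1 (fun i : 'I_n.+1 => b i) (mnmwiden m) =
  mmap1 (fun i : 'I_n => b i) m.
Proof.
rewrite /mmap1 big_ord_recr /= mnmwiden_ordmax expr0 mulr1.
by apply: eq_bigr => i _; rewrite mnmwiden_widen.
Qed.

Lemma mevD n p q : @mev n (p + q) = mev p + mev q.
Proof. exact: mmapD. Qed.
Lemma mevB n p q : @mev n (p - q) = mev p - mev q.
Proof. exact: mmapB. Qed.
Lemma mevM n p q : @mev n (p * q) = mev p * mev q.
Proof. exact: (rmorphM (mmap iota (fun i : 'I_n => b i) : {rmorphism mpoly n k -> F})). Qed.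
Lemma mev1 n : @mev n 1 = 1.
Proof. exact: (rmorph1 (mmap iota (fun i : 'I_n => b i) : {rmorphism mpoly n k -> F})). Qed.

Lemma mev_widen n (p : mpoly n k) : mev (mwiden p) = mev p.
Proof.
elim/mpolyind: p => [|c m p _ _ IH].
  by rewrite mwiden0 /mev !mmap0.
rewrite mwidenD !mevD IH; congr (_ + _).
by rewrite mwidenZ mwidenX /mev !mmapZ !mmapX mmap1_widen.
Qed.

Lemma muni_widen n (p : mpoly n k) : muni (mwiden p) = p%:P.
Proof.
elim/mpolyind: p => [|c m p _ _ IH].
  by rewrite mwiden0 muni0.
rewrite mwidenD muniD IH polyCD; congr (_ + _).
rewrite mwidenZ mwidenX muniZ muniE msuppX.
rewrite big_seq1 mcoeffX eqxx mnmwiden_ordmax expr0 scale1r alg_polyC.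
rewrite -mul_polyC -polyCM mul_mpolyC; congr (_ *: mpolyX _ _)%:P.
by apply/mnmP => i; rewrite mnmE mnmwiden_widen.
Qed.

Lemma muni_ord_max n :
  muni (mpolyX k (mnm1 (@ord_max n))) = 'X.
Proof.
rewrite muniE msuppX big_seq1 mcoeffX eqxx scale1r.
rewrite mnm1E eqxx expr1.
rewrite (_ : mpolyX _ _ = 1) ?scale1r // -mpolyX0; congr mpolyX.
apply/mnmP => i; rewrite mnmE mnm0E mnm1E.
by case: eqP => // /(congr1 val) /= e; have := ltn_ord i; rewrite -e ltnn.
Qed.

Lemma muni_mmulti n (r : {poly mpoly n k}) : muni (mmulti r) = r.
Proof.
rewrite /mmulti.
rewrite (rmorph_sum (@muni n k : {rmorphism mpoly n.+1 k -> {poly mpoly n k}})) /=.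
rewrite -[RHS]coefK poly_def; apply: eq_bigr => i _.
rewrite muniM muni_widen mul_polyC.
by rewrite (rmorphXn (@muni n k : {rmorphism mpoly n.+1 k -> {poly mpoly n k}})) /= muni_ord_max.
Qed.

Lemma mev_mmulti n (r : {poly mpoly n k}) :
  mev (mmulti r) = \sum_(i < size r) mev r`_i * b n ^+ i.
Proof.
rewrite /mev (rmorph_sum (mmap iota (fun i : 'I_n.+1 => b i) : {rmorphism mpoly n.+1 k -> F})).
apply: eq_bigr => i _; transitivity (mev (mwiden r`_i) * mev (mpolyX k (mnm1 (@ord_max n)) ^+ i)).
  exact: mevM.
rewrite mev_widen; congr (_ * _).
rewrite /mev (rmorphXn (mmap iota (fun i : 'I_n.+1 => b i) : {rmorphism mpoly n.+1 k -> F})).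
by rewrite /= mmapX mmap1U.
Qed.

Lemma mev_frac n x : adjoin iota (sset (mkseq b n)) x ->
  exists P Q : mpoly n k, mev Q != 0 /\ x = mev P / mev Q.
Proof.
move=> hx; apply: (hx [set x | exists P Q : mpoly n k, mev Q != 0 /\ x = mev P / mev Q]).
split; last first.
  move=> y /= /mapP [i]; rewrite mem_iota /= add0n => lt_in ->.
  exists (mpolyX k (mnm1 (Ordinal lt_in))), 1.
  by rewrite mev1 oner_neq0 divr1 /mev mmapX mmap1U.
split=> [c|_ _ [P [Q [Q0 ->]]] [P' [Q' [Q0' ->]]]|_ _ [P [Q [Q0 ->]]] [P' [Q' [Q0' ->]]]|_ [P [Q [Q0 ->]]]].
- by exists (mpolyC n c), 1; rewrite mev1 oner_neq0 divr1 /mev mmapC.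
- exists (P * Q' - P' * Q), (Q * Q'); rewrite mevM mulf_neq0 //; split=> //.
  by rewrite mevB !mevM -mulNr addf_div // mulNr.
- by exists (P * P'), (Q * Q'); rewrite !mevM mulf_neq0 // mulf_div.
have [P0|P0] := eqVneq (mev P) 0.
  exists 0, 1; rewrite mev1 oner_neq0 P0 mul0r invr0; split=> //.
  by rewrite /mev mmap0 mul0r.
by exists Q, P; rewrite invf_div.
Qed.

(** Clearing denominators in an equation of [b n] over the field generated by the previous terms
    gives a polynomial over [mpoly n k], that is one in [n.+1] variables, which vanishes at the
    basis and hence is zero. *)
Lemma transcendence_basis_indep : (forall (n : nat) (p : mpoly n k),
     mev p = 0 -> forall m, mcoeff m p = 0) ->
  forall n, ~ acl iota (sset (mkseq b n)) (b n).
Proof.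
move=> hb n [p [p0 hp pb]].
have [P hP] := @choice _ _ (fun i P => exists Q, mev Q != 0 /\ p`_i = @mev n P / mev Q)
  (fun i => mev_frac (hp i)).
have [Q hQ] := choice hP.
pose D := \prod_(j < size p) mev (Q j).
have D0 : D != 0 by apply/prodf_neq0 => i _; case: (hQ i).
pose r := \poly_(i < size p) (P i * \prod_(j < size p | (j : nat) != i) Q j).
have mev_prod (I : finType) (A : pred I) (f : I -> mpoly n k) :
    mev (\prod_(j | A j) f j) = \prod_(j | A j) mev (f j).
  exact: (rmorph_prod (mmap iota (fun i : 'I_n => b i) : {rmorphism mpoly n k -> F})).
have hr i : mev r`_i = p`_i * D.
  rewrite coef_poly; case: ltnP => [lt_i|le_i]; last first.
    by rewrite [p`__]nth_default // mul0r /mev mmap0.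
  have -> : D = mev (Q i) * \prod_(j < size p | (j : nat) != i) mev (Q j).
    by rewrite /D (bigD1 (Ordinal lt_i)).
  rewrite mevM mev_prod (hQ i).2 mulrA divfK //.
  by case: (hQ i).
have /hb r0 : mev (mmulti r) = 0.
  have e i : mev r`_i = (D *: p)`_i by rewrite hr coefZ mulrC.
  rewrite mev_mmulti; transitivity (D *: p).[b n]; last by rewrite hornerZ (rootP pb) mulr0.
  rewrite (@horner_coef_wide _ (size r)); first by apply: eq_bigr => i _; rewrite e.
  by apply/leq_sizeP => i le_i; rewrite -e nth_default // /mev mmap0.
have {}r0 : r = 0.
  by rewrite -[r]muni_mmulti (_ : mmulti r = 0) ?muni0 //; apply/mpolyP => m; rewrite r0 mcoeff0.
move: p0; suff -> : p = 0 by rewrite eqxx.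
apply/polyP => i; apply: (mulIf D0); rewrite coef0 mul0r -hr r0 coef0.
by rewrite /mev mmap0.
Qed.

End MultivariateEvaluation.

(** * Homogeneity of the automorphism group *)

Section GoodPairs.
Variables (k F : fieldType) (iota : {rmorphism k -> F}).
Implicit Types (S A G : set (F * F)%type) (K C : set F).
Local Notation acl := (acl iota).
Local Notation adjoin := (adjoin iota).
Local Notation inter := (intermediate_field iota).

Definition base_pairs : set (F * F)%type := [set z | exists c, z = (iota c, iota c)].
Definition diag K : set (F * F)%type := [set z | K z.1 /\ z.2 = z.1].

Lemma good_graph (f : {rmorphism F -> F}) S : S `<=` [set z | z.2 = f z.1] -> good S.
Proof.
move=> Sf z /(@ring_gen_min F F S [set z | z.2 = f z.1]) -> //=.
  by split=> [->|z0]; [rewrite rmorph0|exists (f z.1)^-1; rewrite mulfV ?fmorph_eq0].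
split=> [|x y /= hx hy|x y /= hx hy] /=; first by rewrite rmorph1.
  by rewrite rmorphB hx hy.
by rewrite rmorphM hx hy.
Qed.

Lemma partial_iso_domain (S : comNzRingType) (G : set (F * S)%type) : partial_iso G ->
  (forall c, (fst @` G) (iota c)) -> inter (fst @` G).
Proof.
move=> [sG G0 GV] bG; split=> //.
- by move=> _ _ [x Gx <-] [y Gy <-]; exists (x - y) => //; exact: subringB.
- by move=> _ _ [x Gx <-] [y Gy <-]; exists (x * y) => //; exact: subringM.
move=> _ [x Gx <-]; have [x0|x0] := eqVneq x.1 0.
  by rewrite x0 invr0; exists 0 => //; exact: subring0.
have [w Gw xw] := GV _ Gx x0; exists w => //.
by apply: (mulfI x0); rewrite mulfV //; have := congr1 fst xw.
Qed.

Lemma partial_iso_fst G : partial_iso G -> base_pairs `<=` G -> inter (fst @` G).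
Proof.
move=> hG bG; apply: partial_iso_domain hG _ => c; exists (iota c, iota c) => //.
by apply: bG; exists c.
Qed.

Lemma partial_iso_snd_eq0 G z : partial_iso G -> G z -> z.2 = 0 -> z = 0.
Proof.
move=> [sG G0 GV] Gz z0; apply: (G0 _ Gz); apply: contrapT => /eqP /(GV _ Gz) [w _].
by move=> /(congr1 snd) /= /eqP; rewrite z0 mul0r eq_sym oner_eq0.
Qed.

Lemma partial_iso_diag G : partial_iso G -> base_pairs `<=` G -> inter [set x | G (x, x)].
Proof.
move=> [sG G0 GV] bG; split.
- by move=> c; apply: bG; exists c.
- by move=> x y /= Gx Gy; exact: (subringB sG Gx Gy).
- by move=> x y /= Gx Gy; exact: (subringM sG Gx Gy).
move=> x /= Gx; have [x0|x0] := eqVneq x 0.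
  by rewrite x0 invr0; exact: (subring0 sG).
have [w Gw xw] := GV _ Gx x0; suff -> : (x^-1, x^-1) = w by [].
rewrite [w]surjective_pairing; congr pair; apply: (mulfI x0); rewrite mulfV //; apply/esym.
  exact: (congr1 fst xw).
exact: (congr1 snd xw).
Qed.

Lemma field_gen_adjoin S : good (base_pairs `|` S) ->
  field_gen (base_pairs `|` S) `<=`
  [set z | adjoin (fst @` S) z.1 /\ adjoin (snd @` S) z.2].
Proof.
have h1 := adjoin_inter iota (fst @` S); have h2 := adjoin_inter iota (snd @` S).
move=> gS; apply: field_gen_sub gS _.
- split; first by split; [exact: (subring1 h1)|exact: (subring1 h2)].
    by move=> x y [x1 x2] [y1 y2]; split; [exact: (subringB h1)|exact: (subringB h2)].
  by move=> x y [x1 x2] [y1 y2]; split; [exact: (subringM h1)|exact: (subringM h2)].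
- move=> z w [z1 z2] zw; have e1 := congr1 fst zw; have e2 := congr1 snd zw.
  have n1 : z.1 != 0 by apply/eqP => z0; move/eqP: e1; rewrite /= z0 mul0r eq_sym oner_eq0.
  have n2 : z.2 != 0 by apply/eqP => z0; move/eqP: e2; rewrite /= z0 mul0r eq_sym oner_eq0.
  have -> : w = (z.1^-1, z.2^-1).
    by rewrite [w]surjective_pairing; congr pair;
      [apply: (mulfI n1); rewrite mulfV|apply: (mulfI n2); rewrite mulfV].
  by split; [exact: (interV h1)|exact: (interV h2)].
move=> x [[c ->]|Sx]; first by split; exact: inter_base.
by split; apply: sub_adjoin; exists x.
Qed.

(** A nonzero polynomial over the field generated by [S] vanishes neither at [a] nor, after
    transport, at [b], so the pair imposes no condition. *)
Lemma good_transcendental S a b : good (base_pairs `|` S) ->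
  ~ acl (fst @` S) a -> ~ acl (snd @` S) b -> good (base_pairs `|` (S `|` [set (a, b)])).
Proof.
move=> gS na nb; set G := field_gen (base_pairs `|` S).
have hG : partial_iso G by exact: field_gen_partial_iso.
have GS := field_gen_adjoin gS; have [sG G0 _] := hG.
suff : good (G `|` [set (a, b)]).
  apply: goodS => x [bx|[Sx|->]]; [left|left|by right]; apply: sub_field_gen; by [left|right].
apply: good_adjoin => // p hp; rewrite fst_horner snd_horner /=.
have [->|p0] := eqVneq p 0; first by rewrite !rmorph0 !horner0 eqxx; split.
have [i pi0] : exists i, p`_i != 0.
  by exists (size p).-1; rewrite -[_`__]/(lead_coef p) lead_coef_eq0.
have n1 : (map_poly fst p).[a] != 0.
  apply/eqP => pa; apply: na; exists (map_poly fst p); split; last exact/rootP.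
    apply: contra_neq pi0 => /(congr1 (fun q : {poly F} => q`_i)).
    by rewrite coef_fst coef0 /= => /(G0 _ (hp i)).
  by move=> j; rewrite coef_fst; case: (GS _ (hp j)).
have n2 : (map_poly snd p).[b] != 0.
  apply/eqP => pb; apply: nb; exists (map_poly snd p); split; last exact/rootP.
    apply: contra_neq pi0 => /(congr1 (fun q : {poly F} => q`_i)).
    rewrite coef_snd coef0 /=.
    exact: (partial_iso_snd_eq0 hG (hp i)).
  by move=> j; rewrite coef_snd; case: (GS _ (hp j)).
split=> [/eqP|_]; first by rewrite (negPf n1).
by exists (map_poly snd p).[b]^-1; rewrite mulfV.
Qed.

End GoodPairs.

Section Homogeneity.
Variables (k F : closedFieldType) (iota : {rmorphism k -> F}).
Implicit Types (S A G : set (F * F)%type) (K C : set F).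
Local Notation acl := (acl iota).
Local Notation adjoin := (adjoin iota).
Local Notation inter := (intermediate_field iota).
Local Notation base_pairs := (base_pairs iota).
Local Notation indep := (indep iota).

Lemma extend_automorphism S : good (base_pairs `|` S) ->
  (forall x, acl (fst @` S) x) -> (forall x, acl (snd @` S) x) ->
  exists g : faut iota, forall z, S z -> g z.1 = z.2.
Proof.
move=> gS a1 a2.
have [G [hG bG _ totG]] : exists G, [/\ partial_iso G, base_pairs `|` S `<=` G,
    G `<=` setT & forall a, exists b, G (a, b)].
apply: good_extension.
- by split.
- by [].
- by [].
- by [].
- move=> a G hG bG _; apply: partial_iso_algebraic => //.
  have [p [p0 hp pa]] := a1 a; exists p; split=> // i.
  have bG' : base_pairs `<=` G by move=> x bx; apply: bG; left.
  have [z Gz <-] : (fst @` G) p`_i.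
    apply: adjoin_min (hp i); first exact: partial_iso_fst bG'.
    by move=> _ [z Sz <-]; exists z => //; apply: bG; right.
  by exists z.
- by move=> a G f _ _ _ /min_poly_root [b fb]; exists b.
have [f hf] := partial_iso_total hG totG.
have eqf x y : G (x, y) -> y = f x.
  move=> Gxy; case: (hG) => sG G0 _.
  have /G0 : G ((x, y) - (x, f x)) by exact: subringB (hf x).
  by move=> /(_ (subrr x)) /(congr1 snd) /eqP; rewrite /= subr_eq0 => /eqP.
have f4 c : f (iota c) = iota c by apply/esym/eqf/bG; left; exists c.
have imf : inter (range f).
  split=> [c|_ _ [x _ <-] [y _ <-]|_ _ [x _ <-] [y _ <-]|_ [x _ <-]].
  - by exists (iota c).
  - by exists (x - y); rewrite ?rmorphB.
  - by exists (x * y); rewrite ?rmorphM.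
  - by exists x^-1; rewrite ?fmorphV.
(* The image of [f] is algebraically closed, and [F] is algebraic over it. *)
have surj y : exists x, f x = y.
  have [p [p0 hp py]] := a2 y; apply: root_image p0 _ py => i.
  have [x _ <-] : range f p`_i; last by exists x.
  apply: adjoin_min (hp i) => // _ [[u v] Suv <-]; exists u => //=.
  by rewrite -(eqf u v) //; apply: bG; right.
have [f' hf'] := choice surj.
have f3 : bijective f.
  exists f' => x; last exact: hf'.
  by apply: (fmorph_inj f); rewrite hf'.
have f1 : zmod_morphism f by exact: rmorphB.
have f2 : monoid_morphism f by split; [exact: rmorph1|exact: rmorphM].
exists (FAut f1 f2 f3 f4) => -[u v] Suv /=; apply/esym/eqf/bG; by right.
Qed.

Hypothesis trdegF : countably_infinite_trdeg iota.

Lemma indep_mkseq C (beta : nat -> F) n :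
  (forall n, ~ acl (C `|` sset (mkseq beta n)) (beta n)) -> indep C (mkseq beta n).
Proof.
move=> bi; elim: n => [//|n IH]; rewrite mkseqS -cats1; by apply/indep_cat; split=> //=.
Qed.

(** The terms are picked greedily from the given transcendence basis: each time the first [b i]
    transcendental over [C] and the terms already chosen. As [s] is finite this never stops, so the
    complement of [C] is indexed by all of [nat]. *)
Lemma basis_extension C (s : seq F) : C `<=` acl (sset s) ->
  exists beta : nat -> F, (forall n, ~ acl (C `|` sset (mkseq beta n)) (beta n)) /\
    forall x, acl (C `|` range beta) x.
Proof.
have [b [/transcendence_basis_indep bi bs]] := trdegF.
have indep_b n : indep set0 (mkseq b n).
  by apply: indep_mkseq => i; rewrite set0U; exact: bi.
move=> Cs.
have next (L : seq F) : exists i, ~ acl (C `|` sset L) (b i) /\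
    forall j, (j < i)%N -> acl (C `|` sset L) (b j).
  pose P i := ~~ `[< acl (C `|` sset L) (b i) >].
  have exP : exists i, P i.
    apply: contrapT => h.
    have all_i i : acl (C `|` sset L) (b i).
      by apply: contrapT => ni; apply: h; exists i; apply/asboolP.
    have := @steinitz _ _ iota set0 (mkseq b (size (s ++ L)).+1) (s ++ L) (indep_b _).
    rewrite size_mkseq ltnn => contra; suff: is_true false by []; apply: contra.
    move=> _ /= /mapP [i _ ->]; apply: acl_min (all_i i) => x [/Cs|Lx].
      by apply: aclS => y ys; right; rewrite /= mem_cat ys.
    by apply: sub_acl; right; rewrite /= mem_cat Lx orbT.
  case: (ex_minnP exP) => i /asboolP ni mini; exists i; split=> // j lt_ji.
  apply: contrapT => nj; have : (i <= j)%N by apply: mini; apply/asboolP.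
  by rewrite leqNgt lt_ji.
have [nx hnx] := choice next.
pose L n := iter n (fun L => rcons L (b (nx L))) [::].
pose beta n := b (nx (L n)).
have LE n : L n = mkseq beta n by elim: n => [//|n IH]; rewrite mkseqS -IH.
exists beta; split; first by move=> n; rewrite -LE; case: (hnx (L n)).
have LS n : sset (L n) `<=` range beta by rewrite LE => _ /= /mapP [i _ ->]; exists i.
(* The chosen indices increase strictly, so every [b i] is eventually chosen or passed over as
   algebraic. *)
have incr n : (nx (L n) < nx (L n.+1))%N.
  rewrite ltnNge; apply/negP => le; have [ni _] := hnx (L n.+1).
  apply: ni; have [lt|eq] : (nx (L n.+1) < nx (L n))%N \/ nx (L n.+1) = nx (L n).
      by move: le; rewrite leq_eqVlt => /predU1P [->|]; [right|left].
    have [_ /(_ _ lt)] := hnx (L n); apply: aclS => x [Cx|Lx]; [by left|right].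
    by rewrite /= mem_rcons inE Lx orbT.
  by rewrite eq; apply: sub_acl; right; rewrite /= mem_rcons inE eqxx.
have ge_n n : (n <= nx (L n))%N.
  by elim: n => [//|n IH]; apply: leq_ltn_trans IH (incr n).
move=> x; apply: (acl_min _ (bs x)) => _ [i _ <-].
have lt_i : (i < nx (L i.+1))%N by apply: leq_trans (ge_n i.+1).
have [_ /(_ _ lt_i)] := hnx (L i.+1); apply: aclS => y [Cy|/LS Ly]; by [left|right].
Qed.

Lemma good_zip (t t' : seq F) : size t = size t' -> forall S, good (base_pairs `|` S) ->
  indep (fst @` S) t -> indep (snd @` S) t' ->
  good (base_pairs `|` (S `|` sset (zip t t'))).
Proof.
elim: t t' => [|a t IH] [|a' t'] //=; first by move=> _ S gS _ _; apply: goodS gS => x [|[|//]]; [left|right].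
move=> [st] S gS [na ht] [na' ht']; have := IH _ st _ (good_transcendental gS na na').
rewrite !image_setU !image_set1 => /(_ ht ht').
by rewrite sset_cons !setUA.
Qed.

Lemma good_sequence S (beta beta' : nat -> F) : good (base_pairs `|` S) ->
  (forall n, ~ acl (fst @` S `|` sset (mkseq beta n)) (beta n)) ->
  (forall n, ~ acl (snd @` S `|` sset (mkseq beta' n)) (beta' n)) ->
  good (base_pairs `|` (S `|` range (fun i => (beta i, beta' i)))).
Proof.
move=> gS bi bi'; pose B n := sset (zip (mkseq beta n) (mkseq beta' n)).
have BE n z : B n z <-> exists2 i, (i < n)%N & z = (beta i, beta' i).
  rewrite /B /mkseq zip_map; split=> [/mapP [i]|[i lt_i ->]].
    by rewrite mem_iota => lt_i ->; exists i.
  by apply/mapP; exists i; rewrite ?mem_iota.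
have gB n : good (base_pairs `|` (S `|` B n)).
  by apply: good_zip => //; [rewrite !size_mkseq|exact: indep_mkseq|exact: indep_mkseq].
have tot : total_on (range B) subset.
  move=> _ _ [m _ <-] [n _ <-]; have BS i j : (i <= j)%N -> B i `<=` B j.
    by move=> le_ij x /BE [l lt_l ->]; apply/BE; exists l => //; exact: leq_trans le_ij.
  by case: (leqP m n) => [/BS|/ltnW /BS]; [left|right].
have -> : base_pairs `|` (S `|` range (fun i => (beta i, beta' i))) =
    (base_pairs `|` S) `|` \bigcup_(X in range B) X.
  rewrite bigcup_image setUA; congr (_ `|` _); apply/seteqP; split=> [_ [i _ <-]|_ [n _ /BE [i _ ->]]].
    by exists i.+1 => //; apply/BE; exists i.
  by exists i.
move=> z /(ring_gen_chain tot) [/gS//|[_ [n _ <-]]].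
by rewrite -setUA => /gB.
Qed.

(** Both sides lie in the closure of one finite [s], so each has a complementary basis indexed by
    [nat]; once these are matched only algebraic extensions remain. *)
Lemma homogeneity S (s : seq F) : good (base_pairs `|` S) ->
  fst @` S `<=` acl (sset s) -> snd @` S `<=` acl (sset s) ->
  exists g : faut iota, forall z, S z -> g z.1 = z.2.
Proof.
move=> gS S1 S2.
have [beta [bi bs]] := basis_extension S1; have [beta' [bi' bs']] := basis_extension S2.
have [||g hg] := extend_automorphism (good_sequence gS bi bi').
- move=> x; apply: aclS (bs x) => y [[z Sz <-]|[i _ <-]]; first by exists z => //; left.
  by exists (beta i, beta' i) => //; right; exists i.
- move=> x; apply: aclS (bs' x) => y [[z Sz <-]|[i _ <-]]; first by exists z => //; left.
  by exists (beta i, beta' i) => //; right; exists i.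
by exists g => z Sz; apply: hg; left.
Qed.

(** * Rational functions over an algebraically closed subfield *)

Section Interpolation.
Hypothesis char0 : [pchar k] =i pred0.

Lemma nonroot_nat (h : {poly F}) : h != 0 -> exists m : nat, h.[iota m%:R] != 0.
Proof.
move=> h0; apply: contrapT => no.
have all_root m : h.[iota m%:R] = 0.
  by apply: contrapT => /eqP hm; apply: no; exists m.
pose rs := mkseq (fun m => iota m%:R) (size h).
have : (size rs < size h)%N.
  apply: max_poly_roots => //; first by apply/allP => _ /mapP [m _ ->]; exact/rootP.
  rewrite mkseq_uniq // => m n /fmorph_inj/eqP; rewrite -subr_eq0 => mn.
  apply/eqP; rewrite eqn_leq; apply/andP.
  suff le i j : (i%:R - j%:R == 0 :> k) -> (i <= j)%N.
    by split; [exact: le|apply: le; rewrite -opprB oppr_eq0].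
  move=> e; rewrite leqNgt; apply/negP => lt_ji.
  by move: e; rewrite -natrB ?(ltnW lt_ji) // ((pcharf0P k).1 char0) subn_eq0 leqNgt lt_ji.
by rewrite size_mkseq ltnn.
Qed.

Lemma coefs_in_factor C (p : {poly F}) c : inter C -> coefs_in C p -> C c -> root p c ->
  exists2 q, coefs_in C q & p = q * ('X - c%:P).
Proof.
move=> hC /(coefs_in_lift hC) [p' <-] /(subfield_lift hC) [c' <-].
rewrite fmorph_root => /factor_theorem [q ->].
exists (map_poly (subfield_incl (hK := hC)) q); first exact: coefs_in_map.
by rewrite rmorphM rmorphB /= map_polyX map_polyC.
Qed.

Section RationalFunctions.
Variables (K C : set F) (t : F).
Hypotheses (hK : inter K) (aclK : acl K `<=` K) (hC : inter C) (KC : K `<=` C).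
Hypothesis tC : ~ acl C t.

Let hKt := acl_inter iota (K `|` [set t]).
Let KL : K `<=` acl (K `|` [set t]).
Proof. by move=> x Kx; apply: sub_acl; left. Qed.
Let tL : acl (K `|` [set t]) t. Proof. by apply: sub_acl; right. Qed.

Lemma transcendental_horner p : coefs_in C p -> p.[t] = 0 -> p = 0.
Proof.
move=> hp pt; apply: contrapT => /eqP p0; apply: tC; exists p; split=> //; last exact/rootP.
by rewrite adjoin_eq.
Qed.

(** Cleared of denominators, the equation of [p.[t] / q.[t]] over [K(t)] is a polynomial relation of
    [t] over [C], hence an identity. Evaluated at a point of [K] it becomes an equation over [K] for
    the value there, which lies in [K] because [K] is algebraically closed in [F]. *)
Lemma rational_value (p q : {poly F}) : coefs_in C p -> coefs_in C q -> q != 0 ->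
  acl (K `|` [set t]) (p.[t] / q.[t]) ->
  exists c, [/\ K c, q.[c] != 0 & K (p.[c] / q.[c])].
Proof.
move=> hp hq q0 /acl1_relation [n [P [hP [i0 Pi0] rel]]].
rewrite adjoin_eq // in hP.
have qt : q.[t] != 0 by apply: contra_neq q0; exact: transcendental_horner.
have P0 : P i0 != 0 by apply: contra_neq Pi0 => ->; rewrite horner0.
pose H := \sum_(i < n) P i * p ^+ i * q ^+ (n - i).
have evH x : q.[x] != 0 -> H.[x] = q.[x] ^+ n * \sum_(i < n) (P i).[x] * (p.[x] / q.[x]) ^+ i.
  move=> qx; rewrite horner_sum big_distrr; apply: eq_bigr => i _ /=.
  rewrite !hornerM !horner_exp expr_div_n.
  have -> : q.[x] ^+ n = q.[x] ^+ (n - i) * q.[x] ^+ i.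
    by rewrite -exprD subnK // ltnW.
  have : q.[x] ^+ i != 0 by rewrite expf_neq0.
  by move=> h; field.
have H0 : H = 0.
  apply: transcendental_horner; last by rewrite evH // rel mulr0.
  apply: (coefs_in_sum hC) => i _; apply: (coefs_inM hC); last exact: (coefs_inXn hC).
  by apply: (coefs_inM hC); [exact: coefs_inS KC (hP i)|exact: (coefs_inXn hC)].
(* The point must avoid the zeros of [q] and of one nonzero coefficient, so that the equation stays
   nontrivial; in characteristic zero some integer does. *)
have [m] := nonroot_nat (mulf_neq0 q0 P0); rewrite hornerM mulf_eq0 negb_or => /andP [qm Pm].
exists (iota m%:R); split=> //; first exact: (inter_base hK).
set c := iota _ in qm Pm *; set v := p.[c] / q.[c].
have Kc : K c by exact: (inter_base hK).
apply: aclK; pose r := \poly_(i < n) (if insub i is Some i' then (P i').[c] else 0).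
have hr (i : 'I_n) : r`_i = (P i).[c].
  by rewrite coef_poly ltn_ord; case: insubP => [u _ /val_inj ->|]; rewrite ?ltn_ord.
exists r; split.
- by apply: contra_neq Pm => r0; rewrite -hr r0 coef0.
- rewrite adjoin_eq // => i; rewrite coef_poly; case: ifP => [lt_in|_]; last exact: subring0 hK.
  by case: insubP => [u _ _|_]; [exact: (subring_horner hK)|exact: subring0 hK].
apply/rootP; rewrite horner_poly.
have := evH c qm; rewrite H0 horner0 => /esym/eqP.
rewrite mulf_eq0 expf_eq0 (negPf qm) andbF /= => /eqP e; rewrite -[RHS]e.
by apply: eq_bigr => i _; rewrite -hr coef_poly ltn_ord.
Qed.

(** Descent on degrees: a value [v] of [p / q] at a point [c] of [K] lies in [K], and
    [p / q = v + (t - c) z'] with [z'] of smaller degree. *)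
Lemma rational_acl_descent n (p q : {poly F}) : (size p + size q <= n)%N ->
  coefs_in C p -> coefs_in C q -> q != 0 ->
  acl (K `|` [set t]) (p.[t] / q.[t]) -> adjoin (K `|` [set t]) (p.[t] / q.[t]).
Proof.
have hA := adjoin_inter iota (K `|` [set t]).
have KA : K `<=` adjoin (K `|` [set t]) by move=> x Kx; apply: sub_adjoin; left.
have tA : adjoin (K `|` [set t]) t by apply: sub_adjoin; right.
elim: n p q => [|n IH] p q spq hp hq q0 hz.
  by move: spq; rewrite leqn0 addn_eq0 !size_poly_eq0 (negPf q0) andbF.
(* It is enough to treat [size q <= size p]: the inverse fraction has the same total size. *)
have main (p' q' : {poly F}) : (size p' + size q' <= n.+1)%N -> (size q' <= size p')%N ->
    coefs_in C p' -> coefs_in C q' -> q' != 0 ->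
    acl (K `|` [set t]) (p'.[t] / q'.[t]) -> adjoin (K `|` [set t]) (p'.[t] / q'.[t]).
  clear p q spq hp hq q0 hz; move: p' q' => p q spq le_qp hp hq q0 hz.
  have qt : q.[t] != 0 by apply: contra_neq q0; exact: transcendental_horner.
  have [c [Kc qc Kv]] := rational_value hp hq q0 hz.
  set v := p.[c] / q.[c] in Kv; pose r := p - v *: q.
  have hr : coefs_in C r.
    by apply: (coefs_inB hC) => //; apply: (coefs_inZ hC) => //; exact: KC.
  have rc : root r c by rewrite rootE hornerD hornerN hornerZ divfK ?subrr.
  have [p1 hp1 e] := coefs_in_factor hC hr (KC Kc) rc.
  have zE : p.[t] / q.[t] = v + (t - c) * (p1.[t] / q.[t]).
    have : p.[t] = p1.[t] * (t - c) + v * q.[t].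
      have := congr1 (horner^~ t) e; rewrite /r !hornerE => <-; by rewrite subrK.
    by move=> ->; field.
  have tc : t - c != 0.
    rewrite subr_eq0; apply/eqP => tc; apply: tC; rewrite tc; apply: sub_acl; exact: KC.
  have hz1 : acl (K `|` [set t]) (p1.[t] / q.[t]).
    have -> : p1.[t] / q.[t] = (p.[t] / q.[t] - v) / (t - c).
      by rewrite zE [v + _]addrC addrK [(t - c) * _]mulrC mulfK.
    by apply: (inter_div hKt); apply: (subringB hKt) => //; exact: KL.
  rewrite zE; apply: (subringD hA); first exact: KA.
  apply: (subringM hA); first by apply: (subringB hA) => //; exact: KA.
  have [r0|r0] := eqVneq r 0.
    have -> : p1 = 0; last by rewrite horner0 mul0r; exact: subring0 hA.
    by move/eqP: e; rewrite r0 eq_sym mulf_eq0 polyXsubC_eq0 orbF => /eqP.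
  apply: IH => //; rewrite -ltnS; apply: leq_trans spq; rewrite ltn_add2r.
  have p10 : p1 != 0 by apply: contra_neq r0 => p10; rewrite e p10 mul0r.
  have : size r = (size p1).+1 by rewrite e size_Mmonic ?monicXsubC // size_XsubC addn2.
  move=> <-; rewrite /r; apply: leq_trans (size_polyD _ _) _.
  rewrite geq_max leqnn size_polyN /=; exact: leq_trans (size_scale_leq _ _) le_qp.
case: (leqP (size q) (size p)) => [le_qp|/ltnW le_pq]; first exact: main.
have [->|p0] := eqVneq p 0; first by rewrite horner0 mul0r; exact: subring0 hA.
rewrite -[_ / _]invrK invf_div; apply: (interV hA); apply: main => //; first by rewrite addnC.
by rewrite -invf_div; exact: (interV hKt).
Qed.

(** [K(t)] is relatively algebraically closed in [C(t)], a form of regularity of [C] over [K]. This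
    keeps minimal polynomials over [K(t)] from factoring over [C(t)]. *)
Lemma adjoin_acl_rational z : adjoin (C `|` [set t]) z -> acl (K `|` [set t]) z ->
  adjoin (K `|` [set t]) z.
Proof.
rewrite adjoin1E // => -[p [q [hp hq q0 ->]]]; apply: rational_acl_descent (leqnn _) hp hq _.
by apply: contra_neq q0 => ->; rewrite horner0.
Qed.

End RationalFunctions.
End Interpolation.

End Homogeneity.

(** * Stationarity *)

Section Stationarity.
Variables (k F : closedFieldType) (iota : {rmorphism k -> F}).
Implicit Types (S A G : set (F * F)%type) (K C : set F).
Local Notation acl := (acl iota).
Local Notation adjoin := (adjoin iota).
Local Notation inter := (intermediate_field iota).
Local Notation base_pairs := (base_pairs iota).
Local Notation indep := (indep iota).
Hypothesis char0 : [pchar k] =i pred0.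

Lemma primitive_element K : inter K -> forall s : seq F, sset s `<=` acl K ->
  exists2 d, acl K d & sset s `<=` adjoin (K `|` [set d]).
Proof.
move=> hK; elim=> [|a s IH] hs; first by exists 0 => //; exact: subring0 (acl_inter _ _).
have [d' hd' hs'] : exists2 d, acl K d & sset s `<=` adjoin (K `|` [set d]).
  by apply: IH => x xs; apply: hs; rewrite /= inE xs orbT.
have lift x : acl K x -> exists2 p : {poly subfield_type hK}, p != 0 & root (map_poly (subfield_incl (hK := hK)) p) x.
  move=> [p [p0 hp px]]; have {}hp : coefs_in K p by move: hp; rewrite adjoin_eq.
  have [q qp] := coefs_in_lift hK hp; exists q; last by rewrite qp.
  by apply: contra_neq p0 => q0; rewrite -qp q0 map_poly0.
have [p p0 pa] : exists2 p : {poly subfield_type hK}, p != 0 & root (map_poly (subfield_incl (hK := hK)) p) a.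
  by apply/lift/hs; rewrite /= inE eqxx.
have [q q0 qd] := lift _ hd'.
have ch0 : [pchar subfield_type hK] =i pred0.
  move=> n; have h1 := fmorph_pchar (subfield_incl (hK := hK)) n.
  have h2 := fmorph_pchar iota n; rewrite -h1 h2; exact: char0.
have [n [[u ud] [v vd]]] := pchar0_PET p0 pa q0 qd ch0.
set d := _ - _ in ud vd; exists d.
  by apply: (subringB (acl_inter _ _)) => //; [rewrite -mulr_natr; apply: (subringM (acl_inter _ _)) => //; rewrite -(rmorph_nat iota); exact: (inter_base (acl_inter _ _))|apply: hs; rewrite /= inE eqxx].
have hA := adjoin_inter iota (K `|` [set d]).
have KA : K `<=` adjoin (K `|` [set d]) by move=> x Kx; apply: sub_adjoin; left.
have dA : adjoin (K `|` [set d]) d by apply: sub_adjoin; right.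
have inA (w : {poly subfield_type hK}) : adjoin (K `|` [set d]) (map_poly (subfield_incl (hK := hK)) w).[d].
  by apply: (subring_horner hA) => //; apply: coefs_inS KA (coefs_in_map w).
rewrite sset_cons => x [->|/hs']; first by rewrite -ud.
apply: adjoin_min => // y [/KA//|->]; by rewrite -vd.
Qed.

Lemma ring_gen_finitary S A z : ring_gen (S `|` A) z ->
  exists s : seq (F * F)%type, sset s `<=` A /\ ring_gen (S `|` sset s) z.
Proof.
move=> hz; apply: (hz [set z | exists s : seq (F * F)%type, sset s `<=` A /\ ring_gen (S `|` sset s) z]).
split; last first.
  move=> x [Sx|Ax].
    by exists [::]; split; [move=> y|apply: sub_ring_gen; left].
  exists [:: x]; split; first by move=> y /=; rewrite inE => /eqP ->.
  by apply: sub_ring_gen; right; rewrite /= inE.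
have two x y (op : F * F -> F * F -> F * F) :
    (forall G, subring G -> G x -> G y -> G (op x y)) ->
    (exists s : seq (F * F)%type, sset s `<=` A /\ ring_gen (S `|` sset s) x) ->
    (exists s : seq (F * F)%type, sset s `<=` A /\ ring_gen (S `|` sset s) y) ->
    exists s : seq (F * F)%type, sset s `<=` A /\ ring_gen (S `|` sset s) (op x y).
  move=> hop [s [sA hs]] [t [tA ht]]; exists (s ++ t); rewrite sset_cat; split.
    by move=> w [/sA|/tA].
  apply: hop; first exact: ring_gen_subring.
    by apply: ring_genS hs => w [|]; [left|right; left].
  by apply: ring_genS ht => w [|]; [left|right; right].
split=> [|x y|x y].
- by exists [::]; split=> //; exact: (subring1 (ring_gen_subring _)).
- by apply: (two x y (fun x y => x - y)) => G hG hx hy; exact: (subringB hG).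
- by apply: (two x y (fun x y => x * y)) => G hG hx hy; exact: (subringM hG).
Qed.

Lemma coefs_in_roots K (p : {poly F}) : inter K -> p \is monic ->
  (forall x, root p x -> K x) -> coefs_in K p.
Proof.
move=> hK mp hp; have [s ps] := closed_field_poly_normal p.
move: ps; rewrite (monicP mp) scale1r => ps.
have hs : all (fun x => `[< K x >]) s.
  apply/allP => x xs; apply/asboolP/hp; rewrite ps root_prod_XsubC //.
rewrite ps; elim: s hs {ps} => [_|a s IH /= /andP [/asboolP Ka hs]].
  by rewrite big_nil; exact: (coefs_inC hK (subring1 hK)).
rewrite big_cons; apply: (coefs_inM hK); last exact: IH.
by apply: (coefs_inB hK); [exact: (coefs_inX hK)|exact: (coefs_inC hK)].
Qed.

Lemma partial_iso_diagS K : inter K -> partial_iso (diag K).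
Proof.
move=> hK; split.
- split; first by split=> //; exact: (subring1 hK).
    by move=> [x1 x2] [y1 y2] [/= Kx ->] [/= Ky ->]; split=> //=; exact: (subringB hK).
  by move=> [x1 x2] [y1 y2] [/= Kx ->] [/= Ky ->]; split=> //=; exact: (subringM hK).
- by move=> [x1 x2] [/= Kx ->] ->.
move=> [x1 x2] [/= Kx ->] x0; exists (x1^-1, x1^-1); first by split=> //=; exact: (interV hK).
by congr pair; rewrite /= mulfV.
Qed.

Lemma diag_snd_fst K (p : {poly F * F}) : coefs_in (diag K) p -> map_poly snd p = map_poly fst p.
Proof.
move=> hp; apply/polyP => i.
rewrite coef_snd coef_fst.
by case: (hp i).
Qed.

Section OneVariable.
Variables (G : set (F * F)%type) (K : set F) (t : F).
Hypotheses (hG : partial_iso G) (bG : base_pairs `<=` G).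
Hypotheses (hK : inter K) (aclK : acl K `<=` K) (KG : diag K `<=` G).
Hypotheses (t1 : ~ acl (fst @` G) t) (t2 : ~ acl (snd @` G) t).

(** By the primitive element theorem, an element of the generated ring involves, besides [G] and
    [L = K(t)], a single [d] algebraic over [L]. The minimal polynomial of [d] over [L] stays
    minimal over the larger domain of [G1]; its coefficients being diagonal pairs, its transport
    kills [d] too. *)
Lemma good_diag_acl1 : good (G `|` diag (acl (K `|` [set t]))).
Proof.
have hC : inter (fst @` G) by exact: partial_iso_fst bG.
have KC : K `<=` fst @` G by move=> x Kx; exists (x, x) => //; exact: KG.
pose A1 := base_pairs `|` (G `|` [set (t, t)]).
have gA1 : good A1.
  apply: good_transcendental => //; apply: goodS (good_partial_iso hG).
  by move=> x [/bG|].
pose G1 := field_gen A1; have hG1 : partial_iso G1 by exact: field_gen_partial_iso.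
have A1G1 : A1 `<=` G1 by exact: sub_field_gen.
have GG1 : G `<=` G1 by move=> x Gx; apply: A1G1; right; left.
have bG1 : base_pairs `<=` G1 by move=> x bx; apply: A1G1; left.
set L := adjoin (K `|` [set t]).
have hL : inter L by exact: adjoin_inter.
have dL : diag L `<=` G1.
  move=> [x y] [/= Lx ->]; apply: (adjoin_min (partial_iso_diag hG1 bG1) _ Lx).
  by move=> z [Kz|->]; [apply/GG1/KG|apply: A1G1; right; right].
have fstG1 z : G1 z -> adjoin (fst @` G `|` [set t]) z.1.
  move=> /(field_gen_adjoin gA1) [+ _]; rewrite image_setU image_set1.
  by apply: adjoinS.
move=> z /ring_gen_finitary [s [sA hz]].
pose ds := [seq x.1 | x <- s].
have [d hd dds] : exists2 d, acl L d & sset ds `<=` adjoin (L `|` [set d]).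
  apply: primitive_element => // _ /= /mapP [x xs ->].
  by have [h _] := sA _ xs; apply: acl_min h; apply: subset_trans (@sub_acl _ _ iota L); exact: sub_adjoin.
have hDL := partial_iso_diagS hL.
have [f hf] : exists f, min_poly (diag L) d f.
  apply: partial_iso_algebraic => //; case: hd => p [p0 hp pd]; exists p; split=> // i.
  by exists (p`_i, p`_i) => //; split=> //=; move: (hp i); rewrite adjoin_eq.
have [mf cf fd minf] := hf.
have cf1 : coefs_in G1 f by move=> i; exact/dL/cf.
have f0 : f != 0 by rewrite monic_neq0.
have [g hg] : exists g, min_poly G1 d g.
  by apply: min_poly_ex => //; exists f.
have [mg cg gd ming] := hg.
(* The roots of [g] are among those of [f], so its coefficients are algebraic over [K(t)]; they also
   lie in the field generated by [t] over the domain of [G], hence in [L]. *)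
have cgL : coefs_in (diag L) g.
  have mg1 : map_poly fst g \is monic.
    exact: (monic_map (fst : {rmorphism (F * F)%type -> F}) mg).
  have [q hq fq] := min_poly_multiple hG1 hg cf1 fd.
  have aclg : coefs_in (acl (K `|` [set t])) (map_poly fst g).
    apply: coefs_in_roots => //; first exact: acl_inter.
    move=> x gx; apply: (@root_acl _ _ _ _ (map_poly fst f)).
    - exact: (monic_neq0 (monic_map (fst : {rmorphism (F * F)%type -> F}) mf)).
    - move=> i; rewrite coef_fst.
      by apply: adjoin_acl; case: (cf i).
    - by rewrite fq rmorphM rootM gx orbT.
  have gL i : L (map_poly fst g)`_i.
    apply: (adjoin_acl_rational _ _ aclK hC KC t1 _ (aclg i)) => //.
    by rewrite coef_fst; exact: fstG1.
  move=> i; have Lgi : L (g`_i).1.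
    by move: (gL i); rewrite coef_fst.
  have [sG1 G10 _] := hG1.
  have : G1 (g`_i - ((g`_i).1, (g`_i).1)) by apply: (subringB sG1) => //; exact: dL.
  move=> /G10 /(_ (subrr _)) /(congr1 snd) /= /eqP; rewrite subr_eq0 => /eqP e.
  by split.
have le_fg : (size f <= size g)%N.
  rewrite leqNgt; apply/negP => /(minf _ cgL gd) g0.
  by move: (monic_neq0 mg); rewrite g0 eqxx.
have hf1 : min_poly G1 d f.
  split=> // p hp pd sp; apply: ming => //; exact: leq_trans sp le_fg.
have gG2 : good (G1 `|` [set (d, d)]).
  by apply: (good_min_poly hG1 hf1); rewrite (diag_snd_fst cf).
have bb : good (base_pairs `|` (G1 `|` [set (d, d)])).
  by apply: goodS gG2 => x [/bG1|//]; left.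
pose G2 := field_gen (base_pairs `|` (G1 `|` [set (d, d)])).
have hG2 : partial_iso G2 by exact: field_gen_partial_iso.
have sub2 : G1 `|` [set (d, d)] `<=` G2 by move=> x hx; apply: sub_field_gen; right.
have bG2 : base_pairs `<=` G2 by move=> x bx; apply: sub_field_gen; left.
have : good G2 by exact: good_partial_iso.
move=> /(_ z); apply; move: hz; apply: ring_gen_min; first exact: ring_gen_subring.
move=> x hx; apply: sub_ring_gen; move: x hx => x [Gx|xs]; first by apply: sub2; left; exact: GG1.
have [_ e] := sA _ xs; have : adjoin (L `|` [set d]) x.1 by apply: dds; apply/mapP; exists x.
have -> : x = (x.1, x.1) by rewrite -{2}e -surjective_pairing.
move=> /= hx; apply: (adjoin_min (partial_iso_diag hG2 bG2) _ hx).
by move=> y [Ly|->]; apply: sub2; [left; apply: dL|right].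
Qed.

End OneVariable.

(** Types over an algebraically closed base are stationary: [acl (K, beta)] may be
    added pointwise as soon as [beta] is independent on both sides. *)
Lemma stationarity (beta : seq F) : forall S K, good S -> inter K -> acl K `<=` K ->
  diag K `<=` S -> indep (fst @` S) beta -> indep (snd @` S) beta ->
  good (S `|` diag (acl (K `|` sset beta))).
Proof.
elim: beta => [|t beta IH] S K gS hK aclK KS.
  by move=> _ _; apply: goodS gS => -[x y] [//|[/=]]; rewrite sset_nil setU0 => /aclK Kx ->; apply: KS.
move=> /= [t1 b1] [t2 b2].
have bS : base_pairs `<=` S by move=> x [c ->]; apply: KS; split=> //; exact: (inter_base hK).
have bSS : base_pairs `|` S = S by apply/seteqP; split=> x; [case=> // /bS|right].
have gbS : good (base_pairs `|` S) by rewrite bSS.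
pose G := field_gen S; have hG : partial_iso G by exact: field_gen_partial_iso.
have SG : S `<=` G by exact: sub_field_gen.
have Gadj : G `<=` [set z | adjoin (fst @` S) z.1 /\ adjoin (snd @` S) z.2].
  by have := field_gen_adjoin gbS; rewrite bSS.
have f1 : fst @` G `<=` acl (fst @` S) by move=> _ [z /Gadj [h _] <-]; exact: adjoin_acl.
have f2 : snd @` G `<=` acl (snd @` S) by move=> _ [z /Gadj [_ h] <-]; exact: adjoin_acl.
pose K1 := acl (K `|` [set t]).
(* The closure of [K] and [t] is absorbed first and becomes the algebraically closed base for the
   rest of [beta]. *)
have g1 : good (G `|` diag K1).
  apply: good_diag_acl1 => //; [by move=> x /bS /SG|by move=> x /KS /SG| |].
    by move=> /(acl_min f1).
  by move=> /(acl_min f2).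
have K1t C : K `<=` C -> K1 `<=` acl (C `|` [set t]).
  by move=> KC; apply: aclS => x [/KC|]; [left|right].
have h : good ((G `|` diag K1) `|` diag (acl (K1 `|` sset beta))).
  apply: IH => //; first exact: acl_inter.
  - by apply: acl_min; exact: subset_refl.
  - apply: indepS b1 => _ [z [Gz|[Kz _]] <-].
      by apply: aclS (f1 z.1 _) => [x|]; [left|exists z].
    by apply: K1t Kz => x Kx; exists (x, x) => //; apply: KS.
  - apply: indepS b2 => _ [z [Gz|[Kz e]] <-].
      by apply: aclS (f2 z.2 _) => [x|]; [left|exists z].
    by rewrite e; apply: K1t Kz => x Kx; exists (x, x) => //; apply: KS.
apply: goodS h => x [Sx|[hx e]]; first by left; left; exact: SG.
right; split=> //; apply: aclS hx; rewrite sset_cons => y [Ky|[->|yb]].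
- by left; apply: sub_acl; left.
- by left; apply: sub_acl; right.
- by right.
Qed.

End Stationarity.

(** * Continuous characters of the automorphism group *)

Section ContinuousCharacters.
Variables (k F : closedFieldType) (iota : {rmorphism k -> F}).
Local Notation acl := (acl iota).
Local Notation adjoin := (adjoin iota).
Local Notation inter := (intermediate_field iota).
Local Notation base_pairs := (base_pairs iota).
Local Notation indep := (indep iota).
Local Notation G := (faut iota).
Hypothesis char0 : [pchar k] =i pred0.
Hypothesis trdegF : countably_infinite_trdeg iota.

Lemma fautK (g : G) x : g^-1%g (g x) = x. Proof. exact: (faut_invK g).1. Qed.

Definition fixes (g : G) (s : seq F) : Prop := forall x, x \in s -> g x = x.

Lemma fixesM g h s : fixes g s -> fixes h s -> fixes (g * h)%g s.
Proof. by move=> hg hh x xs; rewrite [LHS]/= hh // hg. Qed.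
Lemma fixesV g s : fixes g s -> fixes g^-1%g s.
Proof. by move=> hg x xs; rewrite -[in LHS](hg x xs) fautK. Qed.
Lemma fixes1 s : fixes 1%g s. Proof. by []. Qed.

Lemma fixed_inter (g : G) : inter [set x | g x = x].
Proof.
split=> [c|x y|x y|x] /=; first exact: faut_fix.
- by move=> hx hy; rewrite rmorphB /= hx hy.
- by move=> hx hy; rewrite rmorphM /= hx hy.
- by move=> hx; rewrite fmorphV /= hx.
Qed.

Lemma independent_seq (s : seq F) n : exists2 beta : seq F, size beta = n & indep (sset s) beta.
Proof.
have [beta [bi _]] := basis_extension trdegF (@sub_acl _ _ iota (sset s)).
exists (mkseq beta n); first exact: size_mkseq.
exact: indep_mkseq.
Qed.

Lemma fst_graph (T : Type) (A : set T) (f f' : T -> F) :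
  fst @` [set z | exists2 x, A x & z = (f x, f' x)] = f @` A.
Proof. by apply/seteqP; split=> [_ [_ [x Ax ->] <-]|_ [x Ax <-]]; [exists x|exists (f x, f' x) => //; exists x]. Qed.

Lemma snd_graph (T : Type) (A : set T) (f f' : T -> F) :
  snd @` [set z | exists2 x, A x & z = (f x, f' x)] = f' @` A.
Proof. by apply/seteqP; split=> [_ [_ [x Ax ->] <-]|_ [x Ax <-]]; [exists x|exists (f x, f' x) => //; exists x]. Qed.

Lemma fst_diag (K : set F) : fst @` (diag K) = K.
Proof. by apply/seteqP; split=> [_ [z [h _] <-]|x Kx] //; exists (x, x). Qed.
Lemma snd_diag (K : set F) : snd @` (diag K) = K.
Proof. by apply/seteqP; split=> [_ [z [h e] <-]|x Kx]; [rewrite e|exists (x, x)]. Qed.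

Lemma image_sset (T U : eqType) (f : T -> U) (r : seq T) : f @` sset r = sset (map f r).
Proof. by apply/seteqP; split=> [_ [x xr <-]|_ /= /mapP [x xr ->]]; [apply/mapP|]; exists x. Qed.

Lemma fst_zip (t t' : seq F) : size t = size t' -> fst @` sset (zip t t') = sset t.
Proof. by move=> e; rewrite image_sset [map _ _]unzip1_zip ?e. Qed.
Lemma snd_zip (t t' : seq F) : size t = size t' -> snd @` sset (zip t t') = sset t'.
Proof. by move=> e; rewrite image_sset [map _ _]unzip2_zip ?e. Qed.

Lemma good_diag_base K : inter K -> good (base_pairs `|` diag K).
Proof.
by move=> hK; apply: (@good_graph F idfun) => z [[c ->]//|[_ e]].
Qed.

Lemma acl_ssetS (s t : seq F) : {subset s <= t} -> acl (sset s) `<=` acl (sset t).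
Proof. by move=> st; apply: aclS => x /st. Qed.

Lemma acl_faut (g : G) (C : set F) x : acl C x -> acl (g @` C) (g x).
Proof.
move=> [p [p0 hp px]]; exists (map_poly g p); split.
- by rewrite map_poly_eq0.
- move=> i; rewrite coef_map /=; have : inter [set y | adjoin (g @` C) (g y)].
    have hA := adjoin_inter iota (g @` C).
    split=> [c|y z|y z|y] /=; first by rewrite faut_fix; exact: (inter_base hA).
    - by rewrite rmorphB; exact: (subringB hA).
    - by rewrite rmorphM; exact: (subringM hA).
    - by rewrite fmorphV; exact: (interV hA).
  move=> h; apply: (adjoin_min h _ (hp i)) => y Cy /=; apply: sub_adjoin; by exists y.
- by rewrite fmorph_root.
Qed.

(** [w] is sent to an element transcendental over [s ++ t]. In particular, an element fixed by all
    automorphisms that fix [s] is algebraic over [s]. *)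
Lemma moved_by_automorphism (s t : seq F) w : ~ acl (sset s) w ->
  exists g : G, fixes g s /\ ~ acl (sset t) (g w).
Proof.
move=> nw; have [[|b []] //= _ [nb _]] := independent_seq (s ++ t) 1.
have gS : good (base_pairs `|` (diag (acl (sset s)) `|` [set (w, b)])).
  apply: good_transcendental; first exact/good_diag_base/acl_inter.
    by rewrite fst_diag => h; apply: nw; exact: acl_min h.
  rewrite snd_diag => h; apply: nb; apply: acl_min h; apply: acl_ssetS => x xs.
  by rewrite mem_cat xs.
have [||g hg] := homogeneity trdegF (s := w :: b :: s) gS.
- rewrite image_setU fst_diag image_set1 => x [|->]; last by apply: sub_acl; rewrite /= inE eqxx.
  by apply: acl_ssetS => y ys; rewrite !inE ys !orbT.
- rewrite image_setU snd_diag image_set1 => x [|->]; last by apply: sub_acl; rewrite /= !inE eqxx orbT.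
  by apply: acl_ssetS => y ys; rewrite !inE ys !orbT.
exists g; split=> [x xs|]; first by apply: (hg (x, x)); left; split=> //; exact: sub_acl.
rewrite (hg (w, b)) /=; last by right.
by move=> h; apply: nb; apply: acl_ssetS h => y yt; rewrite mem_cat yt orbT.
Qed.

(** A transcendence basis of [t] over [s] is sent to elements independent over [s ++ C], with
    [acl (sset s)] fixed; the rest of [t] follows by algebraicity. *)
Lemma independent_copy (s t C : seq F) : exists w : G, exists beta : seq F,
  [/\ forall c, acl (sset s) c -> w c = c, size beta <= size t,
      indep (sset (s ++ C)) beta & forall x, x \in t -> acl (sset (s ++ beta)) (w x)]%N.
Proof.
have [tau [taut tau_i t_tau]] := indep_subseq_ex iota (sset s) t.
have [beta sb bi] := independent_seq (s ++ C) (size tau).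
pose K := acl (sset s); have hK : inter K by exact: acl_inter.
have gS : good (base_pairs `|` (diag K `|` sset (zip tau beta))).
  apply: good_zip; [by rewrite sb|exact: good_diag_base| |].
    by rewrite fst_diag; apply: indepS tau_i.
  rewrite snd_diag; apply: indepS bi; apply: acl_ssetS => x xs; by rewrite mem_cat xs.
have [||w hw] := homogeneity trdegF (s := s ++ tau ++ beta) gS.
- rewrite image_setU fst_diag fst_zip // => x [|xt].
    by apply: acl_ssetS => y ys; rewrite mem_cat ys.
  by apply: sub_acl; rewrite /= !mem_cat xt orbT.
- rewrite image_setU snd_diag snd_zip // => x [|xt].
    by apply: acl_ssetS => y ys; rewrite mem_cat ys.
  by apply: sub_acl; rewrite /= !mem_cat xt !orbT.
have wK c : K c -> w c = c by move=> Kc; apply: (hw (c, c)); left.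
exists w, beta; split=> //; first by rewrite sb; exact: size_subseq.
move=> x xt; have := acl_faut w (t_tau x xt); apply: acl_min => _ [y [ys|yt] <-].
  by rewrite wK; [apply: sub_acl; rewrite /= mem_cat ys|apply: sub_acl].
have : (fst @` sset (zip tau beta)) y by rewrite fst_zip.
move=> [z zz <-]; rewrite hw; last by right.
have : (snd @` sset (zip tau beta)) z.2 by exists z.
by rewrite snd_zip // => zb; apply: sub_acl; rewrite /= mem_cat zb orbT.
Qed.

Section Character.
(** [chi] is total, but constrained only on automorphisms fixing [s]; [chi_closed] says that its
    kernel there is closed for agreement on finite sets. *)
Variables (s : seq F) (chi : G -> rat).
Hypothesis chiM : forall g h, fixes g s -> fixes h s -> chi (g * h)%g = chi g + chi h.
Hypothesis chi_closed : forall g, fixes g s ->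
  (forall t : seq F, exists h, [/\ fixes h s, chi h = 0 & forall x, x \in t -> h x = g x]) ->
  chi g = 0.

Lemma chi1 : chi 1%g = 0.
Proof. by apply: (addrI (chi 1%g)); rewrite -chiM ?mulg1 ?addr0 //; exact: fixes1. Qed.

Lemma chiV g : fixes g s -> chi g^-1%g = - chi g.
Proof.
move=> hg; apply/eqP; rewrite -addr_eq0 -chiM //; last exact: fixesV.
by rewrite mulVg chi1.
Qed.

(** Over the algebraically closed base [acl s], [u] agrees on every finite set with a
    commutator: move [t] to [w t] independent of [t] and [u t]. *)
Lemma chi_geometric (u : G) : (forall c, acl (sset s) c -> u c = c) -> chi u = 0.
Proof.
move=> uK; pose K := acl (sset s); have hK : inter K by exact: acl_inter.
have fixK (g : G) : (forall c, K c -> g c = c) -> fixes g s.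
  by move=> h x xs; apply: h; exact: sub_acl.
apply: chi_closed; first exact: fixK.
move=> t; pose s1 := map u t.
have [w [beta [wK _ bi wt]]] := independent_copy s t (t ++ s1).
pose a := (u * w^-1)%g.
(* [b] is to undo [u] on [t] and to fix [K]; stationarity lets it also fix the closure of [beta],
   which contains the copy [w t]. *)
pose S := diag K `|` [set z | exists2 x, sset t x & z = (u x, x)].
have S1 : fst @` S `<=` acl (sset (s ++ t ++ s1)).
  rewrite image_setU fst_diag (fst_graph _ u idfun) => x [|[y yt <-]].
    by apply: acl_ssetS => y ys; rewrite mem_cat ys.
  by apply: sub_acl; rewrite /= !mem_cat map_f ?orbT.
have S2 : snd @` S `<=` acl (sset (s ++ t ++ s1)).
  rewrite image_setU snd_diag (snd_graph _ u idfun) => x [|[y yt <-]].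
    by apply: acl_ssetS => y ys; rewrite mem_cat ys.
  by apply: sub_acl; rewrite /= !mem_cat yt ?orbT.
have gS : good S.
  apply: (@good_graph F u^-1%g) => z [[Kz e]|[x _ ->]] /=; last by rewrite fautK.
  by rewrite e -{2}(uK _ Kz) fautK.
have gS' : good (S `|` diag (acl (K `|` sset beta))).
  apply: (stationarity char0 gS hK).
  - by apply: acl_min; exact: subset_refl.
  - by move=> x; left.
  - exact: indepS bi.
  - exact: indepS bi.
have gbS : good (base_pairs `|` (S `|` diag (acl (K `|` sset beta)))).
  apply: goodS gS' => x [[c ->]|//]; left; left; split=> //; exact: (inter_base hK).
have [||b hb] := homogeneity trdegF (s := s ++ t ++ s1 ++ beta) gbS.
- rewrite image_setU fst_diag => x [/S1|].
    by apply: acl_ssetS => y; rewrite !mem_cat => /or3P [] ->; rewrite ?orbT.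
  apply: acl_min => y [|yb]; first by apply: acl_ssetS => z zs; rewrite mem_cat zs.
  by apply: sub_acl; rewrite /= !mem_cat yb !orbT.
- rewrite image_setU snd_diag => x [/S2|].
    by apply: acl_ssetS => y; rewrite !mem_cat => /or3P [] ->; rewrite ?orbT.
  apply: acl_min => y [|yb]; first by apply: acl_ssetS => z zs; rewrite mem_cat zs.
  by apply: sub_acl; rewrite /= !mem_cat yb !orbT.
have bK c : K c -> b c = c by move=> Kc; apply: (hb (c, c)); left; left.
have hwK c : K c -> (w^-1)%g c = c by move=> Kc; rewrite -{1}(wK _ Kc) fautK.
have fa : fixes a s by apply: fixK => c Kc; rewrite [LHS]/= hwK ?uK.
have fb : fixes b s by exact: fixK.
have fVa := fixesV fa; have fVb := fixesV fb.
(* For [x] in [t] the successive images are [x], [u x], [w x], [w x], [u x]. *)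
exists (a * b * a^-1 * b^-1)%g; split.
- exact: (fixesM (fixesM (fixesM fa fb) fVa) fVb).
- rewrite (chiM (fixesM (fixesM fa fb) fVa) fVb) (chiM (fixesM fa fb) fVa) (chiM fa fb).
  by rewrite (chiV fa) (chiV fb) [chi a + _]addrC addrK subrr.
move=> x xt.
have e1 : (b^-1)%g x = u x.
  have bu : b (u x) = x by apply: (hb (u x, x)); left; right; exists x.
  by rewrite -{1}bu fautK.
have e2 : (a^-1)%g (u x) = w x.
  have aw : a (w x) = u x by rewrite [LHS]/= fautK.
  by rewrite -aw fautK.
have e3 : b (w x) = w x.
  apply: (hb (w x, w x)); right; split=> //=; move: (wt _ xt); apply: aclS.
  by rewrite sset_cat => y [ys|]; [left; exact: sub_acl|right].
by rewrite [LHS]/= e1 e2 e3 [LHS]/= fautK.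
Qed.

Lemma chiX g n : fixes g s -> fixes (g ^+ n)%g s /\ chi (g ^+ n)%g = chi g *+ n.
Proof.
move=> hg; elim: n => [|n [hn IH]]; first by rewrite expg0 chi1.
by rewrite expgS; split; [exact: fixesM|rewrite chiM // IH mulrS].
Qed.

(** Translation by one element [h0] of the level set reduces this to the kernel. *)
Lemma chi_eq_closed g q : fixes g s ->
  (forall t : seq F, exists h, [/\ fixes h s, chi h = q & forall x, x \in t -> h x = g x]) ->
  chi g = q.
Proof.
move=> hg h; have [h0 [fh0 ch0 _]] := h [::].
have fV := fixesV fh0.
suff : chi (h0^-1 * g)%g = 0.
  by rewrite chiM // chiV // ch0 => /eqP; rewrite addrC subr_eq0 => /eqP.
apply: chi_closed; first exact: fixesM.
move=> t; have [h1 [fh1 ch1 eh1]] := h t; exists (h0^-1 * h1)%g; split.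
- exact: fixesM.
- by rewrite chiM // chiV // ch0 ch1 addNr.
by move=> x xt; rewrite [LHS]/= eh1.
Qed.

Lemma expgDE (g : G) m n x : (g ^+ (m + n))%g x = (g ^+ m)%g ((g ^+ n)%g x).
Proof. by rewrite expgnDr. Qed.

Lemma expg_period (g : G) l m x : (g ^+ l)%g x = x -> (l %| m)%N -> (g ^+ m)%g x = x.
Proof.
move=> gl /dvdnP [q ->]; elim: q => [|q IH]; first by rewrite mul0n expg0.
by rewrite mulSn expgDE IH.
Qed.

Lemma expg_mod (g : G) l m n x : (g ^+ l)%g x = x -> (m = n %[mod l])%N ->
  (g ^+ m)%g x = (g ^+ n)%g x.
Proof.
move=> gl e; rewrite (divn_eq m l) (divn_eq n l) e ![(_ %/ l * l + _)%N]addnC !expgDE.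
have h q : (g ^+ (q * l))%g x = x by apply: (expg_period gl); exact: dvdn_mull.
by rewrite !h.
Qed.

(** The class of [a] modulo [N] is a basic open set of the profinite integers. A limit of powers of
    [g] with exponents in that class agrees with [g ^ a] on [t], so [chi] does not take the value
    [q] at it. *)
Definition avoids (g : G) (a N : nat) (q : rat) : Prop := exists t : seq F,
  (forall x, x \in t -> (g ^+ N)%g x = x) /\
  forall h : G, fixes h s -> (forall x, x \in t -> h x = (g ^+ a)%g x) -> chi h <> q.

(** Baire category: the limits [g ^ a], [a] in the profinite integers, would give
    uncountably many values of [chi]. *)
Lemma chi_locally_finite g : fixes g s ->
  (forall x, exists2 l, (0 < l)%N & (g ^+ l)%g x = x) -> chi g = 0.
Proof.
move=> hg per; apply: contrapT => /eqP c0.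
have [l lP] := @choice _ _ (fun x l => (0 < l)%N /\ (g ^+ l)%g x = x)
  (fun x => let: ex_intro2 l h1 h2 := per x in ex_intro _ l (conj h1 h2)).
(* An enumeration of the rationals; numbers that code nothing give 0. *)
pose q n : rat := odflt 0 (unpickle n).
have step (n : nat) (st : nat * nat) : exists st' : nat * nat, (0 < st.2)%N ->
    [/\ (0 < st'.2)%N, (st.2 %| st'.2)%N, (n.+1 %| st'.2)%N,
        (st'.1 = st.1 %[mod st.2])%N & avoids g st'.1 st'.2 (q n)].
  case: st => a N /=.
  have [N0|N0] := posnP N; first by exists (0, 0)%N; rewrite N0.
  have [a' [a'N qa']] : exists a', (a' = a %[mod N])%N /\ chi (g ^+ a')%g <> q n.
    have [qa|qa] := eqVneq (chi (g ^+ a)%g) (q n); last by exists a; split=> //; apply/eqP.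
    (* Adding [N] to the exponent changes the value of [chi] by [N] times [chi g], which is
       nonzero. *)
    exists (a + N)%N; rewrite modnDr; split=> //.
    rewrite (chiX _ hg).2 mulrnDr -(chiX a hg).2 qa => /eqP.
    by rewrite -subr_eq0 addrC addKr mulrn_eq0 (negPf c0) orbF -leqn0 leqNgt N0.
  have [t ht] : exists t : seq F, forall h : G, fixes h s ->
      (forall x, x \in t -> h x = (g ^+ a')%g x) -> chi h <> q n.
    apply: contrapT => no; apply: qa'; apply: chi_eq_closed; first by case: (chiX a' hg).
    move=> t; apply: contrapT => no'; apply: no; exists t => h fh eh ch; apply: no'.
    by exists h.
  pose L := (\prod_(x <- t) l x)%N.
  have L0 : (0 < L)%N.
    rewrite /L; elim: (t) => [|x r IH]; first by rewrite big_nil.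
    by rewrite big_cons muln_gt0 IH andbT; case: (lP x).
  (* The modulus absorbs the periods of [t], so that the class determines the action on [t], and the
     factor [n.+1], so that the exponents eventually stabilize modulo every period. *)
  exists (a', N * L * n.+1)%N => _ /=; split=> //.
  - by rewrite !muln_gt0 N0 L0.
  - by rewrite -mulnA dvdn_mulr.
  - exact: dvdn_mull.
  exists t; split=> // x xt; apply: (expg_period (lP x).2).
  have : (l x %| L)%N by rewrite /L (big_rem x) //= dvdn_mulr.
  by move=> lL; apply: dvdn_mulr; apply: dvdn_mull.
have [f hf] := choice (fun p => step p.1 p.2).
pose st := fix st n := if n is m.+1 then f (m, st m) else (0, 1)%N.
have stP n : (0 < (st n).2)%N.
  by elim: n => [//|n IH]; case: (hf (n, st n) IH).
have stS n : [/\ ((st n).2 %| (st n.+1).2)%N, (n.+1 %| (st n.+1).2)%N,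
    ((st n.+1).1 = (st n).1 %[mod (st n).2])%N & avoids g (st n.+1).1 (st n.+1).2 (q n)].
  by case: (hf (n, st n) (stP n)).
have stD m n : (m <= n)%N -> ((st m).2 %| (st n).2)%N /\ ((st n).1 = (st m).1 %[mod (st m).2])%N.
  move=> le_mn; rewrite -(subnK le_mn); elim: (n - m)%N => [|i [IH1 IH2]]; first by rewrite add0n.
  rewrite addSn; have [d1 _ e1 _] := stS (i + m)%N; split; first exact: dvdn_trans IH1 d1.
  rewrite -[RHS]IH2 -(modn_dvdm (st (i + m)%N.+1).1 IH1) e1 modn_dvdm //.
have conv x : exists y, forall n, (l x <= n)%N -> (g ^+ (st n).1)%g x = y.
  exists ((g ^+ (st (l x)).1)%g x); move=> n le_n; have [l0 lx] := lP x.
  apply: (expg_mod lx); have [_ e] := stD _ _ le_n.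
  have dl : (l x %| (st (l x)).2)%N by case: (l x) l0 => // m _; case: (stS m).
  by rewrite -(modn_dvdm _ dl) e modn_dvdm.
have [gam hgam] := choice conv.
have g1 : zmod_morphism gam.
  move=> x y; pose n := (l (x - y)%R + (l x + l y))%N.
  rewrite -(hgam (x - y) n) -?(hgam x n) -?(hgam y n) ?rmorphB //; rewrite /n; lia.
have g2 : monoid_morphism gam.
  split=> [|x y]; first by rewrite -(hgam 1 (l 1)) ?rmorph1.
  pose n := (l (x * y)%R + (l x + l y))%N.
  rewrite -(hgam (x * y) n) -?(hgam x n) -?(hgam y n) ?rmorphM //; rewrite /n; lia.
have g4 c : gam (iota c) = iota c by rewrite -(hgam _ (l (iota c))) ?faut_fix.
have ginj : injective gam.
  move=> x y; rewrite -(hgam x (l x + l y)%N) ?leq_addr // -(hgam y (l x + l y)%N) ?leq_addl //.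
  exact: fmorph_inj.
have gsurj y : exists x, gam x = y.
  (* [x] is the image of [y] under [g ^ (- a)], the exponent being made nonnegative by a multiple of
     the period. *)
  have [l0 ly] := lP y; pose a := (st (l y)).1; pose x := (g ^+ (l y * a - a))%g y.
  have px : (g ^+ l y)%g x = x by rewrite /x -expgDE addnC expgDE ly.
  exists x; pose n := (l x + l y)%N; rewrite -(hgam x n) ?leq_addr //.
  have dl : (l y %| (st (l y)).2)%N by case: (l y) l0 => // m _; case: (stS m).
  have e : ((st n).1 = a %[mod l y])%N.
    have [_ e] := stD (l y) n (leq_addl _ _).
    by rewrite -(modn_dvdm _ dl) e modn_dvdm.
  rewrite (expg_mod px e) /x -expgDE subnKC; last by rewrite leq_pmull.
  by apply: (expg_period ly); exact: dvdn_mulr.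
have g3 : bijective gam.
  have [h hh] := choice gsurj; exists h => x; last exact: hh.
  by apply: ginj; rewrite hh.
pose gm : G := FAut g1 g2 g3 g4.
have fgm : fixes gm s.
  move=> x xs /=; rewrite -(hgam x (l x)) //.
  by case: (chiX (st (l x)).1 hg) => + _; apply.
(* The value of [chi] at the limit is rational, and the step numbered by its code has excluded
   it. *)
have [_ _ _ [t [tN ht]]] := stS (pickle (chi gm)).
apply: (ht gm fgm); last by rewrite /q pickleK.
move=> x xt /=; set n := (pickle _).+1 in tN ht *.
rewrite -(hgam x (n + l x)%N) ?leq_addl //.
by apply: (expg_mod (tN x xt)); case: (stD n (n + l x)%N (leq_addr _ _)).
Qed.

Lemma expg_fixed (h : G) (C : set F) n : (forall c, C c -> h c = c) -> forall c, C c -> (h ^+ n)%g c = c.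
Proof.
by move=> hC c Cc; elim: n => [|n IH]; [rewrite expg0|rewrite expgS [LHS]/= IH hC].
Qed.

(** The orbit of [x] stays among the roots of one polynomial over [C]. *)
Lemma algebraic_periodic (h : G) (C : set F) x : (forall c, C c -> h c = c) -> acl C x ->
  exists2 l, (0 < l)%N & (h ^+ l)%g x = x.
Proof.
move=> hC [p [p0 hp px]].
have hC' : forall c, adjoin C c -> h c = c by apply: adjoin_min => //; exact: fixed_inter.
have rootX n : root p ((h ^+ n)%g x).
  have <- : map_poly (h ^+ n)%g p = p.
    by apply/polyP => i; rewrite coef_map /=; apply: expg_fixed (hp i).
  by rewrite fmorph_root.
apply: contrapT => no.
have : (size (mkseq (fun n => (h ^+ n)%g x) (size p)) < size p)%N.
  apply: max_poly_roots => //; first by apply/allP => _ /mapP [n _ ->].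
  rewrite mkseq_uniq // => m n; wlog lt_mn : m n / (m <= n)%N.
    by move=> H e; case: (leqP m n) => [/H|/ltnW /H h']; [apply|apply/esym/h'].
  rewrite -{1}(subnK lt_mn) addnC expgDE => /fmorph_inj /esym e.
  case: (posnP (n - m)%N) => [/eqP|n0]; first by rewrite subn_eq0 => le; apply/eqP; rewrite eqn_leq lt_mn.
  by case: no; exists (n - m)%N.
by rewrite size_mkseq ltnn.
Qed.

(** [g] is the product of [h] and [h^-1 * g], where [h] agrees with [g] on [acl (sset s)] and fixes
    a transcendence basis over [s]: the orbits of [h] are finite, and the other factor fixes
    [acl (sset s)]. *)
Theorem continuous_character_trivial g : fixes g s -> chi g = 0.
Proof.
move=> hg; pose K := acl (sset s); have hK : inter K by exact: acl_inter.
have [beta [bi bs]] := basis_extension trdegF (@sub_acl _ _ iota (sset s)).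
have gK c : K c -> K (g c).
  move=> Kc; have := acl_faut g Kc; apply: aclS => _ [x xs <-]; by rewrite /= hg.
pose S : set (F * F)%type := [set z | exists2 x, K x & z = (x, g x)].
have gS : good (base_pairs `|` S).
  by apply: (@good_graph F g) => z [[c ->]|[x _ ->]] //=; rewrite faut_fix.
have S1 : fst @` S `<=` K by rewrite (fst_graph _ idfun g) => _ [x Kx <-].
have S2 : snd @` S `<=` K by rewrite (snd_graph _ idfun g) => _ [x Kx <-]; exact: gK.
have KU (C : set F) : C `<=` K -> acl (C `|` sset [::]) `<=` K.
  by move=> CK; rewrite sset_nil setU0; exact: acl_min.
have aclK C : C `<=` K -> forall n, acl (C `|` sset (mkseq beta n)) `<=`
    acl (sset s `|` sset (mkseq beta n)).
  by move=> CK n; exact: aclUS.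
have gSb : good (base_pairs `|` (S `|` range (fun i => (beta i, beta i)))).
  by apply: good_sequence gS _ _ => n; [move=> /(aclK _ S1)/bi|move=> /(aclK _ S2)/bi].
have [||h hh] := extend_automorphism gSb.
- move=> x; apply: acl_min (bs x) => y [ys|[i _ <-]].
    by apply: sub_acl; exists (y, g y) => //; left; exists y => //; exact: sub_acl.
  by apply: sub_acl; exists (beta i, beta i) => //; right; exists i.
- move=> x; apply: acl_min (bs x) => y [ys|[i _ <-]].
    apply: sub_acl; exists (y, g y) => /=; last exact: hg.
    by left; exists y => //; exact: sub_acl.
  by apply: sub_acl; exists (beta i, beta i) => //; right; exists i.
have hKE c : K c -> h c = g c by move=> Kc; apply: (hh (c, g c)); left; exists c.
have hs : fixes h s by move=> x xs; rewrite hKE ?hg //; exact: sub_acl.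
have hb i : h (beta i) = beta i by apply: (hh (beta i, beta i)); right; exists i.
have ch : chi h = 0.
  apply: chi_locally_finite => // x; apply: algebraic_periodic (bs x).
  by move=> c [/hs|[i _ <-]].
have : chi (h^-1 * g)%g = 0.
  by apply: chi_geometric => c Kc; rewrite [LHS]/= -hKE // fautK.
rewrite chiM //; last exact: fixesV.
by rewrite chiV // ch oppr0 add0r.
Qed.

End Character.
End ContinuousCharacters.

(** * Fractions and residue fields *)

Definition is_ideal (R : comPzRingType) (J : set R) : Prop :=
  [/\ J 0, forall x y, J x -> J y -> J (x + y) & forall a x, J x -> J (a * x)].

(** Localizing at [den] and dividing by [kern] at once covers the algebras [R_r] and
    the residue fields of primes. *)
Record fraction_data (R : comPzRingType) := FractionData {
  den : set R;
  kern : set R;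
  den1 : den 1;
  denM : forall x y, den x -> den y -> den (x * y);
  kern_ideal : is_ideal kern }.

Section FractionRing.
Local Open Scope quotient_scope.
Variables (R : comPzRingType) (D : fraction_data R).
Local Notation M := (den D).
Local Notation J := (kern D).

Lemma kern0 : J 0. Proof. by case: (kern_ideal D). Qed.
Lemma kernD x y : J x -> J y -> J (x + y). Proof. by case: (kern_ideal D) => _ + _; apply. Qed.
Lemma kernM a x : J x -> J (a * x). Proof. by case: (kern_ideal D) => _ _; apply. Qed.
Lemma kernN x : J x -> J (- x). Proof. by move=> h; rewrite -mulN1r; exact: kernM. Qed.

Definition prefraction : Type := (R * {s : R | `[< M s >]})%type.
HB.instance Definition _ := Choice.on prefraction.

Definition fraction_rel (x y : prefraction) : bool :=
  `[< exists2 u, M u & J (u * (x.1 * sval y.2 - y.1 * sval x.2)) >].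

Lemma prefraction_den (x : prefraction) : M (sval x.2).
Proof. by apply/asboolP; exact: (svalP x.2). Qed.

Lemma fraction_rel_equiv : equiv_class_of fraction_rel.
Proof.
split=> [x|x y|y x z]; rewrite /fraction_rel.
- by apply/asboolP; exists 1; [exact: den1|rewrite subrr mulr0; exact: kern0].
- by apply/asboolP/asboolP => -[u Mu h]; exists u => //; rewrite -opprB mulrN; exact: kernN.
move=> /asboolP [u Mu hu] /asboolP [v Mv hv]; apply/asboolP.
exists (u * v * sval y.2); first by apply: denM (prefraction_den y); exact: denM.
have := kernD (kernM (v * sval z.2) hu) (kernM (u * sval x.2) hv).
by congr (J _); ring.
Qed.

Canonical fraction_rel_canonical := EquivRelPack fraction_rel_equiv.
Canonical fraction_rel_enc := defaultEncModRel fraction_rel.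

Definition fraction_ring : Type := {eq_quot fraction_rel}.
HB.instance Definition _ := Choice.on fraction_ring.

Definition mkfr (a s : R) (hs : M s) : fraction_ring :=
  \pi_{eq_quot fraction_rel} (a, exist _ s (asboolT hs)).

Lemma mkfr_eq a s (hs : M s) b t (ht : M t) :
  mkfr a hs = mkfr b ht <-> exists2 u, M u & J (u * (a * t - b * s)).
Proof.
split; first by move=> /eqquotP /asboolP.
by move=> h; apply/eqquotP/asboolP.
Qed.

Lemma mkfr_ex (x : fraction_ring) : exists a s (hs : M s), x = mkfr a hs.
Proof.
exists (repr (x : {eq_quot fraction_rel})).1, _, (prefraction_den (repr (x : {eq_quot fraction_rel}))).
rewrite -[LHS](reprK (x : {eq_quot fraction_rel})) /mkfr; congr (\pi _).
case: (repr _) => a [s hs] /=; congr (a, exist _ s _); exact: Prop_irrelevance.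
Qed.

Definition fnumr (x : fraction_ring) : R := projT1 (cid (mkfr_ex x)).
Definition fdenr (x : fraction_ring) : R := projT1 (cid (projT2 (cid (mkfr_ex x)))).
Definition fdenrP (x : fraction_ring) : M (fdenr x) :=
  projT1 (cid (projT2 (cid (projT2 (cid (mkfr_ex x)))))).
Lemma fraction_ringE x : x = mkfr (fnumr x) (fdenrP x).
Proof. exact: projT2 (cid (projT2 (cid (projT2 (cid (mkfr_ex x)))))). Qed.

Definition fr_add x y : fraction_ring :=
  mkfr (fnumr x * fdenr y + fnumr y * fdenr x) (denM (fdenrP x) (fdenrP y)).
Definition fr_opp x : fraction_ring := mkfr (- fnumr x) (fdenrP x).
Definition fr_mul x y : fraction_ring := mkfr (fnumr x * fnumr y) (denM (fdenrP x) (fdenrP y)).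

Lemma fr_addE a s (hs : M s) b t (ht : M t) :
  fr_add (mkfr a hs) (mkfr b ht) = mkfr (a * t + b * s) (denM hs ht).
Proof.
have /mkfr_eq [u Mu hu] := esym (fraction_ringE (mkfr a hs)).
have /mkfr_eq [v Mv hv] := esym (fraction_ringE (mkfr b ht)).
apply/mkfr_eq; exists (u * v); first exact: denM.
have := kernD (kernM (v * t * fdenr (mkfr b ht)) hu) (kernM (u * s * fdenr (mkfr a hs)) hv).
by congr (J _); ring.
Qed.

Lemma fr_mulE a s (hs : M s) b t (ht : M t) :
  fr_mul (mkfr a hs) (mkfr b ht) = mkfr (a * b) (denM hs ht).
Proof.
have /mkfr_eq [u Mu hu] := esym (fraction_ringE (mkfr a hs)).
have /mkfr_eq [v Mv hv] := esym (fraction_ringE (mkfr b ht)).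
apply/mkfr_eq; exists (u * v); first exact: denM.
have := kernD (kernM (v * t * fnumr (mkfr b ht)) hu) (kernM (u * a * fdenr (mkfr a hs)) hv).
by congr (J _); ring.
Qed.

Lemma fr_oppE a s (hs : M s) : fr_opp (mkfr a hs) = mkfr (- a) hs.
Proof.
have /mkfr_eq [u Mu hu] := esym (fraction_ringE (mkfr a hs)).
by apply/mkfr_eq; exists u => //; have := kernN hu; congr (J _); ring.
Qed.

Lemma mkfr_same a s (hs : M s) b t (ht : M t) : a * t = b * s -> mkfr a hs = mkfr b ht.
Proof.
move=> e; apply/mkfr_eq; exists 1; first exact: den1.
by rewrite e subrr mulr0; exact: kern0.
Qed.

Lemma fr_addA : associative fr_add.
Proof.
move=> x y z; rewrite (fraction_ringE x) (fraction_ringE y) (fraction_ringE z).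
by rewrite !fr_addE; apply: mkfr_same; ring.
Qed.
Lemma fr_addC : commutative fr_add.
Proof.
move=> x y; rewrite (fraction_ringE x) (fraction_ringE y) !fr_addE.
by apply: mkfr_same; ring.
Qed.
Lemma fr_add0 : left_id (mkfr 0 (den1 D)) fr_add.
Proof. by move=> x; rewrite (fraction_ringE x) !fr_addE; apply: mkfr_same; ring. Qed.
Lemma fr_addN : left_inverse (mkfr 0 (den1 D)) fr_opp fr_add.
Proof. by move=> x; rewrite (fraction_ringE x) fr_oppE !fr_addE; apply: mkfr_same; ring. Qed.

HB.instance Definition _ := GRing.isZmodule.Build fraction_ring fr_addA fr_addC fr_add0 fr_addN.

Lemma fr_mulA : associative fr_mul.
Proof.
move=> x y z; rewrite (fraction_ringE x) (fraction_ringE y) (fraction_ringE z).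
by rewrite !fr_mulE; apply: mkfr_same; ring.
Qed.
Lemma fr_mulC : commutative fr_mul.
Proof.
move=> x y; rewrite (fraction_ringE x) (fraction_ringE y) !fr_mulE.
by apply: mkfr_same; ring.
Qed.
Lemma fr_mul1 : left_id (mkfr 1 (den1 D)) fr_mul.
Proof. by move=> x; rewrite (fraction_ringE x) !fr_mulE; apply: mkfr_same; ring. Qed.
Lemma fr_mulDl : left_distributive fr_mul +%R.
Proof.
have addE a s (hs : M s) b t (ht : M t) :
  mkfr a hs + mkfr b ht = mkfr (a * t + b * s) (denM hs ht) by exact: fr_addE.
move=> x y z; have [a [s [hs ->]]] := mkfr_ex x; have [b [t [ht ->]]] := mkfr_ex y.
by have [c [u [hu ->]]] := mkfr_ex z; rewrite !(addE, fr_mulE); apply: mkfr_same; ring.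
Qed.

HB.instance Definition _ := GRing.Zmodule_isComPzRing.Build fraction_ring
  fr_mulA fr_mulC fr_mul1 fr_mulDl.

Lemma mkfrM a s (hs : M s) b t (ht : M t) : mkfr a hs * mkfr b ht = mkfr (a * b) (denM hs ht).
Proof. exact: fr_mulE. Qed.
Lemma mkfrD a s (hs : M s) b t (ht : M t) :
  mkfr a hs + mkfr b ht = mkfr (a * t + b * s) (denM hs ht).
Proof. exact: fr_addE. Qed.

Definition to_fraction (a : R) : fraction_ring := mkfr a (den1 D).

Lemma to_fraction_zmod : zmod_morphism to_fraction.
Proof.
move=> a b; rewrite -[- to_fraction b]/(fr_opp _) fr_oppE mkfrD.
by apply: mkfr_same; ring.
Qed.
Lemma to_fraction_monoid : monoid_morphism to_fraction.
Proof. by split=> [//|a b]; rewrite mkfrM; apply: mkfr_same; ring. Qed.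

HB.instance Definition _ := GRing.isZmodMorphism.Build R fraction_ring to_fraction to_fraction_zmod.
HB.instance Definition _ := GRing.isMonoidMorphism.Build R fraction_ring to_fraction to_fraction_monoid.

Lemma to_fraction_eq0 a : to_fraction a = 0 <-> exists2 u, M u & J (u * a).
Proof.
rewrite -[0]/(mkfr 0 (den1 D)) mkfr_eq; split=> -[u Mu hu]; exists u => //.
  by move: hu; rewrite mul0r subr0 mulr1.
by rewrite mul0r subr0 mulr1.
Qed.

Lemma mkfr_den a s (hs : M s) : mkfr a hs * to_fraction s = to_fraction a.
Proof. by rewrite mkfrM; apply: mkfr_same; ring. Qed.

Lemma to_fraction_unit s : M s -> exists v, to_fraction s * v = 1.
Proof. by move=> hs; exists (mkfr 1 hs); rewrite mulrC mkfr_den rmorph1. Qed.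

Section Lift.
Variables (K : fieldType) (f : {rmorphism R -> K}).
Hypotheses (fM : forall s, M s -> f s != 0) (fJ : forall a, J a -> f a = 0).

Definition fraction_lift (x : fraction_ring) : K := f (fnumr x) / f (fdenr x).

Lemma fraction_lift_mk a s (hs : M s) : fraction_lift (mkfr a hs) = f a / f s.
Proof.
have /mkfr_eq [u Mu /fJ] := esym (fraction_ringE (mkfr a hs)).
move/eqP; rewrite rmorphM mulf_eq0 (negPf (fM Mu)) /= rmorphB !rmorphM subr_eq0 => /eqP e.
by apply/eqP; rewrite eqr_div ?fM //; [apply/eqP|exact: fdenrP].
Qed.

Lemma fraction_lift_zmod : zmod_morphism fraction_lift.
Proof.
move=> x y; rewrite (fraction_ringE x) (fraction_ringE y).
rewrite -[- mkfr _ _]/(fr_opp _) fr_oppE mkfrD !fraction_lift_mk.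
have h1 := fM (fdenrP x); have h2 := fM (fdenrP y).
by rewrite rmorphD !rmorphM rmorphN; field; rewrite h1 h2.
Qed.
Lemma fraction_lift_monoid : monoid_morphism fraction_lift.
Proof.
split=> [|x y]; first by rewrite fraction_lift_mk rmorph1 divr1.
rewrite (fraction_ringE x) (fraction_ringE y) mkfrM !fraction_lift_mk.
have h1 := fM (fdenrP x); have h2 := fM (fdenrP y).
by rewrite !rmorphM; field; rewrite h1 h2.
Qed.

Lemma fraction_lift_ex : exists psi : {rmorphism fraction_ring -> K},
  forall a, psi (to_fraction a) = f a.
Proof.
pose psi : {rmorphism fraction_ring -> K} := HB.pack fraction_lift
  (GRing.isZmodMorphism.Build fraction_ring K fraction_lift fraction_lift_zmod)
  (GRing.isMonoidMorphism.Build fraction_ring K fraction_lift fraction_lift_monoid).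
by exists psi => a; rewrite [LHS]fraction_lift_mk rmorph1 divr1.
Qed.

End Lift.
End FractionRing.

Section ResidueFields.
Variable R : comPzRingType.
Implicit Types (P I : set R).

Definition prime_ideal P : Prop :=
  [/\ is_ideal P, ~ P 1 & forall x y, P (x * y) -> P x \/ P y].

Lemma residue_field P : prime_ideal P ->
  exists (K : fieldType) (f : {rmorphism R -> K}), forall x, f x = 0 <-> P x.
Proof.
move=> [idP P1 primeP].
have M1 : (~` P) 1 by [].
have MM x y : (~` P) x -> (~` P) y -> (~` P) (x * y).
  by move=> nx ny /primeP [].
pose D := FractionData M1 MM idP; pose L := fraction_ring D.
have eq0 a : to_fraction D a = 0 <-> P a.
  rewrite to_fraction_eq0 /=; split=> [[u nu /primeP [/nu|]]|Pa] //.
  by exists 1 => //; rewrite mul1r.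
have one0 : (1 : L) != 0.
  by apply/eqP => e; apply: P1; apply/eq0; rewrite rmorph1.
pose Lnz : comNzRingType := HB.pack L (GRing.PzSemiRing_isNonZero.Build L one0).
have invP (x : L) : exists y, x != 0 -> y * x = 1.
  have [a [s [hs ->]]] := mkfr_ex x; have [Pa|nPa] := pselect (P a).
    exists 0 => /eqP []; apply/mkfr_eq; exists 1 => //=.
    have [_ _ idM] := idP; have := idM 1 a Pa; by rewrite mul0r subr0 mulr1.
  by exists (@mkfr _ D s a nPa) => _; rewrite mkfrM; apply: mkfr_same => /=; ring.
have [inv hinv] := choice invP.
pose inv' (x : Lnz) : Lnz := if x == 0 then 0 else inv x.
have mulV (x : Lnz) : x != 0 -> inv' x * x = 1 by move=> x0; rewrite /inv' (negPf x0); exact: hinv.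
have inv0 : inv' 0 = 0 by rewrite /inv' eqxx.
pose K : fieldType := HB.pack Lnz (GRing.ComNzRing_isField.Build Lnz mulV inv0).
by exists K, (to_fraction D : {rmorphism R -> K}).
Qed.

Definition ideal_gen I : set R := [set x | exists (n : nat) (a r : 'I_n -> R),
  (forall i, I (r i)) /\ \sum_(i < n) a i * r i = x].

Lemma ideal_gen_ideal I : is_ideal (ideal_gen I).
Proof.
split=> [|x y [n [a [r [hr <-]]]] [m [b [t [ht <-]]]]|c x [n [a [r [hr <-]]]]].
- by exists 0%N, (fun=> 0), (fun=> 0); rewrite big_ord0; split=> // -[].
- exists (n + m)%N, (fun i => match fintype.split i with inl j => a j | inr j => b j end),
    (fun i => match fintype.split i with inl j => r j | inr j => t j end).
  split; first by move=> i; case: fintype.split.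
  rewrite big_split_ord /=; congr (_ + _); apply: eq_bigr => i _.
    by rewrite -[lshift _ _]/(unsplit (inl i)) unsplitK.
  by rewrite -[rshift _ _]/(unsplit (inr i)) unsplitK.
by exists n, (fun i => c * a i), r; split=> //; rewrite big_distrr; apply: eq_bigr => i _ /=; rewrite mulrA.
Qed.

Lemma sub_ideal_gen I : I `<=` ideal_gen I.
Proof. by move=> x Ix; exists 1%N, (fun=> 1), (fun=> x); rewrite big_ord1 mul1r. Qed.

Lemma prime_ideal_ex I (f : R) : (forall n, ~ ideal_gen I (f ^+ n)) ->
  exists P, [/\ prime_ideal P, I `<=` P & ~ P f].
Proof.
(* The family consists of subsets of admissible ideals, so that it is closed under unions of chains,
   the empty one included; the ideal [J] around a maximal set is then itself maximal. *)
move=> If; pose Q := [set P | exists J, [/\ P `<=` J, I `<=` J, is_ideal J & forall n, ~ J (f ^+ n)]].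
have [A [[J [AJ IJ idJ Jf]] maxA]] : exists A, Q A /\ forall B, A `<` B -> ~ Q B.
  apply: Zorn_bigcup => F FQ tot.
  have idI := ideal_gen_ideal I.
  have gen_min X J : is_ideal J -> X `<=` J -> ideal_gen X `<=` J.
    move=> [J0 JD JM] XJ x [n [a [r [hr <-]]]].
    by elim/big_ind: _ => // i _; apply/JM/XJ.
  pose U := ideal_gen I `|` \bigcup_(X in F) ideal_gen (I `|` X).
  exists U; have mono X Y : X `<=` Y -> ideal_gen X `<=` ideal_gen Y.
    by move=> XY; apply: gen_min; [exact: ideal_gen_ideal|apply: subset_trans XY _; exact: sub_ideal_gen].
  split.
  - by move=> x [X FX Xx]; right; exists X => //; apply: sub_ideal_gen; right.
  - by move=> x Ix; left; exact: sub_ideal_gen.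
  - have IX X : ideal_gen I `<=` ideal_gen (I `|` X) by apply: mono => z; left.
    split=> [|x y|a x].
    + by left; case: idI.
    + move=> [hx|[X FX hx]] [hy|[Y FY hy]].
      * by left; case: idI => _ + _; apply.
      * by right; exists Y => //; case: (ideal_gen_ideal (I `|` Y)) => _ h _; apply: h => //; exact: IX.
      * by right; exists X => //; case: (ideal_gen_ideal (I `|` X)) => _ h _; apply: h => //; exact: IX.
      have [XY|YX] := tot _ _ FX FY; right.
        exists Y => //; case: (ideal_gen_ideal (I `|` Y)) => _ h _; apply: h => //.
        by apply: mono hx => z [|/XY]; [left|right].
      exists X => //; case: (ideal_gen_ideal (I `|` X)) => _ h _; apply: h => //.
      by apply: mono hy => z [|/YX]; [left|right].
    + move=> [hx|[X FX hx]]; first by left; case: idI => _ _; apply.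
      by right; exists X => //; case: (ideal_gen_ideal (I `|` X)) => _ _; apply.
  move=> n [/If//|[X FX]]; have [J [XJ IJ idJ Jf]] := FQ X FX.
  by move=> /(gen_min _ _ idJ) h; apply/(Jf n)/h => z [/IJ|/XJ].
have maxJ K : is_ideal K -> J `<=` K -> (forall n, ~ K (f ^+ n)) -> K `<=` J.
  move=> idK JK Kf x Kx; apply: contrapT => nx; apply: (maxA K).
    by split=> [y /AJ/JK//|KA]; apply/nx/AJ/KA.
  by exists K; split=> // y /IJ /JK.
have [J0 JD JM] := idJ.
pose add x := [set z | exists a y, J y /\ z = y + a * x].
have add_id x : is_ideal (add x).
  split=> [|_ _ [a [y [Jy ->]]] [b [z [Jz ->]]]|c _ [a [y [Jy ->]]]].
  - by exists 0, 0; rewrite mul0r addr0.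
  - by exists (a + b), (y + z); split; [exact: JD|ring].
  - by exists (c * a), (c * y); split; [exact: JM|ring].
have hit x : ~ J x -> exists n, add x (f ^+ n).
  move=> nx; apply: contrapT => no; apply: nx; apply: (maxJ (add x)) => //.
  - by move=> y Jy; exists 0, y; rewrite mul0r addr0.
  - by move=> n hn; apply: no; exists n.
  - by exists 1, 0; rewrite mul1r add0r.
exists J; split=> //; last by have := Jf 1%N; rewrite expr1.
split=> //; first by have := Jf 0%N; rewrite expr0.
move=> x y Jxy; have [Jx|/hit [n [a [u [Ju eu]]]]] := pselect (J x); first by left.
have [Jy|/hit [m [b [v [Jv ev]]]]] := pselect (J y); first by right.
case: (Jf (n + m)%N); rewrite exprD eu ev.
have -> : (u + a * x) * (v + b * y) = (v + b * y) * u + (a * x) * v + (a * b) * (x * y) by ring.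
exact: (JD _ _ (JD _ _ (JM _ _ Ju) (JM _ _ Jv)) (JM _ _ Jxy)).
Qed.

Lemma field_point_ex I (f : R) : (forall n, ~ ideal_gen I (f ^+ n)) ->
  exists (K : fieldType) (phi : {rmorphism R -> K}), (forall i, I i -> phi i = 0) /\ phi f != 0.
Proof.
move=> /prime_ideal_ex [P [hP IP nf]]; have [K [phi hphi]] := residue_field hP.
exists K, phi; split; first by move=> i /IP /hphi.
by apply/eqP => /hphi.
Qed.

End ResidueFields.

(** * Affine charts *)

Section FieldPoints.
Local Notation fmap := Defs.fmap.
Variable k : fieldType.
Implicit Types R S : kalg k.

Lemma kalg_hom_ex R S (f : R -> S) : zmod_morphism f -> monoid_morphism f ->
  (forall c, f (kalg_str R c) = kalg_str S c) -> exists h : kalg_hom R S, h =1 f.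
Proof.
move=> fz fm fk; pose z := GRing.isZmodMorphism.Build _ _ f fz.
pose fr : {rmorphism R -> S} := HB.pack f z (GRing.isMonoidMorphism.Build _ _ f fm).
by exists (@KAlgHom _ _ _ fr fk).
Qed.

Lemma kalg_field_point R (I : set R) (f : R) : (forall n, ~ ideal_gen I (f ^+ n)) ->
  exists (K : fieldType) (j : {rmorphism k -> K}) (phi : kalg_hom R (field_kalg j)),
    (forall i, I i -> phi i = 0) /\ phi f != 0.
Proof.
move=> /field_point_ex [K [phi [phiI phif]]].
pose j : {rmorphism k -> K} := phi \o kalg_str R.
pose p : {rmorphism R -> field_kalg j} := phi.
by exists K, j, (@KAlgHom _ _ (field_kalg j) p (fun _ => erefl)).
Qed.

(** A proper ideal lies in a prime, at whose residue field it vanishes. Through this criterion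
    openness is tested on points over fields. *)
Lemma unit_ideal_field R (I : set R) : generates_unit_ideal I <->
  forall (K : fieldType) (j : {rmorphism k -> K}) (phi : kalg_hom R (field_kalg j)),
    exists2 i, I i & phi i != 0.
Proof.
split=> [[n [a [r [hr e]]]] K j phi|h].
  apply: contrapT => no; have /eqP := congr1 phi e.
  rewrite rmorph1 rmorph_sum big1 ?(eq_sym 0) ?oner_eq0 // => i _; rewrite rmorphM.
  have [->|ri] := eqVneq (phi (r i)) 0; first by rewrite mulr0.
  by case: no; exists (r i).
apply: contrapT => no; have [n|K [j [phi [phiI _]]]] := @kalg_field_point R I 1.
  by rewrite expr1n.
by have [i /phiI -> /eqP] := h K j phi.
Qed.

Lemma unit_ideal_image R S (f : kalg_hom R S) (I : set R) :
  generates_unit_ideal I -> generates_unit_ideal (f @` I).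
Proof.
move=> [n [a [r [hr e]]]]; exists n, (f \o a), (f \o r); split.
  by move=> i; exists (r i).
by rewrite -(rmorph1 f) -e rmorph_sum; apply: eq_bigr => i _; rewrite rmorphM.
Qed.

Section Localization.
Variables (R : kalg k) (r : R).

Lemma powers1 : [set x | exists n, x = r ^+ n] 1.
Proof. by exists 0%N; rewrite expr0. Qed.
Lemma powersM x y : [set x | exists n, x = r ^+ n] x -> [set x | exists n, x = r ^+ n] y ->
  [set x | exists n, x = r ^+ n] (x * y).
Proof. by move=> [n ->] [m ->]; exists (n + m)%N; rewrite exprD. Qed.
Lemma zero_ideal : is_ideal [set 0 : R].
Proof. by split=> [|x y -> ->|a x ->] //=; rewrite ?addr0 ?mulr0. Qed.

Definition powers_data : fraction_data R := FractionData powers1 powersM zero_ideal.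

Definition localization : kalg k :=
  @KAlg k (fraction_ring powers_data) (to_fraction powers_data \o kalg_str R).

Definition localization_hom : kalg_hom R localization :=
  @KAlgHom k R localization (to_fraction powers_data : {rmorphism R -> localization}) (fun _ => erefl).

Lemma localization_unit : exists v, localization_hom r * v = 1.
Proof. by apply: to_fraction_unit; exists 1%N; rewrite expr1. Qed.

Lemma localization_den (y : localization) :
  exists a n, y * localization_hom r ^+ n = localization_hom a.
Proof.
have [a [s [hs ->]]] := mkfr_ex y; have [n e] := hs; exists a, n.
by rewrite -rmorphXn /= -e; exact: mkfr_den.
Qed.

Lemma localization_lift (K : fieldType) (j : {rmorphism k -> K})
    (phi : kalg_hom R (field_kalg j)) : phi r != 0 ->
  exists psi : kalg_hom localization (field_kalg j), forall a, psi (localization_hom a) = phi a.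
Proof.
move=> pr; pose f : {rmorphism R -> K} := phi.
have fM s : den powers_data s -> f s != 0 by move=> [n ->]; rewrite rmorphXn expf_neq0.
have fJ a : kern powers_data a -> f a = 0 by move=> ->; exact: rmorph0.
have [psi hpsi] := fraction_lift_ex fM fJ.
have psi_str c : (psi : {rmorphism localization -> field_kalg j}) (kalg_str localization c) = kalg_str (field_kalg j) c.
  by rewrite [LHS]hpsi -(kalg_homP phi).
by exists (KAlgHom psi_str) => a; exact: hpsi.
Qed.

End Localization.

Section Functor.
Variable A : group_functor k.

Lemma fmap_comp_eq R S T (f : kalg_hom R S) (g : kalg_hom S T) (h : kalg_hom R T) x :
  (forall r, g (f r) = h r) -> fmap A g (fmap A f x) = fmap A h x.
Proof. by move=> e; rewrite (@Defs.fmap_comp _ A _ _ _ f g h) // => r /=; rewrite e. Qed.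

Lemma fmap_id1 R x : fmap A (kalg_id R) x = x.
Proof. exact: fmap_id. Qed.

Lemma fmap_eq R S (f g : kalg_hom R S) x : f =1 g -> fmap A f x = fmap A g x.
Proof.
by move=> e; rewrite -(@fmap_comp_eq _ _ _ (kalg_id R) f g) ?fmap_id1.
Qed.

Lemma open_subfunctor_map (U : forall R, set (A R)) R S (f : kalg_hom R S) x :
  open_subfunctor U -> U R x -> U S (fmap A f x).
Proof.
move=> oU Ux; have [I hI] := oU R x; apply/hI; apply: unit_ideal_image.
have := (hI R (kalg_id R)).1; rewrite fmap_id1 => /(_ Ux).
by rewrite image_id.
Qed.

Record chart := Chart {
  ch_set :> forall R, set (A R);
  ch_alg : kalg k;
  ch_pt : A ch_alg;
  ch_gens : seq ch_alg;
  ch_open : open_subfunctor ch_set;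
  ch_ind : forall P : set ch_alg,
    (forall c, P (kalg_str ch_alg c)) -> (forall b, b \in ch_gens -> P b) ->
    (forall x y, P x -> P y -> P (x + y)) -> (forall x y, P x -> P y -> P (x * y)) ->
    forall x, P x;
  ch_in : ch_set ch_pt;
  ch_rep : forall S (x : A S), ch_set x -> exists f : kalg_hom ch_alg S, fmap A f ch_pt = x;
  ch_uniq : forall S (f g : kalg_hom ch_alg S), fmap A f ch_pt = fmap A g ch_pt -> f =1 g }.

Lemma chart_of (U : forall R, set (A R)) : open_subfunctor U -> affine_finite_type U ->
  exists c : chart, ch_set c = U.
Proof.
move=> oU [B [u [[n [b hb]] Uu rep]]].
have ind (P : set B) : (forall c, P (kalg_str B c)) -> (forall y, y \in codom b -> P y) ->
    (forall x y, P x -> P y -> P (x + y)) -> (forall x y, P x -> P y -> P (x * y)) ->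
    forall x, P x.
  by move=> Pc Pb PD PM; apply: hb => // i; apply: Pb; exact: codom_f.
have rep' S (x : A S) : U S x -> exists f : kalg_hom B S, fmap A f u = x.
  by move=> /rep [f [fu _]]; exists f.
have uniq S (f g : kalg_hom B S) : fmap A f u = fmap A g u -> f =1 g.
  move=> e r; have Uf : U S (fmap A f u) by exact: open_subfunctor_map.
  have [h [_ hu]] := rep _ _ Uf; by rewrite (hu f) // (hu g).
by exists (Chart oU ind Uu rep' uniq).
Qed.

Section Chart.
Variable c : chart.
Local Notation B := (ch_alg c).
Local Notation u := (ch_pt c).

Lemma chart_point S (h : kalg_hom B S) : ch_set c (fmap A h u).
Proof. exact: open_subfunctor_map (ch_open c) (ch_in c). Qed.

Lemma chart_hom_ext S (f g : kalg_hom B S) : (forall b, b \in ch_gens c -> f b = g b) -> f =1 g.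
Proof.
move=> e; apply: (ch_ind (P := [set b | f b = g b])) => //=.
- by move=> a; rewrite !kalg_homP.
- by move=> x y hx hy; rewrite !rmorphD /= hx hy.
- by move=> x y hx hy; rewrite !rmorphM /= hx hy.
Qed.

(** The principal open subset [f != 0] of the chart, as a subfunctor of all of [A]. A point lies in
    an open subset as soon as all its restrictions to fields do, whence this form. *)
Definition nonvanishing (f : B) : forall R, set (A R) := fun R => [set x |
  forall (K : fieldType) (j : {rmorphism k -> K}) (phi : kalg_hom R (field_kalg j)),
    exists h : kalg_hom B (field_kalg j), fmap A h u = fmap A phi x /\ h f != 0].

Lemma nonvanishing_field f (K : fieldType) (j : {rmorphism k -> K}) (h : kalg_hom B (field_kalg j)) :
  h f != 0 -> nonvanishing f (fmap A h u).
Proof.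
move=> hf L i phi; exists (kalg_comp h phi); split; last by rewrite /= (fmorph_eq0 (phi : {rmorphism K -> L})).
by rewrite (fmap_comp_eq (h := kalg_comp h phi)).
Qed.

Lemma field_nonvanishing f (K : fieldType) (j : {rmorphism k -> K}) (x : A (field_kalg j)) :
  nonvanishing f x -> exists h : kalg_hom B (field_kalg j), fmap A h u = x /\ h f != 0.
Proof. by move=> /(_ K j (kalg_id _)); rewrite fmap_id1. Qed.

(** On [R_r], [r] in the ideal defining the chart, the point [x] is a map
    [h_r : B -> R_r], and [h_r f = a / r ^ n]; the functions [r a] define the subset. *)
Lemma nonvanishing_open f : open_subfunctor (nonvanishing f).
Proof.
move=> R x; have [J hJ] := ch_open c x.
have loc r : J r -> exists h : kalg_hom B (localization r), fmap A h u = fmap A (localization_hom r) x.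
  move=> Jr; apply/ch_rep/hJ; have [v hv] := localization_unit r.
  exists 1%N, (fun=> v), (fun=> localization_hom r r); split; first by move=> _; exists r.
  by rewrite big_ord1 mulrC.
pose I : set R := [set b | exists r (h : kalg_hom B (localization r)) a n,
  [/\ J r, fmap A h u = fmap A (localization_hom r) x,
      h f * localization_hom r r ^+ n = localization_hom r a & b = r * a]].
have key (K : fieldType) (j : {rmorphism k -> K}) (phi : kalg_hom R (field_kalg j)) :
    (exists h : kalg_hom B (field_kalg j), fmap A h u = fmap A phi x /\ h f != 0) <->
    exists2 i, I i & phi i != 0.
  split=> [[h [hu hf]]|[_ [r [h [a [n [Jr hu ha ->]]]]]]].
    have : ch_set c (fmap A phi x) by rewrite -hu; exact: chart_point.
    move=> /hJ /unit_ideal_field /(_ K j (kalg_id _)) [_ [r Jr <-] /= pr].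
    have [h' hu'] := loc r Jr; have [a [n ha]] := localization_den (h' f).
    have [psi hpsi] := localization_lift pr.
    have e : kalg_comp h' psi =1 h.
      apply: ch_uniq; rewrite hu -(fmap_comp_eq (f := h') (g := psi)) // hu'.
      exact: fmap_comp_eq.
    exists (r * a); first by exists r, h', a, n.
    rewrite rmorphM (mulf_neq0 (pr : phi r != 0 :> K)) // -hpsi -ha rmorphM rmorphXn /= hpsi.
    by rewrite mulf_neq0 ?expf_neq0 // -[psi _]/(kalg_comp h' psi f) e.
  rewrite rmorphM mulf_eq0 negb_or => /andP [pr pa].
  have [psi hpsi] := localization_lift pr; exists (kalg_comp h psi); split.
    rewrite -(fmap_comp_eq (f := h) (g := psi)) // hu; exact: fmap_comp_eq.
  apply: contra_neq pa => /= e; rewrite -hpsi -ha rmorphM /= e; exact: mul0r.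
exists I => S g; rewrite unit_ideal_field; split=> h K j phi.
  have [h' [hu hf]] := h K j phi.
  have /key [i Ii pi0] : exists h : kalg_hom B (field_kalg j), fmap A h u = fmap A (kalg_comp g phi) x /\ h f != 0.
    by exists h'; split=> //; rewrite hu; exact: fmap_comp_eq.
  by exists (g i) => //; exists i.
have [_ [i Ii <-] pi0] := h K j phi.
have /key [h' [hu hf]] : exists2 i, I i & kalg_comp g phi i != 0 by exists i.
by exists h'; split=> //; rewrite hu; apply/esym; exact: fmap_comp_eq.
Qed.

Definition nilpotent (b : B) : Prop := exists n, b ^+ n = 0.

Lemma nonvanishing_nonempty f : ~ nilpotent f -> nonempty_subfunctor (nonvanishing f).
Proof.
move=> nf; have [n|K [j [phi [_ pf]]]] := @kalg_field_point B [set 0] f.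
  move=> [m [a [r [hr e]]]]; apply: nf; exists n; rewrite -e big1 // => i _.
  by rewrite (hr i) mulr0.
by exists K, j, (fmap A phi u); exact: nonvanishing_field.
Qed.

Hypothesis irrA : irreducible_space A.

(** If neither factor is nilpotent, irreducibility makes their principal open subsets meet, and
    [f * g] does not vanish at a common point. So the ring of a chart is a domain modulo
    nilpotents. *)
Lemma nilpotent_prime f g : nilpotent (f * g) -> nilpotent f \/ nilpotent g.
Proof.
move=> [n fg]; apply: contrapT => /not_orP [nf ng].
have [K [j [x [/field_nonvanishing [h [hx hf]] /field_nonvanishing [h' [hx' hg]]]]]] :=
  irrA (nonvanishing_open f) (nonvanishing_open g) (nonvanishing_nonempty nf) (nonvanishing_nonempty ng).
have e : h =1 h' by apply: ch_uniq; rewrite hx hx'.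
have : h ((f * g) ^+ n) != 0.
  by rewrite rmorphXn rmorphM; apply: (expf_neq0 n); apply: (mulf_neq0 hf); rewrite e.
by rewrite fg rmorph0 eqxx.
Qed.

End Chart.
End Functor.
End FieldPoints.

(** * Embeddings and specializations *)

Section Embeddings.
Variables (k F : closedFieldType) (iota : {rmorphism k -> F}).
Local Notation acl := (acl iota).
Local Notation adjoin := (adjoin iota).
Local Notation inter := (intermediate_field iota).
Local Notation base_pairs := (base_pairs iota).
Local Notation indep := (indep iota).
Hypothesis trdegF : countably_infinite_trdeg iota.

Lemma acl_set0 x : acl set0 x -> exists c, iota c = x.
Proof.
have hK : inter (range iota).
  split=> [c|_ _ [a _ <-] [b _ <-]|_ _ [a _ <-] [b _ <-]|_ [a _ <-]].
  - by exists c.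
  - by exists (a - b); rewrite ?rmorphB.
  - by exists (a * b); rewrite ?rmorphM.
  - by exists a^-1; rewrite ?fmorphV.
move=> [p [p0 hp px]]; apply: root_image p0 _ px => i.
by have [c _ <-] := adjoin_min hK (@sub0set _ _) (hp i); exists c.
Qed.

Lemma new_transcendental (s : seq F) : exists b, ~ acl (sset s) b.
Proof.
by have [[|b []] //= _ [nb _]] := independent_seq trdegF s 1; exists b.
Qed.

Section Finite.
Variables (E : fieldType) (j : {rmorphism k -> E}).

(** The generators are mapped one at a time: an algebraic one to a root of its transported minimal
    polynomial, a transcendental one to an element independent of the previous images, available
    since [F] has infinite transcendence degree. *)
Lemma finite_embedding (s : seq E) : exists t : seq F, size t = size s /\
  good ([set z : E * F | exists c, z = (j c, iota c)] `|` sset (zip s t)).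
Proof.
set base : set (E * F)%type := [set z | exists c, z = (j c, iota c)].
elim: s => [|a s [t [st gt]]].
  exists [::]; split=> // z hz.
  have [c ->] : exists c, z = (j c, iota c).
    apply: (hz base); split; last by move=> x [|//].
    split=> [|_ _ [c ->] [d ->]|_ _ [c ->] [d ->]].
    - by exists 1; rewrite !rmorph1.
    - by exists (c - d); rewrite !rmorphB.
    - by exists (c * d); rewrite !rmorphM.
  split=> /= [/eqP|h]; first by rewrite fmorph_eq0 => /eqP ->; rewrite rmorph0.
  by exists (iota c)^-1; rewrite mulfV // fmorph_eq0; move: h; rewrite fmorph_eq0.
set A := base `|` _ in gt; pose G := field_gen A.
have hG : partial_iso G by exact: field_gen_partial_iso.
have AG : A `<=` G by exact: sub_field_gen.
have hA := adjoin_inter iota (sset t).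
have GQ : G `<=` [set z | adjoin (sset t) z.2].
  apply: field_gen_sub gt _.
  - split; first exact: (subring1 hA).
      by move=> x y hx hy; exact: (subringB hA).
    by move=> x y hx hy; exact: (subringM hA).
  - move=> z w hz zw /=; have e2 := congr1 snd zw.
    have n2 : z.2 != 0 by apply/eqP => z0; move/eqP: e2; rewrite /= z0 mul0r eq_sym oner_eq0.
    have -> : w.2 = z.2^-1 by apply: (mulfI n2); rewrite mulfV.
    exact: (interV hA).
  - move=> x [[c ->]|xz]; first exact: (inter_base hA).
    apply: sub_adjoin; rewrite /= -(unzip2_zip (s := s) (t := t)) ?st //.
    by apply/mapP; exists x.
have finish b : good (G `|` [set (a, b)]) ->
    exists t, size t = size (a :: s) /\ good (base `|` sset (zip (a :: s) t)).
  move=> gb; exists (b :: t); split; first by rewrite /= st.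
  apply: goodS gb => x [bx|]; first by left; apply: AG; left.
  by rewrite [zip _ _]/= sset_cons => -[->|xz]; [right|left; apply: AG; right].
have [alg|nalg] := pselect (exists p, [/\ p != 0, coefs_in G p & (map_poly fst p).[a] = 0]).
  have [f hf] := min_poly_ex hG alg; have [b fb] := min_poly_root hf.
  by apply: (finish b); exact: (good_min_poly hG hf).
have [b nb] := new_transcendental t.
apply: (finish b); apply: good_adjoin => // p hp; rewrite fst_horner snd_horner /=.
have [->|p0] := eqVneq p 0; first by rewrite !rmorph0 !horner0 eqxx; split.
split=> [pa|_]; first by case: nalg; exists p.
exists (map_poly snd p).[b]^-1; rewrite mulfV //; apply/eqP => pb; apply: nb.
exists (map_poly snd p); split; last exact/rootP.
  apply: contra_neq p0 => p20; apply/polyP => i; rewrite coef0.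
  have := congr1 (fun q : {poly F} => q`_i) p20.
  rewrite coef_snd coef0 /= => pi0.
  case: (hG) => sG G0 GV; apply: (G0 _ (hp i)); apply: contrapT => /eqP /(GV _ (hp i)) [w _].
  by move=> /(congr1 snd) /= /eqP; rewrite pi0 mul0r eq_sym oner_eq0.
by move=> i; rewrite coef_snd; exact: (GQ _ (hp i)).
Qed.

End Finite.

(** Denominators are cleared because a specialization is defined on a ring only; the nonzero
    constant term will control when a specialized value vanishes. *)
Lemma ring_gen_relation (S : set (F * F)%type) x : good (base_pairs `|` S) -> acl (fst @` S) x ->
  exists q : {poly F * F}, [/\ coefs_in (ring_gen (base_pairs `|` S)) q, q != 0,
    (map_poly fst q).[x] = 0 & x != 0 -> (q`_0).1 != 0].
Proof.
move=> gS ax; set R0 := ring_gen _; have sR : subring R0 by exact: ring_gen_subring.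
have hA := adjoin_inter iota (fst @` S).
have [p [p0 hp px p00]] : exists p : {poly F}, [/\ p != 0, coefs_in (adjoin (fst @` S)) p, root p x &
    x != 0 -> p`_0 != 0].
  (* An equation of least degree is not divisible by ['X] unless [x = 0]. *)
  pose P n := `[< exists p : {poly F}, [/\ p != 0, coefs_in (adjoin (fst @` S)) p, root p x & size p = n] >].
  have exP : exists n, P n by case: ax => p [p0 hp px]; exists (size p); apply/asboolP; exists p.
  case: (ex_minnP exP) => n /asboolP [p [p0 hp px sp]] minn; exists p; split=> // x0.
  apply/eqP => p00; have rp0 : root p 0 by rewrite /root horner_coef0 p00.
  have [q hq e] := coefs_in_factor hA hp (subring0 hA) rp0.
  have q0 : q != 0 by apply: contra_neq p0 => q0; rewrite e q0 mul0r.
  have : (n <= size q)%N.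
    apply: minn; apply/asboolP; exists q; split=> //.
    by move: px; rewrite e rootM root_XsubC (negPf x0) orbF.
  by rewrite -sp e size_Mmonic ?monicXsubC // size_XsubC addn2 ltnn.
pose G := field_gen (base_pairs `|` S); have hG : partial_iso G by exact: field_gen_partial_iso.
have SG : base_pairs `|` S `<=` G by exact: sub_field_gen.
have fr i : exists uv : (F * F) * (F * F),
    [/\ R0 uv.1, R0 uv.2, uv.2.1 != 0 & p`_i * uv.2.1 = uv.1.1].
  have [z [u [v [gu gv v0 e]]] <-] : (fst @` G) p`_i.
    apply: adjoin_min (hp i); first by apply: (partial_iso_fst hG) => z bz; apply: SG; left.
    by move=> _ [z Sz <-]; exists z => //; apply: SG; right.
  by exists (u, v); split=> //=; rewrite -e.
have [uv huv] := choice fr.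
pose D := \prod_(l < size p) (uv l).2.
have prodR (P : pred 'I_(size p)) : R0 (\prod_(l < size p | P l) (uv l).2).
  elim/big_ind: _ => [|y z hy hz|l _]; [exact: (subring1 sR)|exact: (subringM sR)|by case: (huv l)].
have fst_prod (P : pred 'I_(size p)) : (\prod_(l < size p | P l) (uv l).2).1 = \prod_(l < size p | P l) (uv l).2.1.
  exact: (rmorph_prod (fst : {rmorphism (F * F)%type -> F})).
have D0 : D.1 != 0 by rewrite fst_prod; apply/prodf_neq0 => l _; case: (huv l).
pose q := \poly_(i < size p) ((uv i).1 * \prod_(l < size p | (l : nat) != i) (uv l).2).
have q1 i : (q`_i).1 = p`_i * D.1.
  rewrite coef_poly; case: ltnP => [lt_i|le_i]; last by rewrite [p`__]nth_default // mul0r.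
  have -> : D.1 = (uv i).2.1 * \prod_(l < size p | (l : nat) != i) (uv l).2.1.
    by rewrite fst_prod (bigD1 (Ordinal lt_i)).
  by rewrite [LHS]/= fst_prod mulrA; congr (_ * _); case: (huv i).
exists q; split.
- move=> i; rewrite coef_poly; case: ifP => _; last exact: (subring0 sR).
  by apply: (subringM sR) => //; case: (huv i).
- apply: contra_neq p0 => q0; apply/polyP => i; apply: (mulIf D0).
  by rewrite -q1 q0 !coef0 mul0r.
- have -> : map_poly fst q = D.1 *: p.
    apply/polyP => i; rewrite coef_fst coefZ /=.
    by rewrite q1 mulrC.
  by rewrite hornerZ (rootP px) mulr0.
by move=> /p00 h; rewrite q1 mulf_neq0.
Qed.

(** A specialization [c -> a] between subrings of [F], that is a ring of pairs in which
    [c = 0] forces [a = 0], is injective when it does not lower the transcendence degree. *)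
Section Specialization.
Variable R : set (F * F)%type.
Hypotheses (sR : subring R) (bR : base_pairs `<=` R).
Hypothesis spec : forall z, R z -> z.1 = 0 -> z.2 = 0.

(** The value of the relation at [x] lies in [R] with first component 0, so its second component is
    0 too: an equation for [x.2], nontrivial because [S] is good. If [x.2 = 0], its constant term
    vanishes, which forces [x.1 = 0]. *)
Lemma specialization_relation S x : S `<=` R -> good (base_pairs `|` S) -> R x ->
  acl (fst @` S) x.1 -> acl (snd @` S) x.2 /\ (x.2 = 0 -> x.1 = 0).
Proof.
move=> SR gS Rx ax; have [q [hq q0 qx q00]] := ring_gen_relation gS ax.
have genR : ring_gen (base_pairs `|` S) `<=` R by apply: ring_gen_min => // z [/bR|/SR].
have qxR : R q.[x] by apply: (subring_horner sR) => // i; exact/genR.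
have q2 : (map_poly snd q).[x.2] = 0.
  by rewrite -snd_horner; apply: spec => //; rewrite fst_horner.
have snd0 i : (q`_i).2 = 0 -> q`_i = 0.
  have [h1 h2] := gS _ (hq i); move=> e2.
  have e1 : (q`_i).1 = 0.
    apply: contrapT => /eqP /h2 [w /eqP]; by rewrite e2 mul0r eq_sym oner_eq0.
  by rewrite [q`_i]surjective_pairing e1 e2.
have hA := adjoin_inter iota (snd @` S).
split.
  exists (map_poly snd q); split; last exact/rootP.
    apply: contra_neq q0 => h; apply/polyP => i; rewrite coef0; apply: snd0.
    have := congr1 (fun p : {poly F} => p`_i) h.
    by rewrite coef_snd coef0.
  move=> i; rewrite coef_snd /=.
  apply: (hq i [set z | adjoin (snd @` S) z.2]); split.
    split; first exact: (subring1 hA).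
      by move=> y z hy hz; exact: (subringB hA).
    by move=> y z hy hz; exact: (subringM hA).
  move=> z [[c ->]|Sz]; first exact: (inter_base hA).
  by apply: sub_adjoin; exists z.
move=> x20; apply: contrapT => /eqP /q00 /eqP; apply.
have := q2; rewrite x20 horner_coef0 coef_snd /=.
by move=> /snd0 ->.
Qed.

Lemma specialization_indep (ps : seq (F * F)) : forall S, S `<=` R -> good (base_pairs `|` S) ->
  sset ps `<=` R -> indep (snd @` S) (map snd ps) ->
  good (base_pairs `|` (S `|` sset ps)) /\ indep (fst @` S) (map fst ps).
Proof.
elim: ps => [|[c a] ps IH] S SR gS psR /=.
  by move=> _; split=> //; apply: goodS gS => x [|[|//]]; [left|right].
move=> [na ips].
have Rca : R (c, a) by apply: psR; rewrite /= inE eqxx.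
have nc : ~ acl (fst @` S) c by move=> h; have [] := specialization_relation SR gS Rca h.
have [|||g i] := IH _ _ (good_transcendental gS nc na).
- by move=> x [/SR|->].
- by move=> x xs; apply: psR; rewrite /= inE xs orbT.
- by rewrite image_setU image_set1.
split; first by rewrite sset_cons (setUA S).
by split=> //; move: i; rewrite image_setU image_set1.
Qed.

(** Independent images come from independent elements, here numerous enough to span the source;
    [specialization_relation] over them then covers all of [R]. *)
Lemma specialization_rank (ps : seq (F * F)) (t0 : seq F) : sset ps `<=` R ->
  indep set0 (map snd ps) -> fst @` R `<=` acl (sset t0) -> (size t0 <= size ps)%N ->
  (forall z, R z -> z.2 = 0 -> z.1 = 0) /\ snd @` R `<=` acl (sset (map snd ps)).
Proof.
move=> psR ips Rt0 st0.
have g0 : good (base_pairs `|` set0).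
  by apply: (@good_graph F idfun) => z [[c ->]|].
have [||g i] := specialization_indep (ps := ps) (S := set0) _ g0 psR.
- by [].
- by rewrite image_set0.
rewrite image_set0 in i; rewrite set0U in g.
have span : sset t0 `<=` acl (sset (map fst ps)).
  have := @indep_span _ _ iota set0 (map fst ps) t0 i; rewrite !set0U size_map; apply=> //.
  by move=> _ /= /mapP [z zps ->]; apply: Rt0; exists z => //; exact: psR.
have fE : fst @` sset ps = sset (map fst ps) := image_sset _ _.
have sE : snd @` sset ps = sset (map snd ps) := image_sset _ _.
have key z : R z -> acl (sset (map snd ps)) z.2 /\ (z.2 = 0 -> z.1 = 0).
  move=> Rz; rewrite -sE; apply: specialization_relation => //; rewrite fE.
  by apply: acl_min span _ _; apply: Rt0; exists z.
split; first by move=> z /key [].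
by move=> _ [z /key [h _] <-].
Qed.

End Specialization.
End Embeddings.

(** * Generic points *)

Section GenericPoints.
Local Notation fmap := Defs.fmap.
Variables (k F : closedFieldType) (iota : {rmorphism k -> F}).
Local Notation acl := (acl iota).
Local Notation adjoin := (adjoin iota).
Local Notation inter := (intermediate_field iota).
Local Notation base_pairs := (base_pairs iota).
Local Notation indep := (indep iota).
Local Notation G := (faut iota).
Local Notation FF := (field_kalg iota).
Hypothesis char0 : [pchar k] =i pred0.
Hypothesis trdegF : countably_infinite_trdeg iota.
Variable A : algebraic_group k.
Local Notation X := (ext_points iota A).
Implicit Types (s t l : seq F).

Lemma chart_ex (K : fieldType) (j : {rmorphism k -> K}) (x : A (field_kalg j)) :
  exists (c : chart A) (h : kalg_hom (ch_alg c) (field_kalg j)), fmap A h (ch_pt c) = x.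
Proof.
have [_ [m [U [hU cov]]]] := alg_scheme A; have [i Ui] := cov K j x.
have [oU /(chart_of oU) [c e]] := hU i.
by exists c; apply: (@ch_rep _ _ c); rewrite e.
Qed.

Definition coordinates_of z s : Prop := exists (c : chart A) (h : kalg_hom (ch_alg c) FF),
  fmap A h (ch_pt c) = z /\ s = [seq (h b : F) | b <- ch_gens c].

Lemma coordinates_ex z : exists s, coordinates_of z s.
Proof. by have [c [h hz]] := chart_ex z; exists [seq (h b : F) | b <- ch_gens c], c, h. Qed.

Lemma point_act_fmap (g : G) (B : kalg k) (h : kalg_hom B FF) (u : A B) :
  point_act A g (fmap A h u) = fmap A (kalg_comp h (faut_hom g)) u.
Proof. exact: fmap_comp_eq. Qed.

Lemma coordinates_fixed z s (g : G) : coordinates_of z s ->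
  fixes g s <-> point_act A g z = z.
Proof.
move=> [c [h [<- ->]]]; split=> [hg|e].
  rewrite point_act_fmap; apply: fmap_eq; apply: chart_hom_ext => b bc.
  by apply: hg; apply/mapP; exists b.
by move=> _ /mapP [b bc ->]; apply: (ch_uniq (f := kalg_comp h (faut_hom g))); rewrite -point_act_fmap.
Qed.

(** The stabilizer of a point determines its coordinates up to algebraic closure. Hence this closure
    does not depend on the chart, and coordinates of sums can be bounded. *)
Lemma coordinates_acl z s t : coordinates_of z s ->
  (forall g : G, fixes g t -> point_act A g z = z) -> sset s `<=` acl (sset t).
Proof.
move=> zs zt x xs; apply: contrapT => nx.
have [g [gt gx]] := moved_by_automorphism trdegF s nx; apply: gx.
by rewrite ((coordinates_fixed g zs).2 (zt _ gt) x xs); exact: sub_acl.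
Qed.

Lemma coordinates_act z s (g : G) : coordinates_of z s -> coordinates_of (point_act A g z) (map g s).
Proof.
move=> [c [h [<- ->]]]; exists c, (kalg_comp h (faut_hom g)).
by rewrite point_act_fmap -map_comp.
Qed.

Definition coords z : seq F := projT1 (cid (coordinates_ex z)).
Lemma coordsP z : coordinates_of z (coords z).
Proof. exact: projT2 (cid (coordinates_ex z)). Qed.

Lemma coords_fixed (g : G) z : fixes g (coords z) <-> point_act A g z = z.
Proof. exact: coordinates_fixed (coordsP z). Qed.

Lemma coords_acl z t : (forall g : G, fixes g t -> point_act A g z = z) ->
  sset (coords z) `<=` acl (sset t).
Proof. exact: coordinates_acl (coordsP z). Qed.

Lemma coordinates_coords z s : coordinates_of z s ->
  sset s `<=` acl (sset (coords z)) /\ sset (coords z) `<=` acl (sset s).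
Proof.
move=> zs; split.
  by apply: coordinates_acl zs _ => g /coords_fixed.
by apply: coords_acl => g /(coordinates_fixed g zs).
Qed.

Lemma coordsB x y : sset (coords (x - y)) `<=` acl (sset (coords x ++ coords y)).
Proof.
apply: coords_acl => g hg; rewrite raddfB /=; congr (_ - _); apply/coords_fixed => z zs; apply: hg.
  by rewrite mem_cat zs.
by rewrite mem_cat zs orbT.
Qed.

Lemma coordsD x y : sset (coords (x + y)) `<=` acl (sset (coords x ++ coords y)).
Proof.
apply: coords_acl => g hg; rewrite raddfD /=; congr (_ + _); apply/coords_fixed => z zs; apply: hg.
  by rewrite mem_cat zs.
by rewrite mem_cat zs orbT.
Qed.

Lemma chart_range (c : chart A) (h : kalg_hom (ch_alg c) FF) b :
  adjoin (sset [seq (h b : F) | b <- ch_gens c]) (h b : F).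
Proof.
have hA := adjoin_inter iota (sset [seq (h b : F) | b <- ch_gens c]).
apply: (ch_ind (P := [set b | adjoin (sset [seq (h b : F) | b <- ch_gens c]) (h b : F)])).
- by move=> a; rewrite /= kalg_homP; exact: (inter_base hA).
- by move=> a ac; apply: sub_adjoin; apply/mapP; exists a.
- by move=> a a' h1 h2; rewrite /= rmorphD; exact: (subringD hA).
- by move=> a a' h1 h2; rewrite /= rmorphM; exact: (subringM hA).
Qed.

Lemma chart_range_acl (c : chart A) (h : kalg_hom (ch_alg c) FF) b s :
  sset (coords (fmap A h (ch_pt c))) `<=` acl (sset s) -> acl (sset s) (h b : F).
Proof.
move=> sub; have hA := acl_inter iota (sset s); move: (chart_range (h := h) b); apply: (adjoin_min hA).
have zs : coordinates_of (fmap A h (ch_pt c)) [seq (h b : F) | b <- ch_gens c] by exists c, h.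
move=> x xs; apply: acl_min sub _ _; exact: (coordinates_coords zs).1.
Qed.

Lemma coords_base c : sset (coords (base_change iota A c)) `<=` acl set0.
Proof.
by rewrite -sset_nil; apply: coords_acl => g _; exact: point_act_base.
Qed.

Lemma base_of_coords z : sset (coords z) `<=` acl set0 -> exists a, base_change iota A a = z.
Proof.
have [c [h hz]] := chart_ex z; rewrite -{1}hz -sset_nil => sub.
have hex b : exists a, iota a = h b.
  by apply: acl_set0; rewrite -sset_nil; exact: (chart_range_acl (h := h)).
have [f hf] := choice hex.
have [||b|h' hE] := @kalg_hom_ex _ _ (field_kalg [the {rmorphism k -> k} of idfun]) f.
- by move=> a b; apply: (fmorph_inj iota); rewrite rmorphB /= !hf rmorphB.
- split=> [|a b]; apply: (fmorph_inj iota); first by rewrite hf !rmorph1.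
  by rewrite rmorphM /= !hf rmorphM.
- by apply: (fmorph_inj iota); rewrite hf kalg_homP.
exists (fmap A h' (ch_pt c)); rewrite -hz; apply: fmap_comp_eq => b; rewrite hE; exact: hf.
Qed.

Hypothesis irrA : irreducible_space A.

(** Modulo nilpotents [h] is injective: the point is generic over [k]. *)
Definition dominant (c : chart A) (h : kalg_hom (ch_alg c) FF) : Prop :=
  forall b, h b = 0 -> nilpotent b.

Lemma nilpotent_eq0 (c : chart A) (K : fieldType) (j : {rmorphism k -> K})
  (h : kalg_hom (ch_alg c) (field_kalg j)) b : nilpotent b -> h b = 0.
Proof.
move=> [n bn]; apply: contrapT => /eqP hb; have := expf_neq0 n (hb : h b != 0 :> K).
by rewrite -(rmorphXn h) bn rmorph0 eqxx.
Qed.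

Lemma nilpotent_prime_ideal (c : chart A) (h : kalg_hom (ch_alg c) FF) :
  prime_ideal [set b : ch_alg c | nilpotent b].
Proof.
split; last by move=> a b; exact: nilpotent_prime.
  split=> [|a b [n an] [m bm]|a b [n bn]].
  - by exists 1%N; rewrite expr1.
  - exists (n + m)%N; rewrite exprDn big1 // => i _.
    have [le_mi|lt_im] := leqP m i; first by rewrite -(subnK le_mi) exprD bm mulr0 mulr0 mul0rn.
    by rewrite -addnBA 1?ltnW // exprD an mul0r mul0r mul0rn.
  - by exists n; rewrite exprMn bn mulr0.
by move=> [n]; rewrite expr1n => /(congr1 h); rewrite rmorph0 rmorph1 => /eqP; rewrite oner_eq0.
Qed.

(** The residue field at the nilradical of a chart is generated over [k] by the images of finitely
    many functions, so these can be realized in [F]. *)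
Lemma dominant_ex : exists (c : chart A) (h : kalg_hom (ch_alg c) FF), dominant h.
Proof.
have [c [h1 _]] := chart_ex (0 : X); exists c.
have [K [f hf]] := residue_field (nilpotent_prime_ideal h1).
pose j : {rmorphism k -> K} := f \o kalg_str (ch_alg c).
have [t [st gt]] := finite_embedding trdegF j (map f (ch_gens c)).
set S := _ `|` _ in gt; have sS : subring (ring_gen S) by exact: ring_gen_subring.
have hex b : exists y, ring_gen S (f b, y).
  apply: (ch_ind (P := [set b | exists y, ring_gen S (f b, y)])).
  - by move=> a; exists (iota a); apply: sub_ring_gen; left; exists a.
  - move=> a ac; have := map_f f ac; rewrite -(unzip1_zip (s := map f (ch_gens c)) (t := t)) ?st //.
    by move=> /mapP [[z y] zt /= ->]; exists y; apply: sub_ring_gen; right.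
  - move=> a a' [y hy] [y' hy']; exists (y + y'); rewrite rmorphD; exact: (subringD sS hy hy').
  - move=> a a' [y hy] [y' hy']; exists (y * y'); rewrite rmorphM; exact: (subringM sS hy hy').
have [h hh] := choice hex.
have uniq (z y y' : _) : ring_gen S (z, y) -> ring_gen S (z, y') -> y = y'.
  move=> hy hy'; have [+ _] := gt _ (subringB sS hy hy').
  by rewrite /= subrr => /(_ erefl) /eqP; rewrite subr_eq0 => /eqP.
have [|||h' hE] := @kalg_hom_ex _ _ FF h.
- by move=> a b; apply: (uniq (f (a - b))) => //; rewrite rmorphB; exact: (subringB sS (hh a) (hh b)).
- split=> [|a b]; first by apply: (uniq (f 1)) => //; rewrite rmorph1; exact: (subring1 sS).
  by apply: (uniq (f (a * b))) => //; rewrite rmorphM; exact: (subringM sS (hh a) (hh b)).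
- move=> a; apply: (uniq (j a)); first exact: (hh (kalg_str (ch_alg c) a)).
  by apply: sub_ring_gen; left; exists a.
exists h' => b; rewrite hE => hb; apply/hf; apply: contrapT => /eqP fb.
have [_ /(_ fb) [w /eqP]] := gt _ (hh b).
by move: hb => /= ->; rewrite mul0r eq_sym oner_eq0.
Qed.

Lemma chart_nonempty (c : chart A) (K : fieldType) (j : {rmorphism k -> K})
  (h : kalg_hom (ch_alg c) (field_kalg j)) : nonempty_subfunctor c.
Proof. by exists K, j, (fmap A h (ch_pt c)); exact: chart_point. Qed.

(** If [h] killed the ideal that defines the open subset inside its chart, this ideal would consist
    of nilpotents and the subset would miss the chart, against irreducibility. *)
Lemma dominant_nonvanishing (c : chart A) (h : kalg_hom (ch_alg c) FF) (c' : chart A) (f : ch_alg c') :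
  dominant h -> ~ nilpotent f -> nonvanishing f (fmap A h (ch_pt c)).
Proof.
move=> dh nf; have [I hI] := nonvanishing_open f (ch_pt c); apply/hI/unit_ideal_field.
have [i Ii hi] : exists2 i, I i & h i != 0.
  apply: contrapT => no.
  have [K [j [z [fz /ch_rep [p hp]]]]] :=
    irrA (nonvanishing_open f) (ch_open c) (nonvanishing_nonempty nf) (chart_nonempty h).
  move: fz; rewrite -hp => /hI /unit_ideal_field /(_ K j (kalg_id _)) [_ [i Ii <-] /=] /eqP; apply.
  apply: nilpotent_eq0; apply: dh; apply: contrapT => /eqP hi; by apply: no; exists i.
move=> K j phi; exists (h i); first by exists i.
by rewrite (fmorph_eq0 (phi : {rmorphism F -> K})).
Qed.

Lemma dominant_spread (c : chart A) (h : kalg_hom (ch_alg c) FF) (c' : chart A)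
  (h' : kalg_hom (ch_alg c') FF) : dominant h ->
  exists h2 : kalg_hom (ch_alg c') FF,
    fmap A h2 (ch_pt c') = fmap A h (ch_pt c) /\ dominant h2.
Proof.
move=> dh.
have n1 : ~ nilpotent (1 : ch_alg c') by have [_] := nilpotent_prime_ideal h'.
have [h2 [e _]] := field_nonvanishing (dominant_nonvanishing dh n1).
exists h2; split=> // f; apply: contraPP => nf.
have [h3 [e' h3f]] := field_nonvanishing (dominant_nonvanishing dh nf).
have h23 : h2 =1 h3 by apply: ch_uniq; rewrite e e'.
by rewrite h23; apply/eqP.
Qed.

(** * Dimension, and points generic over a finite set *)

Section Dimension.
Variables (c0 : chart A) (h0 : kalg_hom (ch_alg c0) FF).
Hypothesis dom0 : dominant h0.
Variable t0 : seq F.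
Local Notation y0 := (fmap A h0 (ch_pt c0)).
Hypotheses (t0i : indep set0 t0) (t0y : sset t0 `<=` acl (sset (coords y0))).
Hypothesis yt0 : sset (coords y0) `<=` acl (sset t0).
Let d := size t0.

(** [d] is the dimension of [A], computed at one generic point. A count of independent elements does
    not depend on charts and depends on [l] and [y] only up to algebraic closure. *)
Definition generic l (y : X) : Prop := exists t,
  [/\ size t = d, indep (sset l) t & sset t `<=` acl (sset (coords y))].

Lemma genericS l l' y : sset l' `<=` acl (sset l) -> generic l y -> generic l' y.
Proof. by move=> sub [t [st it ty]]; exists t; split=> //; exact: indepS it. Qed.

Lemma generic_acl l y y' : generic l y -> sset (coords y) `<=` acl (sset (coords y')) -> generic l y'.
Proof. by move=> [t [st it ty]] sub; exists t; split=> // x xt; apply: acl_min sub _ _; exact: ty. Qed.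

Lemma graph_subring (c : chart A) (h h' : kalg_hom (ch_alg c) FF) :
  subring [set z : F * F | exists b, z = (h b : F, h' b : F)].
Proof.
split=> [|_ _ [a ->] [b ->]|_ _ [a ->] [b ->]].
- by exists 1; rewrite !rmorph1.
- by exists (a - b); rewrite !rmorphB.
- by exists (a * b); rewrite !rmorphM.
Qed.

Lemma graph_base (c : chart A) (h h' : kalg_hom (ch_alg c) FF) :
  base_pairs `<=` [set z : F * F | exists b, z = (h b : F, h' b : F)].
Proof. by move=> _ [a ->]; exists (kalg_str (ch_alg c) a); rewrite !kalg_homP. Qed.

(** The pairs [(hc b, h b)] specialize a dominant point of the same chart to [h]. The rank [d] is
    not lowered, so [specialization_rank] makes the specialization injective. *)
Lemma generic_dominant l t (c : chart A) (h : kalg_hom (ch_alg c) FF) :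
  size t = d -> indep (sset l) t -> sset t `<=` acl (sset (coords (fmap A h (ch_pt c)))) ->
  dominant h /\ forall b, acl (sset t) (h b : F).
Proof.
move=> st it ty; have [hc [ec dc]] := dominant_spread h dom0.
set s := [seq (h b : F) | b <- ch_gens c].
have hs : coordinates_of (fmap A h (ch_pt c)) s by exists c, h.
have [_ sub] := coordinates_coords hs.
have [t' [t's t'i st']] := indep_subseq_ex iota set0 s; rewrite set0U in st'.
have [m _ et'] := subseqP t's.
have it0 : indep set0 t by apply: indepS it => x [].
have le_d : (d <= size t')%N.
  rewrite -st; apply: (steinitz it0); rewrite set0U => x /ty xs.
  by apply: acl_min st' _ _; exact: acl_min sub _ xs.
pose bs := take d (mask m (ch_gens c)).
pose ps := [seq (hc b : F, h b : F) | b <- bs].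
have eps : map snd ps = take d t' by rewrite -map_comp map_take et' map_mask.
have sps : size ps = d.
  rewrite -(size_map snd) eps size_take; have [//|le] := ltnP d (size t').
  by apply/eqP; rewrite eqn_leq le le_d.
have spec z : (exists b, z = (hc b : F, h b : F)) -> z.1 = 0 -> z.2 = 0.
  by move=> [b ->] /= /dc; exact: nilpotent_eq0.
have [| | | |k1 k2] := specialization_rank (graph_subring hc h) (@graph_base _ hc h) spec (ps := ps) (t0 := t0).
- by move=> _ /mapP [b _ ->]; exists b.
- by rewrite eps; exact: indep_take.
- by move=> _ [_ [b ->] <-] /=; apply: chart_range_acl; rewrite ec.
- by rewrite sps.
split=> [b hb|b]; first by apply: dc; exact: (k1 (hc b : F, h b : F)) (ex_intro _ b erefl) hb.
have k3 : acl (sset (take d t')) (h b : F) by rewrite -eps; apply: k2; exists (hc b : F, h b : F) => //; exists b.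
apply: acl_min k3.
have /= := @indep_span _ _ iota set0 t (take d t') it0; rewrite !set0U; apply.
  move=> x /ty xs; rewrite -eps; have := acl_min sub xs; apply: acl_min.
  by move=> _ /= /mapP [a _ ->]; apply: k2; exists (hc a : F, h a : F) => //; exists a.
by rewrite st size_take; case: ltnP => // /leq_trans; apply.
Qed.

(** Both points being dominant in one chart, [h b |-> h2 b] is an isomorphism of the rings they
    generate. As [k] is algebraically closed, stationarity extends it by the identity on the closure
    of a transcendence basis of [l]. *)
Lemma generic_transitive l y z : generic l y -> generic l z ->
  exists g : G, fixes g l /\ point_act A g y = z.
Proof.
move=> [t [st it ty]] [t' [st' it' tz]].
have [c [h hy]] := chart_ex y; have [c' [h' hz]] := chart_ex z.
rewrite -hy in ty *; rewrite -hz in tz *.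
have [dh ht] := generic_dominant st it ty; have [dh' _] := generic_dominant st' it' tz.
have [h2 [e2 dh2]] := dominant_spread h dh'; rewrite -e2 in tz *.
have [_ ht2] := generic_dominant st' it' tz.
pose S := [set w : F * F | exists b, w = (h b : F, h2 b : F)].
have sS : subring S by exact: graph_subring.
have bS : base_pairs `<=` S by exact: graph_base.
have gS : good S.
  move=> w /(ring_gen_min sS (fun _ => id)) [b ->] /=; split=> [/dh /nilpotent_eq0 -> //|hb].
  exists (h2 b : F)^-1; rewrite mulfV //; apply: contra_neq hb => /dh2; exact: nilpotent_eq0.
pose K := acl set0; have hK : inter K by exact: acl_inter.
have [beta [bl bi lb]] := indep_subseq_ex iota set0 l; rewrite set0U in lb.
have bl' : sset beta `<=` acl (sset l) by move=> x /(mem_subseq bl) xl; exact: sub_acl.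
(* The points are independent over [l]; by symmetry [beta] is independent over the points. *)
have ind (r : seq F) (h3 : kalg_hom (ch_alg c) FF) : indep (sset l) r ->
    (forall b, acl (sset r) (h3 b : F)) -> indep [set x : F | exists b, x = h3 b] beta.
  move=> ir hr; apply: (@indepS _ _ _ _ (sset r)); first by move=> _ [b ->].
  have : indep set0 (beta ++ r) by apply/indep_cat; split=> //; rewrite set0U; exact: indepS ir.
  by move=> /indep_catC /indep_cat; rewrite set0U => -[].
have gd : good (S `|` diag (acl (K `|` sset beta))).
  apply: stationarity => //.
  - by apply: acl_min.
  - by move=> [a b] [/= /acl_set0 [e <-] ->]; apply: bS; exists e.
  - have -> : fst @` S = [set x : F | exists b, x = h b].
      by apply/seteqP; split=> [_ [_ [b ->] <-]|_ [b ->]]; [exists b|exists (h b : F, h2 b : F) => //; exists b].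
    exact: ind it ht.
  - have -> : snd @` S = [set x : F | exists b, x = h2 b].
      by apply/seteqP; split=> [_ [_ [b ->] <-]|_ [b ->]]; [exists b|exists (h b : F, h2 b : F) => //; exists b].
    exact: ind it' ht2.
set S2 := S `|` _ in gd.
have Sl : fst @` S2 `<=` acl (sset (t ++ t' ++ l)) /\ snd @` S2 `<=` acl (sset (t ++ t' ++ l)).
  have dl : acl (K `|` sset beta) `<=` acl (sset (t ++ t' ++ l)).
    apply: acl_min => x [|/(mem_subseq bl) xl]; first by apply: aclS.
    by apply: sub_acl; rewrite /= !mem_cat xl !orbT.
  split=> _ [w [[b ->]|[/dl w1 w2]] <-] /=; rewrite ?w2 //.
    by apply: acl_ssetS (ht b) => x xt; rewrite mem_cat xt.
  by apply: acl_ssetS (ht2 b) => x xt; rewrite !mem_cat xt orbT.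
have [|||g hg] := homogeneity trdegF (S := S2) (s := t ++ t' ++ l).
- by apply: goodS gd => w [/bS|//]; left.
- by case: Sl.
- by case: Sl.
exists g; split=> [x xl|].
  apply: (hg (x, x)); right; split=> //=; apply: acl_min (lb _ xl).
  by move=> y0 y0b; apply: sub_acl; right.
rewrite point_act_fmap; apply: fmap_eq => b.
by apply: (hg (h b : F, h2 b : F)); left; exists b.
Qed.

(** Since [y = (x + y) - x], the coordinates of [x + y] span those of [y] over [l]; by Steinitz
    their rank is at least [d]. *)
Lemma generic_translate l x y : sset (coords x) `<=` acl (sset l) -> generic l y -> generic l (x + y).
Proof.
move=> xl [t [st it ty]].
have [t' [t's t'i st']] := indep_subseq_ex iota (sset l) (coords (x + y)).
have le_d : (d <= size t')%N.
  rewrite -st; apply: (steinitz it) => a /ty; apply: acl_min.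
  have := @coordsB (x + y) x; rewrite (addrC x) addrK => yx b /yx; apply: acl_min.
  move=> e; rewrite /= mem_cat => /orP [ec|ec]; first by apply: st'; rewrite /= (addrC x).
  by apply: aclS (xl _ ec); left.
exists (take d t'); split.
- by rewrite size_take; case: ltnP => // le; apply/eqP; rewrite eqn_leq le le_d.
- exact: indep_take.
- by move=> a /mem_take /(mem_subseq t's) h; exact: sub_acl.
Qed.

(** An automorphism carries [t0] to a sequence independent over [l], and [y0] to the point
    sought. *)
Lemma generic_ex l : exists y, generic l y.
Proof.
have [beta sb bi] := independent_seq trdegF l d.
have g0 : good (base_pairs `|` set0) by apply: (@good_graph F idfun) => z [[c ->]|].
have gz : good (base_pairs `|` (set0 `|` sset (zip t0 beta))).
  apply: good_zip => //; rewrite ?image_set0 //.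
  by apply: indepS bi => x [].
rewrite set0U in gz.
have [||g hg] := homogeneity trdegF (s := t0 ++ beta) gz.
- by rewrite fst_zip // => x xt; apply: sub_acl; rewrite /= mem_cat xt.
- by rewrite snd_zip // => x xt; apply: sub_acl; rewrite /= mem_cat xt orbT.
exists (point_act A g y0), beta; split=> //.
have [sub _] := coordinates_coords (coordinates_act g (coordsP y0)).
have bE : sset beta `<=` g @` sset t0.
  rewrite -(snd_zip (t := t0) (t' := beta)) // => _ [z zz <-]; rewrite -hg //.
  exists z.1 => //; rewrite -(fst_zip (t := t0) (t' := beta)) //; by exists z.
move=> x /bE [a /t0y /(acl_faut g) ha <-]; apply: acl_min ha => _ [b bc <-].
by apply: sub; apply/mapP; exists b.
Qed.

Lemma indep_faut (g : G) s : forall C, indep C s -> indep (g @` C) (map g s).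
Proof.
elim: s => [//|a s IH] C /= [na si]; split.
  move=> /(acl_faut g^-1%g); rewrite fautK => h; apply: na; apply: acl_min h.
  by move=> _ [_ [c Cc <-] <-]; rewrite fautK; exact: sub_acl.
by move: (IH _ si); rewrite image_setU image_set1.
Qed.

Lemma generic_act l y (g : G) : generic l y -> generic (map g l) (point_act A g y).
Proof.
move=> [t [st it ty]]; exists (map g t); split; first by rewrite size_map.
  apply: indepS (indep_faut g it) => x /= /mapP [z zl ->]; apply: sub_acl; by exists z.
move=> x /= /mapP [z zt ->]; have [sub _] := coordinates_coords (coordinates_act g (coordsP y)).
apply: acl_min (acl_faut g (ty z zt)) => _ [b bc <-].
by apply: sub; apply/mapP; exists b.
Qed.

End Dimension.

(** Read [gen l y] as: [y] is a generic point of [A] over the field generated by [l]. *)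
Lemma generic_points_ex : exists gen : seq F -> X -> Prop,
  [/\ forall l l' y, sset l' `<=` acl (sset l) -> gen l y -> gen l' y,
      forall l y y', gen l y -> sset (coords y) `<=` acl (sset (coords y')) -> gen l y',
      forall l y z, gen l y -> gen l z -> exists g : G, fixes g l /\ point_act A g y = z,
      forall l x y, sset (coords x) `<=` acl (sset l) -> gen l y -> gen l (x + y) &
      (forall l y (g : G), gen l y -> gen (map g l) (point_act A g y)) /\
      (forall l, exists y, gen l y)].
Proof.
have [c [h dh]] := dominant_ex.
have [t [ts it st]] := indep_subseq_ex iota set0 (coords (fmap A h (ch_pt c))); rewrite set0U in st.
have tsub : sset t `<=` acl (sset (coords (fmap A h (ch_pt c)))).
  by move=> x /(mem_subseq ts) xs; exact: sub_acl.
exists (generic t); split.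
- by move=> l l' y; exact: genericS.
- by move=> l y y'; exact: generic_acl.
- move=> l y z; exact: (@generic_transitive c h dh t st l y z).
- by move=> l x y; exact: generic_translate.
- by split=> [l y g|l]; [exact: generic_act|exact: (@generic_ex c h t it tsub l)].
Qed.

End GenericPoints.

(** * Tangent vectors and torsion *)

Section SquareZero.
Variables (F : fieldType) (V : lmodType F).

(** [V] will be an ideal of square zero: [F^o] gives the dual numbers, and [F^o * F^o] serves to add
    tangent vectors. *)
Definition square_zero : Type := (F * V)%type.
HB.instance Definition _ := GRing.Zmodule.copy square_zero (F * V)%type.

Definition sqz_one : square_zero := (1, 0).
Definition sqz_mul (x y : square_zero) : square_zero := (x.1 * y.1, x.1 *: y.2 + y.1 *: x.2).

Lemma sqz_mulA : associative sqz_mul.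
Proof.
move=> [a u] [b v] [c w]; rewrite /sqz_mul /= mulrA; congr pair.
by rewrite !scalerDr !scalerA addrA (mulrC c a) (mulrC c b).
Qed.

Lemma sqz_mulC : commutative sqz_mul.
Proof. by move=> [a u] [b v]; rewrite /sqz_mul /= mulrC addrC. Qed.

Lemma sqz_mul1 : left_id sqz_one sqz_mul.
Proof. by move=> [a u]; rewrite /sqz_mul /= mul1r scale1r scaler0 addr0. Qed.

Lemma sqz_mulDl : left_distributive sqz_mul +%R.
Proof.
move=> [a u] [b v] [c w]; rewrite /sqz_mul /=; congr pair; first by rewrite mulrDl.
by rewrite scalerDl scalerDr addrACA.
Qed.

Lemma sqz_one_neq0 : sqz_one != 0.
Proof. by apply/eqP => /(congr1 fst) /= /eqP; rewrite oner_eq0. Qed.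

HB.instance Definition _ := GRing.Zmodule_isComNzRing.Build square_zero
  sqz_mulA sqz_mulC sqz_mul1 sqz_mulDl sqz_one_neq0.

Definition sqz_incl (a : F) : square_zero := (a, 0).
Lemma sqz_incl_zmod : zmod_morphism sqz_incl.
Proof. by move=> a b; congr pair; rewrite subr0. Qed.
Lemma sqz_incl_monoid : monoid_morphism sqz_incl.
Proof. by split=> // a b; congr pair; rewrite !scaler0 addr0. Qed.
HB.instance Definition _ := GRing.isZmodMorphism.Build F square_zero sqz_incl sqz_incl_zmod.
HB.instance Definition _ := GRing.isMonoidMorphism.Build F square_zero sqz_incl sqz_incl_monoid.

Definition sqz_red (x : square_zero) : F := x.1.
Lemma sqz_red_zmod : zmod_morphism sqz_red. Proof. by []. Qed.
Lemma sqz_red_monoid : monoid_morphism sqz_red. Proof. by []. Qed.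
HB.instance Definition _ := GRing.isZmodMorphism.Build square_zero F sqz_red sqz_red_zmod.
HB.instance Definition _ := GRing.isMonoidMorphism.Build square_zero F sqz_red sqz_red_monoid.

Lemma sqz_unit (x : square_zero) : x.1 != 0 -> exists y, x * y = 1.
Proof.
move=> x0; exists (x.1^-1, - (x.1^-1 * x.1^-1) *: x.2); congr pair => /=; first exact: mulfV.
by rewrite scalerA mulrN mulrA mulfV // mul1r scaleNr addNr.
Qed.

Lemma sqz_horner (p : {poly square_zero}) (a : F) v :
  p.[(a, v)] = p.[sqz_incl a] + p^`().[sqz_incl a] * (0, v).
Proof.
have e2 : ((0, v) : square_zero) * (0, v) = 0.
  by congr pair; rewrite /= ?mul0r // !scale0r addr0.
have -> : ((a, v) : square_zero) = sqz_incl a + (0, v).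
  by congr pair; rewrite ?addr0 ?add0r.
elim/poly_ind: p => [|p c IH]; first by rewrite deriv0 !horner0 mul0r addr0.
rewrite derivMXaddC !(hornerE, hornerMXaddC) IH.
set e : square_zero := (0, v) in e2 *; set P := p.[_]; set P' := p^`().[_]; set i := sqz_incl a.
have -> : (P + P' * e) * (i + e) + c = P * i + c + (P + P' * i) * e + P' * (e * e) by ring.
by rewrite e2 mulr0 addr0.
Qed.

End SquareZero.

Section SquareZeroMap.
Variables (F : fieldType) (V W : lmodType F) (f : {linear V -> W}).

Definition sqz_map (x : square_zero V) : square_zero W := (x.1, f x.2).
Lemma sqz_map_zmod : zmod_morphism sqz_map.
Proof. by move=> x y; congr pair; rewrite raddfB. Qed.
Lemma sqz_map_monoid : monoid_morphism sqz_map.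
Proof. by split=> [|x y]; congr pair; rewrite ?raddf0 //= linearD !linearZZ. Qed.
HB.instance Definition _ := GRing.isZmodMorphism.Build _ _ sqz_map sqz_map_zmod.
HB.instance Definition _ := GRing.isMonoidMorphism.Build _ _ sqz_map sqz_map_monoid.

End SquareZeroMap.

(** * Derivations and infinitesimal points *)

Section Derivations.
Local Notation fmap := Defs.fmap.
Variables (k F : closedFieldType) (iota : {rmorphism k -> F}).
Local Notation acl := (acl iota).
Local Notation adjoin := (adjoin iota).
Local Notation inter := (intermediate_field iota).
Hypothesis char0 : [pchar k] =i pred0.
Hypothesis trdegF : countably_infinite_trdeg iota.
Local Notation S := (square_zero F^o).

Lemma acl_range (C : set F) (beta : nat -> F) x : acl (C `|` range beta) x ->
  exists n, acl (C `|` sset (mkseq beta n)) x.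
Proof.
move=> /acl_finitary [s [sC sx]].
suff [n hn] : exists n, sset s `<=` C `|` sset (mkseq beta n) by exists n; exact: aclS sx.
elim: s sC {sx} => [|a s IH] sC; first by exists 0%N.
have [x' xs|n hn] := IH; first by apply: sC; rewrite /= inE xs orbT.
have mono m p : (m <= p)%N -> sset (mkseq beta m) `<=` sset (mkseq beta p).
  move=> le z /= /mapP [i]; rewrite mem_iota add0n => /andP [_ lt] ->.
  by apply: map_f; rewrite mem_iota add0n (leq_trans lt).
have [Ca|[i _ ia]] := sC a (mem_head a s).
  by exists n => z /=; rewrite inE => /predU1P [->|/hn //]; left.
exists (maxn n i.+1) => z /=; rewrite inE => /predU1P [->|/hn [zC|zn]].
- right; apply: (mono i.+1); first exact: leq_maxr.
  by rewrite /= -ia; apply: map_f; rewrite mem_iota /=.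
- by left.
- by right; apply: mono zn; exact: leq_maxl.
Qed.

(** [sigma x] stands for [x + D x eps]: a derivation is a homomorphism to the dual numbers that
    lifts the identity, hence a case of [good_extension]. It starts as the derivative in [w] on
    [K[w]], with [K] the closure of a complementary basis, and extends to algebraic elements by
    separability. *)
Lemma derivation_ex w : ~ acl set0 w -> exists sigma : {rmorphism F -> S},
  [/\ forall x, (sigma x).1 = x, forall c, sigma (iota c) = sqz_incl _ (iota c) &
      (sigma w).2 != 0].
Proof.
move=> nw; have w1 : [set w] `<=` acl (sset [:: w]).
  by move=> _ ->; apply: sub_acl; rewrite /= inE eqxx.
have [beta [bi bs]] := basis_extension trdegF w1.
pose K := acl (range beta); have hK : inter K by exact: acl_inter.
have nKw : ~ K w.
  rewrite /K -(set0U (range beta)) => /acl_range [n].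
  elim: n => [|n IH]; first by rewrite sset_nil set0U.
  have -> : mkseq beta n.+1 = rcons (mkseq beta n) (beta n) by rewrite /mkseq -addn1 iotaD map_cat cats1.
  rewrite -cats1 sset_cat set0U => h; apply: (bi n); rewrite setUC.
  apply: acl_exchange; last by move=> h'; apply: IH; rewrite set0U.
  apply: aclS h => x [|/=]; first by left.
  by rewrite inE => /eqP ->; right.
pose Q := [set z : F * S | z.2.1 = z.1].
have sQ : subring Q.
  split=> // x y; rewrite /Q /= => hx hy.
    by rewrite -hx -hy.
  by rewrite -hx -hy.
have QV z y : Q z -> z * y = 1 -> Q y.
  rewrite /Q /= => hz zy; have e1 := congr1 fst zy; have e2 := congr1 (fun u => u.2.1) zy.
  have z0 : z.1 != 0 by apply/eqP => z0; move: e1 => /= /eqP; rewrite z0 mul0r eq_sym oner_eq0.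
  by apply: (mulfI z0); rewrite -{1}hz; move: e1 e2 => /= -> ->.
pose A0 := [set z : F * S | exists q : {poly F}, coefs_in K q /\ z = (q.[w], (q.[w], q^`().[w] : F^o))].
have sA0 : subring A0.
  split.
  - exists 1%:P; split; first exact: (coefs_inC hK (subring1 hK)).
    by rewrite derivC !hornerC.
  - move=> _ _ [p [hp ->]] [q [hq ->]]; exists (p - q); split; first exact: (coefs_inB hK hp hq).
    by rewrite derivB !hornerE.
  - move=> _ _ [p [hp ->]] [q [hq ->]]; exists (p * q); split; first exact: (coefs_inM hK hp hq).
    rewrite derivM !hornerE; congr (_, (_, _)) => /=.
    by rewrite addrC; congr (_ + _); exact: mulrC.
have A0Q : A0 `<=` Q by move=> _ [q [_ ->]].
have transc q : coefs_in K q -> q.[w] = 0 -> q = 0.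
  move=> hq /eqP qw; apply: contrapT => /eqP q0; apply: nKw.
  by apply: (@root_acl _ _ iota (range beta) q).
have g0 : good A0.
  move=> z /(ring_gen_min sA0 (fun _ => id)) [q [hq ->]] /=; split=> [/(transc _ hq) ->|qw].
    by rewrite deriv0 !horner0.
  exact: sqz_unit.
have domG G : partial_iso G -> A0 `<=` G -> inter (fst @` G).
  move=> hG AG; apply: partial_iso_domain hG _ => c.
  exists (iota c, (iota c, 0)) => //; apply: AG; exists (iota c)%:P.
  by rewrite derivC !hornerC; split=> //; apply: (coefs_inC hK); exact: inter_base.
have [|a G f hG AG GQ hf|G [hG AG GQ tot]] := good_extension sQ QV A0Q g0.
- move=> a G hG AG GQ; apply: (partial_iso_algebraic hG).
  have [p [p0 hp pa]] : acl (K `|` [set w]) a.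
    apply: acl_min (bs a) => x [->|xb]; first by apply: sub_acl; right.
    by apply: sub_acl; left; exact: sub_acl.
  exists p; split=> // i.
  have [z Gz zi] : (fst @` G) p`_i.
    apply: (adjoin_min (domG G hG AG)) (hp i) => x [Kx|->].
      exists (x, (x, 0)) => //; apply: AG; exists x%:P; rewrite derivC !hornerC.
      by split=> //; exact: (coefs_inC hK).
    exists (w, (w, 1 : F^o)) => //; apply: AG; exists 'X; rewrite derivX hornerX hornerC.
    by split=> //; exact: (coefs_inX hK).
  by exists z.
- have char0F : [pchar F] =i pred0 by move=> p; rewrite (fmorph_pchar iota) char0.
  have fs := min_poly_separable hG hf char0F; have [_ fG fa _] := hf.
  pose f2 := map_poly snd f.
  have red (p : {poly F * S}) : coefs_in G p -> (map_poly snd p).[sqz_incl _ a].1 = (map_poly fst p).[a].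
    move=> hp; rewrite -[LHS]/(sqz_red _) -horner_map /= -map_poly_comp; congr horner.
    by apply/polyP => i; rewrite !coef_map_id0 //; exact: (GQ _ (hp i)).
  pose m := f2.[sqz_incl _ a].2; pose e := (map_poly fst f^`()).[a].
  (* One Newton step from [a]: the error [m eps] is infinitesimal, and the derivative reduces to
     [e], nonzero by separability. *)
  exists (a, - m / e : F^o) => //.
  rewrite sqz_horner -/f2.
  have h1 : f2.[sqz_incl _ a].1 = 0 by rewrite red.
  have h2 : f2^`().[sqz_incl _ a].1 = e.
    have -> : f2^`() = map_poly snd f^`() by exact: deriv_map.
    rewrite red //; exact: (coefs_in_deriv (let: And3 s _ _ := hG in s)).
  rewrite [f2.[_]]surjective_pairing h1; congr pair => /=; first by rewrite mulr0 addr0.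
  rewrite h2 scale0r addr0 /GRing.scale /= mulrCA mulfV // mulr1; exact: subrr.
have [sigma hs] := partial_iso_total hG tot; have [sG G0 _] := hG.
have uniq x y : G (x, y) -> sigma x = y.
  move=> Gxy; have /G0 := subringB sG (hs x) Gxy; rewrite /= subrr => /(_ erefl) /(congr1 snd) /eqP.
  by rewrite /= subr_eq0 => /eqP.
exists sigma; split.
- by move=> x; exact: (GQ _ (hs x)).
- move=> c; apply: uniq; apply: AG; exists (iota c)%:P.
  by rewrite derivC !hornerC; split=> //; apply: (coefs_inC hK); exact: inter_base.
- rewrite (uniq w (w, 1 : F^o)) ?oner_neq0 //; apply: AG; exists 'X; rewrite derivX hornerX hornerC.
  by split=> //; exact: (coefs_inX hK).
Qed.

Section Infinitesimal.
Variable A : algebraic_group k.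
Local Notation FF := (field_kalg iota).

Definition sqz_kalg (V : lmodType F) : kalg k :=
  @KAlg k (square_zero V) (sqz_incl V \o iota).

Definition sqz_incl_hom (V : lmodType F) : kalg_hom FF (sqz_kalg V) :=
  @KAlgHom k FF (sqz_kalg V) (sqz_incl V) (fun _ => erefl).

Definition sqz_red_hom (V : lmodType F) : kalg_hom (sqz_kalg V) FF :=
  @KAlgHom k (sqz_kalg V) FF (@sqz_red F V) (fun _ => erefl).

Lemma sqz_hom_ex (V W : lmodType F) (f : V -> W) : linear f ->
  exists h : kalg_hom (sqz_kalg V) (sqz_kalg W), forall x, h x = (x.1, f x.2).
Proof.
move=> lf; pose l := GRing.isLinear.Build F V W *:%R f lf.
pose fl : {linear V -> W} := HB.pack f l.
have hc c : sqz_map fl (kalg_str (sqz_kalg V) c) = kalg_str (sqz_kalg W) c.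
  by congr pair; exact: raddf0.
by exists (@KAlgHom k (sqz_kalg V) (sqz_kalg W) (sqz_map fl) hc).
Qed.

(** An element of a square-zero extension is a unit when its reduction is, so a point lies in the
    chart as soon as its reduction does. *)
Lemma infinitesimal_chart (c : chart A) (h0 : kalg_hom (ch_alg c) FF) (V : lmodType F)
  (t : A (sqz_kalg V)) : fmap A h0 (ch_pt c) = fmap A (sqz_red_hom V) t ->
  exists h : kalg_hom (ch_alg c) (sqz_kalg V),
    fmap A h (ch_pt c) = t /\ forall b, (h b).1 = h0 b.
Proof.
move=> e; have [I hI] := ch_open c t.
have /hI /unit_ideal_field /(_ F iota (kalg_id FF)) [_ [i Ii <-] /= i0] :
    ch_set c (fmap A (sqz_red_hom V) t) by rewrite -e; exact: chart_point.
have [|h ht] := @ch_rep _ _ c _ t.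
  rewrite -(fmap_id1 (A := A) t); apply/hI; have [v iv] := sqz_unit i0.
  exists 1%N, (fun=> v), (fun=> i); split; first by move=> _; exists i.
  by rewrite big_ord1 mulrC.
exists h; split=> // b; have : kalg_comp h (sqz_red_hom V) =1 h0; last exact.
apply: ch_uniq; rewrite e -ht; apply/esym; exact: fmap_comp_eq.
Qed.

(** A tangent vector over [F + F^2] is determined by its two projections to [F + F]; hence
    the image of [t] under the diagonal is the sum of its images under the two inclusions. *)
Lemma tangent_mulrn (t : A (sqz_kalg F^o)) (n : nat) (h : kalg_hom (sqz_kalg F^o) (sqz_kalg F^o)) :
  fmap A (sqz_red_hom _) t = 0 -> (forall x, h x = (x.1, n%:R *: x.2)) ->
  fmap A h t = t *+ n.
Proof.
move=> t0.
have scale (a : F) : exists h : kalg_hom (sqz_kalg F^o) (sqz_kalg F^o), forall x, h x = (x.1, a *: x.2).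
  by apply: sqz_hom_ex => b x y; rewrite scalerDr !scalerA mulrC.
have zero (V : lmodType F) (f : kalg_hom (sqz_kalg F^o) (sqz_kalg V)) :
    (forall x, f x = (x.1, 0)) -> fmap A f t = 0.
  move=> hf; rewrite -(fmap_comp_eq (f := sqz_red_hom F^o) (g := sqz_incl_hom V)) ?t0 ?raddf0 //.
pose V2 : lmodType F := (F^o * F^o)%type.
have [i1 i1E] : exists h : kalg_hom (sqz_kalg F^o) (sqz_kalg V2), forall x, h x = (x.1, (x.2, 0)).
  by apply: (sqz_hom_ex (f := fun v => (v, 0) : V2)) => a x y; congr pair; rewrite /= ?scaler0 ?addr0.
have [i2 i2E] : exists h : kalg_hom (sqz_kalg F^o) (sqz_kalg V2), forall x, h x = (x.1, (0, x.2)).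
  by apply: (sqz_hom_ex (f := fun v => (0, v) : V2)) => a x y; congr pair; rewrite /= ?scaler0 ?addr0.
have [di diE] : exists h : kalg_hom (sqz_kalg F^o) (sqz_kalg V2), forall x, h x = (x.1, (x.2, x.2)).
  by apply: (sqz_hom_ex (f := fun v => (v, v) : V2)) => a x y.
have [p1 p1E] : exists h : kalg_hom (sqz_kalg V2) (sqz_kalg F^o), forall x, h x = (x.1, x.2.1).
  by apply: (sqz_hom_ex (f := fun v : V2 => v.1 : F^o)) => a x y.
have [p2 p2E] : exists h : kalg_hom (sqz_kalg V2) (sqz_kalg F^o), forall x, h x = (x.1, x.2.2).
  by apply: (sqz_hom_ex (f := fun v : V2 => v.2 : F^o)) => a x y.
have addition : fmap A di t = fmap A i1 t + fmap A i2 t.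
  have [c [h0 hz]] := chart_ex (0 : A FF).
  have [|g [gq g0]] := @infinitesimal_chart c h0 _ (fmap A i1 t + fmap A i2 t).
    rewrite raddfD /= !(fmap_comp_eq (h := sqz_red_hom F^o)) => [|r|r].
    - by rewrite t0 addr0.
    - by rewrite i2E.
    - by rewrite i1E.
  have [|ht [htt ht0]] := @infinitesimal_chart c h0 _ t; first by rewrite t0.
  have [z zE] := scale 0.
  have g1 : kalg_comp g p1 =1 ht.
    apply: ch_uniq; rewrite -(fmap_comp_eq (f := g) (g := p1)) // gq htt raddfD /=.
    rewrite (fmap_comp_eq (h := kalg_id _)) => [|r]; last by rewrite i1E p1E -surjective_pairing.
    rewrite fmap_id1 (fmap_comp_eq (h := z)) ?zero ?addr0 // => r; rewrite ?zE ?scale0r //.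
    by rewrite i2E p1E.
  have g2 : kalg_comp g p2 =1 ht.
    apply: ch_uniq; rewrite -(fmap_comp_eq (f := g) (g := p2)) // gq htt raddfD /= addrC.
    rewrite (fmap_comp_eq (h := kalg_id _)) => [|r]; last by rewrite i2E p2E -surjective_pairing.
    rewrite fmap_id1 (fmap_comp_eq (h := z)) ?zero ?addr0 // => r; rewrite ?zE ?scale0r //.
    by rewrite i1E p2E.
  rewrite -gq -htt; apply: fmap_comp_eq => b; rewrite diE.
  have := g1 b; have := g2 b; rewrite /= p1E p2E => <-.
  by move=> /(congr1 snd) /= e; rewrite [RHS]surjective_pairing [(g b).2]surjective_pairing e.
elim: n h => [|n IH] h hE.
  by rewrite mulr0n; apply: zero => x; rewrite hE scale0r.
have [s sE] := scale n%:R.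
(* On the diagonal [m] multiplies by [n.+1]; on the two inclusions it is the identity and
   multiplication by [n]. So [addition] gives the induction step. *)
have [m mE] : exists h : kalg_hom (sqz_kalg V2) (sqz_kalg F^o), forall x, h x = (x.1, x.2.1 + n%:R *: x.2.2).
  apply: (sqz_hom_ex (f := fun v : V2 => v.1 + n%:R *: v.2 : F^o)) => a x y /=; rewrite !scalerDr !scalerA [a * _]mulrC.
  by rewrite addrACA.
rewrite mulrS -(IH s sE) -(fmap_comp_eq (f := di) (g := m)); last first.
  by move=> r; rewrite diE mE hE mulrS scalerDl scale1r.
rewrite addition raddfD /= (fmap_comp_eq (h := kalg_id _)) => [|r]; last first.
  by rewrite i1E mE scaler0 addr0 -surjective_pairing.
by rewrite fmap_id1 (fmap_comp_eq (h := s)) // => r; rewrite i2E mE sE add0r.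
Qed.

(** Multiples of a tangent vector at 0 scale its coordinates, and [n.+1] is invertible in [F]. *)
Lemma tangent_torsion_free (t : A (sqz_kalg F^o)) (n : nat) :
  fmap A (sqz_red_hom _) t = 0 -> t *+ n.+1 = 0 -> t = 0.
Proof.
move=> t0 tn; have [c [h0 hz]] := chart_ex (0 : A FF).
have [|ht [htt ht0]] := @infinitesimal_chart c h0 _ t; first by rewrite t0.
have [s sE] : exists h : kalg_hom (sqz_kalg F^o) (sqz_kalg F^o), forall x, h x = (x.1, n.+1%:R *: x.2).
  by apply: sqz_hom_ex => b x y; rewrite scalerDr !scalerA mulrC.
have e : kalg_comp ht s =1 kalg_comp h0 (sqz_incl_hom F^o).
  apply: ch_uniq; rewrite -(fmap_comp_eq (f := ht) (g := s)) // htt (tangent_mulrn t0 sE) tn.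
  by rewrite -(fmap_comp_eq (f := h0) (g := sqz_incl_hom F^o)) // hz raddf0.
have n0 : n.+1%:R != 0 :> F.
  have char0F : [pchar F] =i pred0 by move=> p; rewrite (fmorph_pchar iota) char0.
  by rewrite ((pcharf0P F).1 char0F).
rewrite -htt -[RHS](raddf0 (fmap A (sqz_incl_hom F^o))) -hz.
apply/esym; apply: fmap_comp_eq => b; have := e b.
rewrite /= sE => /(congr1 snd) /= e2; rewrite -ht0 [RHS]surjective_pairing; congr pair.
by apply: (scalerI n0); rewrite e2 scaler0.
Qed.

Lemma base_of_multiple (x : A FF) (n : nat) (c : base_points A) :
  x *+ n.+1 = base_change iota A c -> exists c', base_change iota A c' = x.
Proof.
move=> xc; apply: (base_of_coords trdegF); apply: contrapT => nx.
have [w wx nw] : exists2 w, w \in coords x & ~ acl set0 w.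
  by apply: contrapT => no; apply: nx => w wx; apply: contrapT => nw; apply: no; exists w.
have [sigma [s1 s2 s3]] := derivation_ex nw.
have sk a : (sigma : {rmorphism FF -> sqz_kalg F^o}) (kalg_str FF a) = kalg_str (sqz_kalg F^o) a.
  exact: s2.
pose sh : kalg_hom FF (sqz_kalg F^o) := KAlgHom sk.
have : fmap A sh x - fmap A (sqz_incl_hom F^o) x = 0.
  (* [sigma x - x] reduces to 0, and [sigma] fixes [x *+ n.+1], which comes from [A(k)]. *)
  apply: (@tangent_torsion_free _ n).
    rewrite raddfB /= !(fmap_comp_eq (h := kalg_id _)) => [|r|r].
    - by rewrite subrr.
    - by [].
    - exact: s1.
  rewrite mulrnBl -!raddfMn xc /base_change.
  rewrite (fmap_comp_eq (g := sh) (h := kalg_comp (iota_hom iota) (sqz_incl_hom F^o))) => [|r]; last exact: s2.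
  by rewrite (fmap_comp_eq (h := kalg_comp (iota_hom iota) (sqz_incl_hom F^o))) // subrr.
have [ch [h [hx ex]]] := coordsP x.
move=> /eqP; rewrite subr_eq0 -hx => /eqP.
rewrite (fmap_comp_eq (g := sh) (h := kalg_comp h sh)) //.
rewrite (fmap_comp_eq (g := sqz_incl_hom F^o) (h := kalg_comp h (sqz_incl_hom F^o))) // => /ch_uniq e.
move: wx; rewrite ex => /mapP [b _ wb].
have := congr1 snd (e b); rewrite /= -wb => /eqP; by rewrite (negPf s3).
Qed.

End Infinitesimal.
End Derivations.

(** * Extensions *)

Lemma additive_eq (U V : zmodType) (f g : {additive U -> V}) : f =1 g -> f = g.
Proof.
move=> e; case: f g e => [f [[cf]]] [g [[cg]]] /= /funext e; subst g.
by rewrite (Prop_irrelevance cf cg).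
Qed.

Section Pushouts.
Variables (G : groupType) (W N N' : gmodule G) (f : ghom N N').
Variables (E : extension W N) (E' : extension W N').

Lemma push_mk_in n : push_mk (E := E) f 0 (ext_in E n) = ext_in (ext_push f E) (f n).
Proof. by apply/push_mk_eq; exists (- n); rewrite !raddfN sub0r opprK subr0. Qed.

(** Together with [push_hom_ex] this replaces computations in the quotient: a class is the pushout
    along [f] exactly when [E] maps to [E'] over [W], extending [f]. *)
Lemma push_universal (m : ghom (ext_mid E) (ext_mid E')) :
  (forall e, ext_out E' (m e) = ext_out E e) -> (forall n, m (ext_in E n) = ext_in E' (f n)) ->
  ext_class (ext_push f E) = ext_class E'.
Proof.
move=> mout min; apply/ext_classP.
pose F (z : push_mid f E) : ext_mid E' :=
  let w := repr (z : Quotient.quot (subspace_closed (push_subspace f E))) in ext_in E' w.1 + m w.2.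
have FE x e : F (push_mk (E := E) f x e) = ext_in E' x + m e.
  have : push_mk (E := E) f (repr (push_mk (E := E) f x e : Quotient.quot (subspace_closed (push_subspace f E)))).1
       (repr (push_mk (E := E) f x e : Quotient.quot (subspace_closed (push_subspace f E)))).2 = push_mk (E := E) f x e.
    by rewrite {1}/push_mk -surjective_pairing /lproj reprK.
  move=> /push_mk_eq [n [h1 h2]]; rewrite /F; apply/eqP; rewrite -subr_eq0 opprD addrACA -!raddfB /=.
  by rewrite h1 h2 raddfN /= min subrr.
have Fl : linear F.
  move=> a z z'; have [x [e <-]] := push_mk_surj z; have [x' [e' <-]] := push_mk_surj z'.
  by rewrite push_mkP !FE !linearP /= scalerDr addrACA.
pose FL : {linear push_mid f E -> ext_mid E'} :=
  HB.pack F (GRing.isLinear.Build rat _ _ *:%R F Fl).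
have FP g z : FL (gact g z) = gact g (FL z).
  have [x [e <-]] := push_mk_surj z.
  by rewrite push_mk_act /= !FE raddfD /= !ghomP.
exists (GHom FP); split=> [x|z] /=; first by rewrite [LHS]FE raddf0 addr0.
have [x [e <-]] := push_mk_surj z.
rewrite FE raddfD /= mout; have -> : ext_out E' (ext_in E' x) = 0 by apply/ext_exact; exists x.
by rewrite add0r; apply/esym; exact: push_out_mk.
Qed.

Definition push_inr (e : ext_mid E) : push_mid f E := push_mk f 0 e.

Lemma push_inr_linear : linear push_inr.
Proof. by move=> a x y; rewrite /push_inr push_mkP scaler0 addr0. Qed.

HB.instance Definition _ :=
  GRing.isLinear.Build rat (ext_mid E) (push_mid f E) *:%R push_inr push_inr_linear.

Lemma push_inrP g e : push_inr (gact g e) = gact g (push_inr e).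
Proof. by rewrite /push_inr push_mk_act raddf0. Qed.

Definition push_hom : ghom (ext_mid E) (ext_mid (ext_push f E)) :=
  @GHom _ _ (push_mid f E) [the {linear _ -> _} of push_inr] push_inrP.

Lemma push_hom_in n : push_hom (ext_in E n) = ext_in (ext_push f E) (f n).
Proof. exact: push_mk_in. Qed.

End Pushouts.

Lemma push_hom_ex (G : groupType) (W N N' : gmodule G) (f : ghom N N') (E : extension W N)
    (E' : extension W N') : ext_class (ext_push f E) = ext_class E' ->
  exists m : ghom (ext_mid E) (ext_mid E'),
    (forall e, ext_out E' (m e) = ext_out E e) /\ (forall n, m (ext_in E n) = ext_in E' (f n)).
Proof.
move=> /ext_classP [h [h1 h2]].
have mP g v : (h \o push_hom f E) (gact g v) = gact g ((h \o push_hom f E) v).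
  by rewrite /= (ghomP (push_hom f E)) ghomP.
exists (@GHom _ _ _ [the {linear _ -> _} of h \o push_hom f E] mP); split=> [e|n] /=.
  by rewrite h2; exact: push_out_mk.
by rewrite -h1 -push_mk_in.
Qed.

Lemma hom_diff (G : groupType) (W N N' : gmodule G) (E : extension W N) (E' : extension W N')
    (m m' : ghom (ext_mid E) (ext_mid E')) : (forall e, ext_out E' (m e) = ext_out E e) ->
  (forall e, ext_out E' (m' e) = ext_out E e) -> forall e, exists n, ext_in E' n = m e - m' e.
Proof. by move=> mo mo' e; apply/ext_exact; rewrite raddfB /= mo mo' subrr. Qed.

(** * Divisibility of [W_A] and the connecting map *)

Section Extensions.
Local Notation fmap := Defs.fmap.
Local Notation frac := Defs.frac.
Variables (k F : closedFieldType) (iota : {rmorphism k -> F}).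
Local Notation acl := (acl iota).
Local Notation G := (faut iota).
Hypothesis char0 : [pchar k] =i pred0.
Hypothesis trdegF : countably_infinite_trdeg iota.

Lemma fixes_adjoin (g : G) s : fixes g s -> fixing_subgroup (adjoin iota (sset s)) g.
Proof. by move=> gs x; apply: (adjoin_min (fixed_inter g)). Qed.

(** The complement of an open subgroup is a union of cosets, hence open. *)
Lemma smooth_continuous (M : gmodule G) : smooth M -> continuous_module M.
Proof.
move=> sM v; suff o : open (~` gstabilizer v) by rewrite -(setCK (gstabilizer v)); exact: open_closedC.
move=> g ng.
have [s hs] := sM v 1%g (gact1 v); exists s => h /hs; rewrite mul1g /= => hv hg.
by apply: ng; move: hg; rewrite /gstabilizer /= gactM [gact h v]hv.
Qed.

Lemma closed_stabilizer (M : gmodule G) (v : M) (g : G) : closed (gstabilizer v) ->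
  (forall t : seq F, exists h : G, gact h v = v /\ forall x, x \in t -> h x = g x) -> gact g v = v.
Proof.
move=> /closed_openC cl hg; apply: contrapT => ng; have [s hs] := cl g ng.
have [h [hv hx]] := hg s; have /hs : fixing_subgroup (adjoin iota [set x | x \in s]) (g^-1 * h)%g.
  by apply: fixes_adjoin => x xs; rewrite -[LHS]/(g^-1%g (h x)) hx // fautK.
by rewrite mulgA mulgV mul1g; apply.
Qed.

Variable A : algebraic_group k.
Hypothesis irrA : irreducible_space A.
Local Notation X := (ext_points iota A).
Local Notation act := (point_act A).
Implicit Types (x y z : X).

(** An automorphism fixing [y *+ n.+1] moves [y] by a torsion point, which comes from [A(k)], so it
    keeps the coordinates inside the closure of [coords y]. Hence multiples of generic points are
    generic. *)
Lemma coords_mulrn y n : sset (coords y) `<=` acl (sset (coords (y *+ n.+1))).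
Proof.
move=> w wy; apply: contrapT => nw.
have [g [gs ngw]] := moved_by_automorphism trdegF (coords y) nw; apply: ngw.
have /(base_of_multiple char0 trdegF) [c hc] : (act g y - y) *+ n.+1 = base_change iota A 0.
  by rewrite mulrnBl -raddfMn /= (coords_fixed g _).1 // subrr raddf0.
have /coordinates_coords - /(_ trdegF) [sub _] := coordinates_act g (coordsP y).
have gw : acl (sset (coords (act g y))) (g w) by apply: sub; apply/mapP; exists w.
apply: acl_min gw; rewrite -[act g y](subrK y) -hc => x /(coordsD trdegF); apply: acl_min => b.
rewrite /= mem_cat => /orP [/(coords_base trdegF)|by_]; last exact: sub_acl.
exact: aclS.
Qed.

Lemma points_divisible x n : exists z, z *+ n.+1 = x.
Proof.
have [gen [_ genA genT genD [_ genE]]] := generic_points_ex char0 trdegF irrA.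
have [y gy] := genE (coords x).
have gny : gen (coords x) (y *+ n.+1) by apply: genA gy _; exact: coords_mulrn.
have [g [_ hg]] := genT _ _ _ gny (genD _ x _ (@sub_acl _ _ _ _) gny).
by exists (act g y - y); rewrite mulrnBl -raddfMn /= hg addrK.
Qed.

Lemma WA_divisible : uniquely_divisible (WA iota A).
Proof.
move=> [//|n] _.
have inj : injective (fun w : WA iota A => w *+ n.+1).
  suff ker (w : WA iota A) : w *+ n.+1 = 0 -> w = 0.
    by move=> v w /= e; apply/eqP; rewrite -subr_eq0; apply/eqP/ker; rewrite mulrnBl e subrr.
  have [x <-] := WA_proj_surj w; rewrite -raddfMn => /WA_proj_eq0 [c hc]; apply/WA_proj_eq0.
  exact: (base_of_multiple char0 trdegF (esym hc)).
have surj w : exists v : WA iota A, v *+ n.+1 = w.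
  have [x <-] := WA_proj_surj w; have [z <-] := points_divisible x n.
  by exists (WA_proj iota A z); rewrite raddfMn.
by have [f hf] := choice surj; exists f => [w|//]; apply: inj; exact: hf.
Qed.

Lemma invariant_additive (V : zmodType) (f : {additive X -> V}) :
  (forall (g : G) x, f (act g x) = f x) -> forall x, f x = 0.
Proof.
move=> inv x.
have [gen [_ _ genT genD [_ genE]]] := generic_points_ex char0 trdegF irrA.
have [y gy] := genE (coords x).
have [g [_ hg]] := genT _ _ _ gy (genD _ x _ (@sub_acl _ _ _ _) gy).
by have := inv g y; rewrite hg raddfD /= -[RHS]add0r => /addIr.
Qed.

Variable hW : uniquely_divisible (WA iota A).
Local Notation W := (WA_module hW).
Local Notation Q := (Q_module iota).
Local Notation proj := (WA_proj_module hW).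
Local Notation base := (base_points A).
Local Notation E0 := (tensor_extension hW).

Lemma ext_kernel (E : extension W Q) e : ext_out E e = 0 -> exists q : rat^o, ext_in E q = e.
Proof. by move=> /ext_exact [q <-]; exists q. Qed.

Lemma connecting_smooth (phi : {additive base -> rat^o}) :
  smooth (ext_mid (ext_push (functional_hom iota phi) E0)).
Proof.
move=> v; have [q [e <-]] := push_mk_surj v; have [m [a ->]] := frac_ex e.
move=> g gv; exists (coords m) => h hm; rewrite /gstabilizer /mkset gactM.
suff -> : gact h (push_mk (E := E0) (functional_hom iota phi) q (frac m a)) = push_mk (E := E0) (functional_hom iota phi) q (frac m a).
  exact: gv.
rewrite push_mk_act /= /tensor_act tensorQ_map_frac (coords_fixed h m).1 //.
by move=> x xm; apply: hm; exact: sub_adjoin.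
Qed.

(** Equal classes give two maps over [W] from [E0] to one extension. On [A(F)] they differ by an
    invariant additive map to the rationals, hence by zero; on [A(k)] the difference is
    [phi - psi]. *)
Lemma connecting_inj : injective (connecting hW : {additive base -> rat^o} -> Ext1 W Q).
Proof.
move=> phi psi /push_hom_ex [m [mout min]]; apply: additive_eq => c.
have [m' [mout' min']] := push_hom_ex (erefl (connecting hW psi)).
move: (ext_push _ _) m mout min m' mout' min' => E m mout min m' mout' min'.
have [u hu] := choice (fun x => hom_diff mout mout' (frac1 x)).
have uz : zmod_morphism (u : X -> rat^o).
  move=> x y; apply: (@ext_in_inj _ _ _ E); rewrite raddfB /= !hu !raddfB /=.
  exact: addrACA.
pose ua : {additive X -> rat^o} := HB.pack (u : X -> rat^o) (GRing.isZmodMorphism.Build _ _ u uz).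
have u0 x : u x = 0.
  apply: (@invariant_additive _ ua) => g {}x; apply: (@ext_in_inj _ _ _ E); rewrite /= !hu.
  have -> : frac1 (act g x) = gact g (frac1 x : points_module iota A).
    by rewrite /= /tensor_act tensorQ_map_frac.
  rewrite !ghomP -raddfB /= -hu; exact: (esym (ghomP (ext_in E) g (u x))).
have := hu (base_change iota A c); rewrite u0 raddf0 => /esym /eqP; rewrite subr_eq0 => /eqP.
have -> : frac1 (base_change iota A c) = ext_in E0 (frac1 c) by rewrite /= tensorQ_map_frac.
rewrite min min' => /(@ext_in_inj _ _ _ E).
by rewrite /= !tensorQ_lift_frac invr1 !scale1r.
Qed.

(** The maps [m1], [m2] and the projection to [W] land together in the pullback along the diagonal;
    followed by the pushout along addition, they restrict to [phi + psi]. *)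
Lemma connectingD (phi psi : {additive base -> rat^o}) :
  connecting hW (phi \+ psi) = Ext1_add (connecting hW phi) (connecting hW psi).
Proof.
have [m1 [o1 i1]] := push_hom_ex (esym (ext_reprK (connecting hW phi))).
have [m2 [o2 i2]] := push_hom_ex (esym (ext_reprK (connecting hW psi))).
rewrite /Ext1_add /baer_sum; set E1 := ext_repr _ in m1 o1 i1 *; set E2 := ext_repr _ in m2 o2 i2 *.
set D := ext_pull _ _; pose P := prod_gmodule (prod_gmodule (ext_mid E1) (ext_mid E2)) W.
have mem e : subspace_pred (pull_subspace (diag_hom W) (ext_sum E1 E2)) (((m1 e, m2 e), ext_out E0 e) : P).
  by apply/asboolP; rewrite /= /pull_set /= /sum_out /= o1 o2.
pose d (e : ext_mid E0) : ext_mid D := SubCarrier (mem e).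
have dl : linear d by move=> a x y; apply: val_inj => /=; rewrite !linearP.
pose dL : {linear ext_mid E0 -> ext_mid D} := HB.pack d (GRing.isLinear.Build rat _ _ *:%R d dl).
have dP g v : dL (gact g v) = gact g (dL v).
  by apply: val_inj; congr (_, _, _); exact: ghomP.
pose dG := GHom dP; pose pD := push_hom (codiag_hom Q) D.
have mP g v : (pD \o dG) (gact g v) = gact g ((pD \o dG) v).
  exact: etrans (congr1 pD (dP g v)) (ghomP pD g (d v)).
apply: (@push_universal _ _ _ _ _ E0 _ (@GHom _ _ _ [the {linear _ -> _} of pD \o dG] mP)) => [e|n].
  exact: push_out_mk.
have dE : dG (ext_in E0 n) =
    ext_in D ((functional_hom iota phi n, functional_hom iota psi n) : prod_gmodule Q Q).
  apply: val_inj => /=; rewrite /sum_in /= -i1 -i2.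
  by congr pair; apply/(@ext_exact _ _ _ E0); exists n.
apply: etrans (congr1 pD dE) _; rewrite push_hom_in; congr (ext_in _ _).
have [c [a ->]] := frac_ex n.
by rewrite /= /codiag_fun /= !tensorQ_lift_frac scalerDr.
Qed.

(** * Continuous extensions as pushouts *)

Section Splitting.
Variable E : extension W Q.
Hypothesis cE : continuous_module (ext_mid E).

Lemma trivial_in g q : gact g (ext_in E q) = ext_in E q.
Proof. by rewrite -ghomP. Qed.

Lemma out_act g e y : ext_out E e = proj y -> ext_out E (gact g e) = proj (act g y).
Proof. by move=> ey; rewrite ghomP ey [LHS]WA_act_proj. Qed.

Lemma lift_ex y : exists e, ext_out E e = proj y.
Proof. exact: ext_out_surj. Qed.

(** [g |-> g e - e] is a character of the stabilizer of [y] with closed kernel. *)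
Lemma lift_fixed (g : G) y e : ext_out E e = proj y -> act g y = y -> gact g e = e.
Proof.
move=> ey gy.
have hchi (h : G) : exists q : rat^o, fixes h (coords y) -> ext_in E q = gact h e - e.
  have [hy|nh] := pselect (fixes h (coords y)); last by exists 0.
  have [q hq] : exists q, ext_in E q = gact h e - e.
    by apply/ext_exact; rewrite raddfB /= (out_act h ey) (coords_fixed h y).1 // ey subrr.
  by exists q.
have [chi hc] := choice hchi.
have chi0 h : fixes h (coords y) -> chi h = 0 -> gact h e = e.
  by move=> hy h0; have /eqP := hc h hy; rewrite h0 raddf0 eq_sym subr_eq0 => /eqP.
have gc : fixes g (coords y) by apply/coords_fixed.
apply: (chi0 g) => //.
apply: (continuous_character_trivial char0 trdegF (s := coords y) (chi := chi : G -> rat)) => // [h h' hs hs'|h hs cl].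
  apply: (@ext_in_inj _ _ _ E); rewrite [RHS]raddfD /= !hc //; last exact: fixesM.
  (* [h] acts trivially on [gact h' e - e], which comes from the trivial submodule. *)
  have -> : gact h e - e + (gact h' e - e) = gact h e - e + gact h (gact h' e - e).
    by congr (_ + _); rewrite -(hc h') // trivial_in.
  by rewrite gactM raddfB /= [RHS]addrC addrA subrK.
apply: (@ext_in_inj _ _ _ E); rewrite raddf0 hc //; apply/eqP; rewrite subr_eq0; apply/eqP.
apply: (closed_stabilizer (@cE e)) => t; have [h' [hs' h0 ht]] := cl t.
by exists h'; split=> //; exact: chi0.
Qed.

(** Two lifts differ by an element of the trivial submodule. *)
Lemma lift_diff (g : G) e e' : ext_out E e = ext_out E e' -> gact g e' - e' = gact g e - e.
Proof.
move=> ee; have /ext_exact [q hq] : ext_out E (e' - e) = 0 by rewrite raddfB /= ee subrr.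
have -> : e' = e + ext_in E q by rewrite hq addrC subrK.
by rewrite raddfD /= trivial_in opprD addrACA subrr addr0.
Qed.

Section Generic.
Variable gen : seq F -> X -> Prop.
Hypothesis genS : forall l l' y, sset l' `<=` acl (sset l) -> gen l y -> gen l' y.
Hypothesis genT : forall l y z, gen l y -> gen l z -> exists g : G, fixes g l /\ act g y = z.
Hypothesis genD : forall l x y, sset (coords x) `<=` acl (sset l) -> gen l y -> gen l (x + y).
Hypothesis genG : forall l y (g : G), gen l y -> gen (map g l) (act g y).
Hypothesis genE : forall l, exists y, gen l y.

(** A relation rather than a function, so that additivity and equivariance can be proved with
    whichever [y], [e] and [g] are convenient. *)
Definition section_at x v : Prop := exists y e (g : G),
  [/\ gen (coords x) y, ext_out E e = proj y, act g y = x + y & v = gact g e - e].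

Lemma section_at_out x v : section_at x v -> ext_out E v = proj x.
Proof.
by move=> [y [e [g [_ ey gy ->]]]]; rewrite raddfB /= (out_act g ey) gy ey raddfD addrK.
Qed.

(** [h] carries the first generic point to the second and fixes [x], hence fixes [v] by
    [lift_fixed]. There remain two automorphisms with the same effect on [y]; they differ by [w],
    which fixes [y] and so its lift. *)
Lemma section_at_uniq x v v' : section_at x v -> section_at x v' -> v = v'.
Proof.
move=> sv [y' [e' [g' [gy' ey' hg' ->]]]]; have vx := section_at_out sv.
move: sv => [y [e [g [gy ey hg ev]]]].
have [h [hx hy]] := genT gy gy'; have hxx : act h x = x by apply/coords_fixed.
rewrite -[v](lift_fixed vx hxx) ev.
have ehe : ext_out E (gact h e) = ext_out E e' by rewrite (out_act h ey) hy.
rewrite (lift_diff g' ehe) raddfB /=; congr (_ - _).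
have [w hw] : exists w : G, w = ((h * g)^-1 * (g' * h))%g by exists ((h * g)^-1 * (g' * h))%g.
have ehg : (g' * h = h * g * w)%g by rewrite hw mulVKg.
have wy : act w y = y.
  rewrite hw !point_actM hy hg' -hy -{1}hxx -raddfD -hg -(point_actM h g) -point_actM mulVg; exact: point_act1.
by rewrite -[RHS]gactM ehg gactM (lift_fixed ey wy) gactM.
Qed.

Lemma section_at_ex x : exists v, section_at x v.
Proof.
have [y gy] := genE (coords x); have [e ey] := lift_ex y.
have [g [_ hg]] := genT gy (genD (x := x) (@sub_acl _ _ _ _) gy).
by exists (gact g e - e), y, e, g.
Qed.

(** With one [y] generic over both points, [g'] carries [y] to [x' + y] and [g] carries this to
    [x + (x' + y)]; the two differences telescope. *)
Lemma section_atD x x' v v' : section_at x v -> section_at x' v' -> section_at (x + x') (v + v').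
Proof.
move=> sv sv'; pose l := coords x ++ coords x'; have [y gy] := genE l.
have xl : sset (coords x) `<=` acl (sset l).
  by move=> z zx; apply: sub_acl; rewrite /= mem_cat zx.
have x'l : sset (coords x') `<=` acl (sset l).
  by move=> z zx; apply: sub_acl; rewrite /= mem_cat zx orbT.
have [e ey] := lift_ex y; have gy1 := genD x'l gy; have gy2 := genD xl gy1.
have [g' [_ hg']] := genT gy gy1; have [g [_ hg]] := genT gy1 gy2.
have -> : v' = gact g' e - e.
  by apply: section_at_uniq sv' _; exists y, e, g'; split=> //; exact: genS gy.
have -> : v = gact g (gact g' e) - gact g' e.
  apply: section_at_uniq sv _; exists (x' + y), (gact g' e), g; split=> //; first exact: genS gy1.
  by rewrite (out_act g' ey) hg'.
exists y, e, (g * g')%g; split=> //.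
- by apply: genS gy; exact: (coordsD trdegF).
- by rewrite point_actM hg' hg addrA.
- by rewrite gactM addrA subrK.
Qed.

Lemma section_at_act x v (a : G) : section_at x v -> section_at (act a x) (gact a v).
Proof.
move=> [y [e [g [gy ey hg ->]]]]; exists (act a y), (gact a e), (a * g * a^-1)%g; split.
- apply: genS (genG a gy).
  exact: (coordinates_coords trdegF (coordinates_act a (coordsP x))).2.
- exact: out_act.
- by rewrite -point_actM mulgVK point_actM hg raddfD.
- by rewrite -gactM mulgVK gactM raddfB.
Qed.

Lemma continuous_connecting_generic : exists phi, connecting hW phi = ext_class E.
Proof.
have [s hs] := choice section_at_ex.
have sD x y : s (x + y) = s x + s y.
  by apply: section_at_uniq (hs _) _; exact: section_atD.
have sz : zmod_morphism (s : X -> ext_mid E).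
  by move=> x y; apply/eqP; rewrite eq_sym subr_eq -sD subrK.
pose sa : {additive X -> ext_mid E} := HB.pack (s : X -> ext_mid E) (GRing.isZmodMorphism.Build _ _ s sz).
have sG (a : G) x : s (act a x) = gact a (s x).
  by apply: section_at_uniq (hs _) _; exact: section_at_act.
have sout x : ext_out E (s x) = proj x by exact: section_at_out.
have base_in c : exists q : rat^o, ext_in E q = s (base_change iota A c).
  by apply: ext_kernel; rewrite sout; apply/WA_proj_eq0; exists c.
have [phi hphi] := choice base_in.
have phiz : zmod_morphism (phi : base -> rat^o).
  by move=> c d; apply: (@ext_in_inj _ _ _ E); rewrite raddfB /= !hphi raddfB /= sz.
pose phia : {additive base -> rat^o} := HB.pack (phi : base -> rat^o) (GRing.isZmodMorphism.Build _ _ phi phiz).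
have mP g v : tensorQ_lift sa (gact g v : points_module iota A) = gact g (tensorQ_lift sa v).
  have [x [a ->]] := frac_ex v.
  by rewrite /= /tensor_act tensorQ_map_frac !tensorQ_lift_frac linearZ /= sG.
exists phia; apply: (@push_universal _ _ _ _ _ E0 E (@GHom _ (points_module iota A) _ [the {linear _ -> _} of tensorQ_lift sa] mP)) => e.
  have [x [a ->]] := frac_ex e.
  by rewrite /= !tensorQ_lift_frac linearZ /= sout.
have [c [a ->]] := frac_ex e.
by rewrite /= tensorQ_map_frac !tensorQ_lift_frac linearZ /= -hphi.
Qed.

End Generic.

Lemma continuous_connecting : exists phi, connecting hW phi = ext_class E.
Proof.
have [gen [genS _ genT genD [genG genE]]] := generic_points_ex char0 trdegF irrA.
exact: (continuous_connecting_generic genS genT genD genG genE).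
Qed.

End Splitting.
End Extensions.

Theorem corollary5p2 (k F : closedFieldType) (iota : {rmorphism k -> F})
    (char0 : [pchar k] =i pred0)
    (trdegF : countably_infinite_trdeg iota)
    (A : algebraic_group k) (irrA : irreducible_space A) :
  exists hW : uniquely_divisible (WA iota A),
    [/\ forall c : Ext1 (WA_module hW) (Q_module iota),
          Ext1_smooth c <-> Ext1_cont c,
        forall c : Ext1 (WA_module hW) (Q_module iota),
          Ext1_cont c <->
          exists phi : {additive base_points A -> rat^o}, connecting hW phi = c,
        injective (connecting hW) &
        forall phi psi : {additive base_points A -> rat^o},
          connecting hW (phi \+ psi) =
          Ext1_add (connecting hW phi) (connecting hW psi)].
Proof.
exists (WA_divisible char0 trdegF irrA); set hW := WA_divisible _ _ _.
(* The comparison is a cycle: continuous, of the form [connecting hW phi], smooth, continuous. *)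
have cont_conn (c : Ext1 (WA_module hW) (Q_module iota)) : Ext1_cont c ->
    exists phi : {additive base_points A -> rat^o}, connecting hW phi = c.
  by move=> [E [<- cE]]; exact: continuous_connecting.
have conn_smooth (phi : {additive base_points A -> rat^o}) : Ext1_smooth (connecting hW phi).
  by exists (ext_push (functional_hom iota phi) (tensor_extension hW)); split=> //; exact: connecting_smooth.
have smooth_cont (c : Ext1 (WA_module hW) (Q_module iota)) : Ext1_smooth c -> Ext1_cont c.
  by move=> [E [<- sE]]; exists E; split=> //; exact: smooth_continuous.
split.
- by move=> c; split=> [/smooth_cont //|/cont_conn [phi <-]].
- by move=> c; split=> [/cont_conn //|[phi <-]]; exact: smooth_cont.
- exact: connecting_inj.
- exact: connectingD.
Qed.
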